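(* Let $G$ be a Lie group and let $G\circledS\mathfrak g$ act on $T^*TG\simeq(G\circledS\mathfrak g_1)\circledS(\mathfrak g_2^*\times\mathfrak g_3^* )$ by $((h,\eta,\mu,\nu);(g,\xi))\mapsto(hg,\eta+\mathrm{Ad}_h\xi,\mu,\nu)$. The (Marsden-Weinstein) symplectic reduction of $T^*TG$ under this action at the momentum value $(\mu,\nu)\in\mathfrak g_2^*\times\mathfrak g_3^*$ results in the coadjoint orbit $\mathcal O_{(\mu,\nu)}$ in $\mathfrak g_2^*\times\mathfrak g_3^*$ through the point $(\mu,\nu)$. The reduced symplectic two-form $\Omega_{\mathcal O_{(\mu,\nu)}}$ takes the value $$\big\langle\Omega_{\mathcal O_{(\mu,\nu)}};(\eta,\zeta),(\bar\eta,\bar\zeta)\big\rangle(\mu,\nu)=\langle\mu,[\bar\eta,\eta]\rangle+\langle\nu,[\bar\eta,\zeta]-[\eta,\bar\zeta]\rangle$$ on two vectors $(\eta,\zeta)$ and $(\bar\eta,\bar\zeta)$ in $T_{(\mu,\nu)}\mathcal O_{(\mu,\nu)}$.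
   Context: $G$ is a (finite-dimensional) Lie group with identity $e$, $\mathfrak g=T_eG$; $\mathfrak g_i,\mathfrak g_i^*$ are copies of $\mathfrak g,\mathfrak g^*$. $R_g$ is right multiplication, $T_e^*R_g:T_g^*G\to\mathfrak g^*$ the dual of $T_eR_g$. $\mathrm{Ad}_g=T_e(h\mapsto ghg^{-1})$, $\mathrm{ad}_\xi\eta=[\xi,\eta]=\frac{d}{dt}|_{t=0}\mathrm{Ad}_{\exp t\xi}\eta$, $\langle\mathrm{Ad}^*_g\mu,\xi\rangle=\langle\mu,\mathrm{Ad}_{g^{-1}}\xi\rangle$, $\langle\mathrm{ad}^*_\xi\mu,\eta\rangle=-\langle\mu,[\xi,\eta]\rangle$. $TG$ is identified with $G\circledS\mathfrak g$ by $V_g\mapsto(g,T_gR_{g^{-1}}V_g)$, with group law $(g,\xi)(h,\eta)=(gh,\xi+\mathrm{Ad}_g\eta)$ and Lie algebra $\mathfrak g\circledS\mathfrak g$ with bracket $[(\xi_1,\xi_2),(\eta_1,\eta_2)]=([\xi_1,\eta_1],[\xi_1,\eta_2]-[\eta_1,\xi_2])$. $T^*TG=T^*(G\circledS\mathfrak g)$ is identified with $G\times\mathfrak g_1\times\mathfrak g_2^*\times\mathfrak g_3^*$ by sending a covector $(\alpha_g,\alpha_\xi)$ at $(g,\xi)$ to $(g,\xi,T_e^*R_g\alpha_g+\mathrm{ad}^*_\xi\alpha_\xi,\alpha_\xi)$; $\Omega_{T^*TG}=d\theta$ with $\theta$ the Liouville form, transported by this map. The displayed action is then the cotangent lift of right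 translation; its momentum map $\mathbf J:T^*TG\to\mathfrak g^*\times\mathfrak g^*$ is $\langle\mathbf J,\kappa\rangle=\theta(X_\kappa)$, with $X_\kappa$ the infinitesimal generator of $\kappa\in\mathfrak g\circledS\mathfrak g$. The coadjoint action is $\mathrm{Ad}^*_{(g,\xi)}(\mu,\nu)=(\mathrm{Ad}_g^*\mu+\mathrm{ad}^*_\xi\mathrm{Ad}^*_g\nu,\ \mathrm{Ad}^*_g\nu)$ and $\mathcal O_{(\mu,\nu)}=\{\mathrm{Ad}^*_{(g,\xi)}(\mu,\nu):(g,\xi)\in G\circledS\mathfrak g\}$. A pair $(\eta,\zeta)\in\mathfrak g\times\mathfrak g$ denotes the tangent vector $(\mathrm{ad}^*_\eta\mu+\mathrm{ad}^*_\zeta\nu,\ \mathrm{ad}^*_\eta\nu)$ to the orbit at $(\mu,\nu)$; the formula is understood at every point of the orbit. *)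

(* Defs.v *)
From HB Require Import structures.
From mathcomp Require Import all_boot all_order all_algebra.
From mathcomp Require Import all_classical all_reals all_analysis.
Set Implicit Arguments.
Unset Strict Implicit.
Unset Printing Implicit Defensive.
Import Order.TTheory GRing.Theory Num.Theory.
Import numFieldNormedType.Exports.
Local Open Scope classical_set_scope.
Local Open Scope ring_scope.

(* C^oo on an open set A: all iterated directional derivatives of f are
   differentiable (hence continuous) at every point of A. *)
Definition smooth_on (R : realType) (E F : normedModType R) (A : set E)
    (f : E -> F) : Prop :=
  forall (vs : seq E) (x : E), A x ->
    differentiable (foldr (fun v g => 'D_v g) f vs) x.

(* An atlas consisting of one preferred chart around each point.  The values
   of [chart p] outside [chart_dom p], and those of [chart_inv p] outside the
   image of the chart, are irrelevant. *)
Record atlas (R : realType) (E : normedModType R) (M : Type) := Atlas {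
  chart_dom : M -> set M;
  chart : M -> M -> E;
  chart_inv : M -> E -> M;
  chart_domP : forall p, chart_dom p p;
  chartK : forall p x, chart_dom p x -> chart_inv p (chart p x) = x;
  chart_open : forall p q, open (chart p @` (chart_dom p `&` chart_dom q));
  chart_smooth : forall p q,
    smooth_on (chart p @` (chart_dom p `&` chart_dom q))
              (chart q \o chart_inv p) }.

Definition mopen (R : realType) (E : normedModType R) (M : Type)
    (A : atlas E M) (W : set M) : Prop :=
  forall p, open (chart A p @` (chart_dom A p `&` W)).

(* For finite-dimensional E, [mfd_countable] is second countability. *)
Record manifold (R : realType) (E : normedModType R) (M : Type) := Manifold {
  mfd_atlas :> atlas E M;
  mfd_hausdorff : forall p q : M, p <> q ->
    exists U V : set M,
      [/\ mopen mfd_atlas U, mopen mfd_atlas V, U p, V q & U `&` V = set0];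
  mfd_countable : exists C : set M,
    countable C /\ forall q, exists2 p, C p & chart_dom mfd_atlas p q }.

Section smooth_on_lemmas.
Context (R : realType).
Implicit Types E F G H : normedModType R.

Lemma near_eq_differentiable E F (f g : E -> F) (x : E) :
  (\forall y \near x, f y = g y) -> differentiable f x -> differentiable g x.
Proof.
move=> fg df; have fgx : f x = g x by exact: nbhs_singleton fg.
have Hg : g \o shift x = cst (g x) + 'd f x +o_ 0 id.
  apply/eqaddoP => e e0; have /eqaddoP /(_ e e0) := diff_locally df.
  have : \forall y \near (0 : E), f (y + x) = g (y + x).
    by move: fg; rewrite (near_shift 0 x) subr0.
  apply: filterS2 => y fgy.
  by rewrite !fctE /= fgy fgx.
have dE := diff_unique (diff_continuous df) Hg.
apply/diff_locallyP; split; first by rewrite dE; exact: diff_continuous.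
by rewrite dE.
Qed.

Lemma openX_set (T U : topologicalType) (A : set T) (B : set U) :
  open A -> open B -> open (A `*` B).
Proof.
rewrite !openE => oA oB [x y] [/= Ax By].
by exists (A, B) => //=; split; [exact: oA|exact: oB].
Qed.

Lemma smooth_on_id E (A : set E) : smooth_on A id.
Proof.
move=> [|v vs] x _ /=; first exact: ex_diff.
suff [c /= ->] : exists c : E,
    foldr (fun v g => 'D_v g) id (v :: vs) = cst c by exact: differentiable_cst.
elim: vs v => [|w vs IH] v /=.
  by exists v; apply/funext => y; rewrite derive_id.
have [c /= ->] := IH w.
by exists 0; apply/funext => y; rewrite derive_cst.
Qed.

Lemma fst_cont E F : continuous (fst : E * F -> E).
Proof. by move=> x; exact: cvg_fst. Qed.

Lemma snd_cont E F : continuous (snd : E * F -> F).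
Proof. by move=> x; exact: cvg_snd. Qed.

Lemma differentiable_fst E F (x : E * F) : differentiable (fst : E * F -> E) x.
Proof. exact/linear_differentiable/fst_cont. Qed.

Lemma differentiable_snd E F (x : E * F) : differentiable (snd : E * F -> F) x.
Proof. exact/linear_differentiable/snd_cont. Qed.

Lemma differentiable_prod E F G H (f : E -> G) (g : F -> H) (x : E * F) :
  differentiable f x.1 -> differentiable g x.2 ->
  differentiable (fun y : E * F => (f y.1, g y.2)) x.
Proof.
move=> df dg; apply: differentiable_pair.
- by apply: (@differentiable_comp _ _ _ _ fst f) => //; exact: differentiable_fst.
- by apply: (@differentiable_comp _ _ _ _ snd g) => //; exact: differentiable_snd.
Qed.

Lemma derive_prod E F G H (f : E -> G) (g : F -> H) (x v : E * F) :
  differentiable f x.1 -> differentiable g x.2 ->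
  'D_v (fun y : E * F => (f y.1, g y.2)) x = ('D_v.1 f x.1, 'D_v.2 g x.2).
Proof.
move=> df dg; rewrite deriveE; last exact: differentiable_prod.
have d1 := differentiable_fst x; have d2 := differentiable_snd x.
have df1 : differentiable (f \o fst) x by exact: differentiable_comp.
have dg2 : differentiable (g \o snd) x by exact: differentiable_comp.
rewrite (@diff_pair _ _ _ _ (f \o fst) (g \o snd)) //.
rewrite (diff_comp d1 df) (diff_comp d2 dg) /=.
by rewrite (diff_lin _ (@fst_cont E F)) (diff_lin _ (@snd_cont E F)) !deriveE.
Qed.

Lemma smooth_on_prod E F G H (A : set E) (B : set F) (f : E -> G) (g : F -> H) :
  open A -> open B -> smooth_on A f -> smooth_on B g ->
  smooth_on (A `*` B) (fun x : E * F => (f x.1, g x.2)).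
Proof.
move=> oA oB sf sg vs; set h := fun x : E * F => _.
pose D := fun K L : normedModType R => fun (v : K) (k : K -> L) => 'D_v k.
pose h' us := fun x : E * F => (foldr (D E G) f (map fst us) x.1,
                                foldr (D F H) g (map snd us) x.2).
have dh' us x : (A `*` B) x -> differentiable (h' us) x.
  by case=> Ax Bx; apply: differentiable_prod; [exact: sf|exact: sg].
have key us : forall x, (A `*` B) x -> h' us x = foldr (D _ _) h us x.
  elim: us => [//|v us IH] x ABx /=.
  have [Ax Bx] := ABx.
  rewrite /h' /= -derive_prod; [|exact: sf|exact: sg].
  apply: near_eq_derive.
  by apply: filterS (open_nbhs_nbhs (conj (openX_set oA oB) ABx)) => y /IH.
move=> x ABx; apply: near_eq_differentiable (dh' vs x ABx).
by apply: filterS (open_nbhs_nbhs (conj (openX_set oA oB) ABx)) => y /key.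
Qed.

End smooth_on_lemmas.

Section vector_manifold.
Context (R : realType) (E : normedModType R).

Let vdom (p : E) : set E := setT.
Let vchart (p x : E) : E := x.

Let vopen p q : open (vchart p @` (vdom p `&` vdom q)).
Proof. by rewrite setTI image_id; exact: openT. Qed.

Definition vatlas : atlas E E :=
  @Atlas R E E vdom vchart vchart (fun _ => I) (fun _ _ _ => erefl) vopen
    (fun p q => @smooth_on_id R E _).

Lemma mopen_vatlas (W : set E) : mopen vatlas W <-> open W.
Proof.
split=> [/(_ 0)|oW p]; first by rewrite /= setTI image_id.
by rewrite /= setTI image_id.
Qed.

Let vhausdorff (p q : E) : p <> q -> exists U V : set E,
  [/\ mopen vatlas U, mopen vatlas V, U p, V q & U `&` V = set0].
Proof.
move=> /eqP pq; have := @norm_hausdorff R E; rewrite open_hausdorff.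
move=> /(_ p q pq) [[U V] /= [pU qV] [oU oV UV]].
exists U, V; split; [exact/mopen_vatlas|exact/mopen_vatlas| | |exact/eqP].
- exact: set_mem pU.
- exact: set_mem qV.
Qed.

Let vcountable : exists C : set E,
  countable C /\ forall q, exists2 p, C p & chart_dom vatlas p q.
Proof. by exists [set 0]; split=> [|q]; [exact: countable1|exists 0]. Qed.

Definition vmanifold : manifold E E := Manifold vhausdorff vcountable.

End vector_manifold.
Arguments vmanifold {R} E.

Section product_manifold.
Context (R : realType) (E F : normedModType R) (M N : Type).
Context (A : manifold E M) (B : manifold F N).

Let pdom (p : M * N) : set (M * N) := chart_dom A p.1 `*` chart_dom B p.2.
Let pchart (p x : M * N) : E * F := (chart A p.1 x.1, chart B p.2 x.2).
Let pinv (p : M * N) (e : E * F) : M * N :=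
  (chart_inv A p.1 e.1, chart_inv B p.2 e.2).

Let pdomP p : pdom p p.
Proof. by split; exact: chart_domP. Qed.

Let pchartK p x : pdom p x -> pinv p (pchart p x) = x.
Proof. by case: x => x y [px py]; congr pair; exact: chartK. Qed.

Let pimage p (U : set M) (V : set N) :
  pchart p @` (pdom p `&` (U `*` V)) =
  (chart A p.1 @` (chart_dom A p.1 `&` U)) `*`
  (chart B p.2 @` (chart_dom B p.2 `&` V)).
Proof.
apply/seteqP; split=> [_ [[x y] [[px py] [Ux Vy]] <-]|[a b] [/=]].
  by split; [exists x|exists y].
by move=> [x [px Ux] <-] [y [py Vy] <-]; exists (x, y).
Qed.

Let popen p q : open (pchart p @` (pdom p `&` pdom q)).
Proof. by rewrite pimage; apply: openX_set; exact: chart_open. Qed.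

Let psmooth p q :
  smooth_on (pchart p @` (pdom p `&` pdom q)) (pchart q \o pinv p).
Proof.
rewrite pimage; apply: (smooth_on_prod (f := chart A q.1 \o chart_inv A p.1)
  (g := chart B q.2 \o chart_inv B p.2));
  by [exact: chart_open|exact: chart_smooth].
Qed.

Definition prod_atlas : atlas (E * F)%type (M * N)%type :=
  Atlas pdomP pchartK popen psmooth.

Lemma mopenT_dom (K : normedModType R) (T : Type) (C : atlas K T) :
  mopen C setT.
Proof. by move=> p; rewrite setIT -[chart_dom C p]setIid; exact: chart_open. Qed.

Lemma mopenX (U : set M) (V : set N) :
  mopen A U -> mopen B V -> mopen prod_atlas (U `*` V).
Proof. by move=> oU oV p; rewrite /= pimage; exact: openX_set. Qed.

Let phausdorff (p q : M * N) : p <> q -> exists U V : set (M * N),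
  [/\ mopen prod_atlas U, mopen prod_atlas V, U p, V q & U `&` V = set0].
Proof.
move: p q => [x y] [x' y'] neq.
have [xx'|/(mfd_hausdorff A) [U [V [oU oV Ux Vx' UV]]]] := pselect (x = x').
  have /(mfd_hausdorff B) [U [V [oU oV Uy Vy' UV]]] : y <> y'.
    by move=> yy'; apply: neq; rewrite xx' yy'.
  exists (setT `*` U), (setT `*` V); split=> //;
    try by apply: mopenX => //; exact: mopenT_dom.
  by apply/seteqP; split=> [[a b] [[_ Ub] [_ Vb]]|//]; have : (U `&` V) b by []; rewrite UV.
exists (U `*` setT), (V `*` setT); split=> //;
  try by apply: mopenX => //; exact: mopenT_dom.
by apply/seteqP; split=> [[a b] [[Ua _] [Va _]]|//]; have : (U `&` V) a by []; rewrite UV.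
Qed.

Let pcountable : exists C : set (M * N),
  countable C /\ forall q, exists2 p, C p & chart_dom prod_atlas p q.
Proof.
have [C [cC hC]] := mfd_countable A; have [D [cD hD]] := mfd_countable B.
exists (C `*` D); split=> [|[x y]]; first exact: countableX.
by have [p Cp px] := hC x; have [q Dq qy] := hD y; exists (p, q).
Qed.

Definition prod_manifold : manifold (E * F)%type (M * N)%type :=
  Manifold phausdorff pcountable.

End product_manifold.

(* The tangent space at p of a manifold modelled on E is E itself, a tangent
   vector being represented by its coordinates in the preferred chart
   [chart A p]. *)

Section maps.
Context (R : realType) (E F : normedModType R) (M N : Type).
Context (A : manifold E M) (B : manifold F N).

Definition smooth_map (f : M -> N) : Prop := forall p q,
  let D := chart A p @` (chart_dom A p `&` f @^-1` chart_dom B q) in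
  open D /\ smooth_on D (chart B q \o f \o chart_inv A p).

Definition tangent_map (f : M -> N) (p : M) : E -> F :=
  'd (chart B (f p) \o f \o chart_inv A p) (chart A p p).

Definition submersion (f : M -> N) : Prop :=
  smooth_map f /\ forall p w, exists v, tangent_map f p v = w.

Definition immersion (f : M -> N) : Prop :=
  smooth_map f /\ forall p, injective (tangent_map f p).

(* Injective immersion that is a homeomorphism onto its image. *)
Definition embedding (f : M -> N) : Prop :=
  [/\ immersion f, injective f &
      forall U, mopen A U -> exists2 W, mopen B W & U = f @^-1` W].

End maps.

Definition diffeomorphism (R : realType) (E F : normedModType R) (M N : Type)
    (A : manifold E M) (B : manifold F N) (f : M -> N) : Prop :=
  smooth_map A B f /\
  exists g : N -> M, [/\ smooth_map B A g, cancel f g & cancel g f].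

Section forms.
Context (R : realType) (E : normedModType R) (M : Type) (A : manifold E M).

Definition form1 : Type := M -> E -> R.
Definition form2 : Type := M -> E -> E -> R.

(* The tangent vector at [chart_inv A p x] whose coordinates in the chart
   around p are v. *)
Definition chart_vector (p : M) (x v : E) : E :=
  'd (chart A (chart_inv A p x) \o chart_inv A p) x v.

Definition local1 (t : form1) (p : M) (v x : E) : R^o :=
  t (chart_inv A p x) (chart_vector p x v).

Definition local2 (w : form2) (p : M) (u v x : E) : R^o :=
  w (chart_inv A p x) (chart_vector p x u) (chart_vector p x v).

(* dt(X, Y) = X t(Y) - Y t(X) - t([X, Y]), evaluated on the constant vector
   fields of the chart around p. *)
Definition ext_deriv1 (t : form1) : form2 := fun p u v =>
  'D_u (local1 t p v) (chart A p p) - 'D_v (local1 t p u) (chart A p p).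

Definition ext_deriv2 (w : form2) (p : M) (u v z : E) : R :=
  'D_u (local2 w p v z) (chart A p p) - 'D_v (local2 w p u z) (chart A p p)
  + 'D_z (local2 w p u v) (chart A p p).

Definition symplectic_form (w : form2) : Prop :=
  [/\ forall p a u v z, w p (a *: u + v) z = a * w p u z + w p v z,
      forall p v, w p v v = 0,
      forall p u v, smooth_on (chart A p @` chart_dom A p) (local2 w p u v),
      forall p u v z, ext_deriv2 w p u v z = 0 &
      forall p u, (forall v, w p u v = 0) -> u = 0].

End forms.
Arguments form1 {R} E M.
Arguments form2 {R} E M.

Definition pullback2 (R : realType) (E F : normedModType R) (M N : Type)
    (A : manifold E M) (B : manifold F N) (f : M -> N) (w : form2 F N) :
    form2 E M :=
  fun p u v => w (f p) (tangent_map A B f p u) (tangent_map A B f p v).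

Section reduction.
Context (R : realType) (E : normedModType R) (P : Type) (A : manifold E P).
Context (Omega : form2 E P).
(* An action [act] of (the underlying set of) a group K on P, a map J to a set
   of momentum values, the coadjoint action [coad] of K on these, and a momentum
   value m. *)
Context (K D : Type) (act : P -> K -> P) (J : P -> D) (coad : K -> D -> D).
Context (m : D).

Definition isotropy : set K := [set k | coad k m = m].

Definition level_set : set P := J @^-1` [set m].

Definition isotropy_orbit (p : P) : set P := act p @` isotropy.

Definition reduced_space : set (set P) := isotropy_orbit @` level_set.

Definition reduction_proj (p : level_set) : reduced_space :=
  SigSub (mem_set (imageP isotropy_orbit (set_valP p))).

(* The level set is an embedded submanifold of P, the quotient J^-1(m) / K_m
   carries the manifold structure for which the projection is a submersion, and
   the reduced form is the symplectic form w on it with pi^* w = i^* Omega. *)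
Definition MW_reduction (r : nat) (Q : manifold 'rV[R]_r reduced_space)
    (w : form2 'rV[R]_r reduced_space) : Prop :=
  (forall p k, level_set p -> isotropy k -> level_set (act p k)) /\
  exists (s : nat) (S : manifold 'rV[R]_s level_set),
    [/\ embedding S A set_val,
        submersion S Q reduction_proj,
        symplectic_form Q w &
        pullback2 S Q reduction_proj w = pullback2 S A set_val Omega].

End reduction.

Definition lie_group (R : realType) (n : nat) (G : groupType)
    (A : manifold 'rV[R]_n G) : Prop :=
  smooth_map (prod_manifold A A) A (fun x => (x.1 * x.2)%g) /\
  smooth_map A A (fun x => (x^-1)%g).

Section lie_group.
Context (R : realType) (n : nat) (G : groupType) (A : manifold 'rV[R]_n G).

(* The Lie algebra T_e G is 'rV_n (row vectors) and its dual 'cV_n (column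
   vectors); similarly for every tangent space T_g G and its dual. *)
Local Notation g_ := 'rV[R]_n.
Local Notation g_dual := 'cV[R]_n.

Definition pairing (mu : g_dual) (xi : g_) : R := (xi *m mu) 0 0.

(* The covector representing a linear functional. *)
Definition covector (l : g_ -> R) : g_dual := \col_i l (delta_mx 0 i).

Lemma pairing_covector (l : {linear g_ -> R^o}) (xi : g_) :
  pairing (covector l) xi = l xi.
Proof.
rewrite /pairing mxE [in RHS](row_sum_delta xi) linear_sum; apply: eq_bigr => i _.
by rewrite linearZ mxE.
Qed.

(* T_h R_g : T_h G -> T_(h g) G *)
Definition TR (g h : G) : g_ -> g_ := tangent_map A A (fun x => (x * g)%g) h.

Definition Ad (g : G) : g_ -> g_ :=
  tangent_map A A (fun x => (g * x * g^-1)%g) 1%g.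

(* t |-> exp (t xi), the one-parameter subgroup with velocity xi at 0. *)
Definition exp_curve (xi : g_) : R -> G :=
  xget (fun=> 1%g) [set c : R -> G |
    [/\ smooth_map (vmanifold R^o) A c,
        forall s t, c (s + t) = (c s * c t)%g &
        tangent_map (vmanifold R^o) A c 0 1 = xi]].

Definition ad (xi eta : g_) : g_ :=
  'D_(1 : R^o) (fun t : R^o => Ad (exp_curve xi t) eta) 0.

Definition Ad_star (g : G) (mu : g_dual) : g_dual :=
  covector (fun xi => pairing mu (Ad (g^-1)%g xi)).

Definition ad_star (xi : g_) (mu : g_dual) : g_dual :=
  covector (fun eta => - pairing mu (ad xi eta)).

(* TG is right-trivialized as the semidirect product of G and its Lie
   algebra. *)
Definition TG : manifold (g_ * g_)%type (G * g_)%type :=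
  prod_manifold A (vmanifold g_).

Definition TG_mul (k l : G * g_) : G * g_ :=
  ((k.1 * l.1)%g, k.2 + Ad k.1 l.2).

Definition coad (k : G * g_) (m : g_dual * g_dual) : g_dual * g_dual :=
  (Ad_star k.1 m.1 + ad_star k.2 (Ad_star k.1 m.2), Ad_star k.1 m.2).

Definition coad_orbit (m : g_dual * g_dual) : set (g_dual * g_dual) :=
  range (coad^~ m).

(* A covector of TG at k = (g, xi) is a pair (alpha_g, alpha_xi). *)
Definition TG_pairing (a : g_dual * g_dual) (v : g_ * g_) : R :=
  pairing a.1 v.1 + pairing a.2 v.2.

(* The identification of the cotangent space at k = (g, xi) with
   g_dual x g_dual. *)
Definition cotriv (k : G * g_) (a : g_dual * g_dual) : g_dual * g_dual :=
  (covector (fun v => pairing a.1 (TR k.1 1%g v)) + ad_star k.2 a.2, a.2).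

Definition cotriv_inv (k : G * g_) (m : g_dual * g_dual) : g_dual * g_dual :=
  xget 0 [set a | cotriv k a = m].

Local Notation TTG_carrier := (G * g_ * (g_dual * g_dual))%type.
Local Notation TTG_model := (g_ * g_ * (g_dual * g_dual))%type.

(* T^*TG, identified with (G x g) x (g_dual x g_dual). *)
Definition TTG : manifold TTG_model TTG_carrier :=
  prod_manifold TG (vmanifold (g_dual * g_dual)%type).

(* The Liouville form: alpha o T(projection to TG) at the covector alpha. *)
Definition liouville : form1 TTG_model TTG_carrier := fun p v =>
  TG_pairing (cotriv_inv p.1 p.2) (tangent_map TTG TG fst p v).

Definition Omega_TTG : form2 TTG_model TTG_carrier := ext_deriv1 TTG liouville.

(* ((h, eta, mu, nu); (g, xi)) |-> (h g, eta + Ad_h xi, mu, nu) *)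
Definition TTG_act (p : TTG_carrier) (k : G * g_) : TTG_carrier :=
  (TG_mul p.1 k, p.2).

(* The infinitesimal generator of kappa: the velocity of p exp(t kappa). *)
Definition TTG_generator (kappa : g_ * g_) (p : TTG_carrier) : TTG_model :=
  tangent_map TG TTG (TTG_act p) (1%g, 0) kappa.

(* <J(p), kappa> = theta(X_kappa)(p) *)
Definition momentum (p : TTG_carrier) : g_dual * g_dual :=
  (covector (fun k1 => liouville p (TTG_generator (k1, 0) p)),
   covector (fun k2 => liouville p (TTG_generator (0, k2) p))).

(* The tangent vector at m denoted by v = (eta, zeta). *)
Definition orbit_vector (m : g_dual * g_dual) (v : g_ * g_) : g_dual * g_dual :=
  (ad_star v.1 m.1 + ad_star v.2 m.2, ad_star v.1 m.2).

Definition orbit_map (m : g_dual * g_dual) (k : G * g_) : coad_orbit m :=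
  SigSub (mem_set (imageP (coad^~ m) (I : setT k))).

(* The standard manifold structure of a coadjoint orbit: immersed in the dual,
   with the orbit map k |-> Ad^*_k m as a submersion. *)
Definition orbit_manifold (m : g_dual * g_dual) (r : nat)
    (O : manifold 'rV[R]_r (coad_orbit m)) : Prop :=
  immersion O (vmanifold (g_dual * g_dual)%type) set_val /\
  submersion TG O (orbit_map m).

End lie_group.

(* Main.v *)
(* The momentum map sends the point (k, x) of T^*TG = TG x (g* x g* ) to
   Ad^*_(k^-1) x, so the level set of m = (mu, nu) is the graph of the orbit map
   k |-> Ad^*_k m, and the isotropy group acts on it through k alone: the orbits
   are the fibres of the orbit map, and the reduced space is O_m.  Pulled back to
   the graph, the Liouville form is beta(v) = <Ad^*_k m, a(v)>, where a is the
   right logarithmic derivative of k, and the Maurer-Cartan equation of G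
   together with the Jacobi identity turns d beta into the stated form of the
   coadjoint orbit.  In particular that form is closed.

   The manifold structure of the orbit comes from the constant rank theorem: the
   differential of the orbit map has the same rank everywhere by equivariance,
   and locally the image is parametrized by a slice.  The bracket, defined
   through exp, is identified with the derivative of Ad by constructing
   exp x as the limit of gamma(x / k)^k for a chart gamma at the identity. *)
From HB Require Import structures.
Require Import Defs.
From mathcomp Require Import all_boot all_order all_algebra.
From mathcomp Require Import all_classical all_reals all_analysis.
From mathcomp Require Import ring lra.
Set Implicit Arguments.
Unset Strict Implicit.
Unset Printing Implicit Defensive.
Import Order.TTheory GRing.Theory Num.Theory.
Import numFieldNormedType.Exports.
Local Open Scope classical_set_scope.
Local Open Scope ring_scope.

(** * Differential calculus *)

(** A tangent vector is stored in the preferred chart of its base point, and that chart may jump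
    from point to point, so even a smooth vector field can have discontinuous coordinates.
    Derivatives are therefore computed on plots, and velocities in [G] are translated back to the
    identity ([logd]), where one chart serves for all points. Tangent vectors come back at the end,
    as velocities of chart inverses.

    The one-parameter subgroups come from inequalities on powers in a chart. The limit is a
    homomorphism with a second order estimate at 0; the homomorphism law spreads differentiability
    to all times and yields an autonomous equation from which smoothness is bootstrapped.

    A coadjoint orbit is immersed but need not carry the induced topology, so its charts come from
    slices of the orbit map. Their inverses lift to plots of TG, which gives the orbit form a
    potential in every chart, hence smoothness and closedness.

    The level set projects bijectively onto TG and the reduced space is in bijection with the orbit,
    so both manifold structures are transported along these bijections. *)

Section bilinear_maps.
Context {R : realType}.
Implicit Types E F G H : normedModType R.

(** A predicate on bare functions, because it serves operations such as [pairing] and [bracket] that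
    carry no bundled structure. *)
Definition bilin F G H (b : F -> G -> H) :=
  [/\ forall x, linear (b x), forall y, linear (b^~ y) &
      continuous (fun p : F * G => b p.1 p.2)].

Lemma bilin_bilinear F G H (b : F -> G -> H) : bilin b ->
  exists b' : {bilinear F -> G -> H}, b = b'.
Proof.
case=> l1 l2 _.
have bb : bilinear_for *:%R *:%R b by split=> [y|x] a u v; [exact: l2|exact: l1].
pose M := bilinear_isBilinear.Build R F G H _ _ b bb.
pose B : {bilinear _ -> _ -> _} := HB.pack b M.
by exists B.
Qed.

Lemma bilin_differentiable F G H (b : F -> G -> H) p : bilin b ->
  differentiable (fun q : F * G => b q.1 q.2) p.
Proof.
move=> bb; have [b' e] := bilin_bilinear bb.
by case: bb => _ _; rewrite e; exact: differentiable_bilin.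
Qed.

Lemma bilin_diff F G H (b : F -> G -> H) p : bilin b ->
  'd (fun q : F * G => b q.1 q.2) p = (fun q => b p.1 q.2 + b q.1 p.2) :> (_ -> _).
Proof.
move=> bb; have [b' e] := bilin_bilinear bb.
by case: bb => _ _; rewrite e; exact: diff_bilin.
Qed.

Lemma derive_comp E F G (f : E -> F) (g : F -> G) x v :
  differentiable f x -> differentiable g (f x) ->
  'D_v (g \o f) x = 'D_('D_v f x) g (f x).
Proof.
move=> df dg; rewrite !deriveE //; last exact: differentiable_comp.
by rewrite diff_comp.
Qed.

Lemma derive_bilin E F G H (b : F -> G -> H) (f : E -> F) (g : E -> G) x v :
  bilin b -> differentiable f x -> differentiable g x ->
  differentiable (fun y => b (f y) (g y)) x /\
  'D_v (fun y => b (f y) (g y)) x = b (f x) ('D_v g x) + b ('D_v f x) (g x).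
Proof.
move=> bb df dg.
have dfg : differentiable (fun y => (f y, g y)) x by exact: differentiable_pair.
have dB := bilin_differentiable (f x, g x) bb.
split; first exact: (differentiable_comp dfg dB).
rewrite deriveE; last exact: (differentiable_comp dfg dB).
rewrite (diff_comp dfg dB) /= bilin_diff // diff_pair //=.
by rewrite -!deriveE.
Qed.

Lemma scale_bilin F : bilin (fun (a : R^o) (x : F) => a *: x).
Proof.
split=> [a|x|p]; first exact: linearP.
  by move=> a u v; rewrite scalerDl scalerA.
by apply: continuousZ => /=; [exact: fst_cont|exact: snd_cont].
Qed.

Lemma mul_bilin : bilin (fun x y : R^o => x * y : R^o).
Proof. exact: scale_bilin. Qed.

End bilinear_maps.

Section Ck.
Context {R : realType}.
Implicit Types E F G H : normedModType R.

(** A finite order allows inductions in which a derivative is handled at the order below. [Ck k]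
    says that all derivatives of order at most [k] are differentiable, so [Ck 0] is already
    differentiability. *)
Fixpoint Ck (k : nat) E F (A : set E) (f : E -> F) : Prop :=
  (forall x, A x -> differentiable f x) /\
  (if k is k'.+1 then forall v, Ck k' A ('D_v f) else True).

Lemma Ck_differentiable k E F (A : set E) (f : E -> F) x :
  Ck k A f -> A x -> differentiable f x.
Proof. by case: k => [|k] [+ _]; apply. Qed.

Lemma CkW k E F (A : set E) (f : E -> F) : Ck k.+1 A f -> Ck k A f.
Proof.
elim: k f => [|k IH] f [df Df]; first by split.
by split=> // v; apply: IH; exact: Df.
Qed.

(** The first derivative taken by [foldr] is along the last vector of the list, hence [rcons] and
    the induction from the end. *)
Lemma smooth_on_deriv E F (A : set E) (f : E -> F) :
  smooth_on A f <-> (forall x, A x -> differentiable f x) /\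
                    forall v, smooth_on A ('D_v f).
Proof.
split=> [sf|[df Df] vs].
  split=> [x Ax|v vs x Ax]; first exact: (sf [::]).
  by have := sf (rcons vs v) x Ax; rewrite foldr_rcons.
elim/last_ind: vs => [|vs v _] x Ax; first exact: df.
by rewrite foldr_rcons; exact: Df.
Qed.

Lemma smooth_onP E F (A : set E) (f : E -> F) :
  smooth_on A f <-> forall k, Ck k A f.
Proof.
split=> [sf k|cf vs].
  elim: k f sf => [|k IH] f /smooth_on_deriv [df Df]; first by split.
  by split=> // v; exact/IH/Df.
elim/last_ind: vs f cf => [|vs v IH] f cf x Ax /=.
  exact: (Ck_differentiable (cf 0%N)).
by rewrite foldr_rcons; apply: IH => // k; have [_] := cf k.+1; apply.
Qed.

Lemma Ck_sub k E F (A B : set E) (f : E -> F) : B `<=` A -> Ck k A f -> Ck k B f.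
Proof.
move=> BA; elim: k f => [|k IH] f [df Df].
  by split=> // x /BA; exact: df.
by split=> [x /BA|v]; [exact: df|exact/IH/Df].
Qed.

Lemma Ck_ext k E F (A : set E) (f g : E -> F) : open A ->
  (forall x, A x -> f x = g x) -> Ck k A f -> Ck k A g.
Proof.
move=> oA; elim: k f g => [|k IH] f g fg [df Df].
  split=> // x Ax; apply: near_eq_differentiable (df x Ax).
  by apply: filterS (open_nbhs_nbhs (conj oA Ax)) => y /fg.
split=> [x Ax|v].
  apply: near_eq_differentiable (df x Ax).
  by apply: filterS (open_nbhs_nbhs (conj oA Ax)) => y /fg.
apply: IH (Df v) => x Ax; apply: near_eq_derive.
by apply: filterS (open_nbhs_nbhs (conj oA Ax)) => y /fg.
Qed.

Lemma Ck_cst k E F (A : set E) (c : F) : Ck k A (fun=> c).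
Proof.
elim: k c => [|k IH] c.
  by split=> // x _; exact: differentiable_cst.
split=> [x _|v]; first exact: differentiable_cst.
rewrite (_ : 'D_v _ = fun=> 0); first exact: IH.
by apply/funext => x; rewrite derive_cst.
Qed.

Lemma derive_lin E F (L : {linear E -> F}) x v : continuous L -> 'D_v L x = L v.
Proof.
by move=> cL; rewrite deriveE ?diff_lin //; exact: linear_differentiable.
Qed.

Lemma Ck_lin k E F (A : set E) (L : {linear E -> F}) : continuous L -> Ck k A L.
Proof.
move=> cL; case: k => [|k]; split=> //; try by move=> *; exact: linear_differentiable.
move=> v.
rewrite (_ : 'D_v _ = fun=> L v); first exact: Ck_cst.
by apply/funext => x; rewrite derive_lin.
Qed.

Lemma derive_lin_comp E F G (L : {linear F -> G}) (f : E -> F) x v :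
  continuous L -> differentiable f x -> 'D_v (fun y => L (f y)) x = L ('D_v f x).
Proof.
move=> cL df; have dL : differentiable L (f x) by exact: linear_differentiable.
by rewrite (derive_comp _ df dL) derive_lin.
Qed.

Lemma Ck_lin_comp k E F G (A : set E) (L : {linear F -> G}) (f : E -> F) :
  open A -> continuous L -> Ck k A f -> Ck k A (fun x => L (f x)).
Proof.
move=> oA cL; elim: k f => [|k IH] f [df Df]; split=> //;
  try by move=> x Ax; apply: (differentiable_comp (df x Ax)); exact: linear_differentiable.
move=> v; apply: Ck_ext (IH _ (Df v)) => // x Ax.
by rewrite derive_lin_comp //; exact: df.
Qed.

Lemma CkD k E F (A : set E) (f g : E -> F) : open A ->
  Ck k A f -> Ck k A g -> Ck k A (fun x => f x + g x).
Proof.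
move=> oA; elim: k f g => [|k IH] f g [df Df] [dg Dg].
  by split=> // x Ax; apply: differentiableD; [exact: df|exact: dg].
split=> [x Ax|v]; first by apply: differentiableD; [exact: df|exact: dg].
apply: Ck_ext (IH _ _ (Df v) (Dg v)) => // x Ax.
by rewrite (@deriveD _ _ _ f g) //; apply: diff_derivable; [exact: df|exact: dg].
Qed.

Lemma Ck_sum k E F (A : set E) I (r : seq I) (P : pred I) (f : I -> E -> F) :
  open A -> (forall i, P i -> Ck k A (f i)) ->
  Ck k A (fun x => \sum_(i <- r | P i) f i x).
Proof.
move=> oA cf; elim: r => [|i r IH].
  rewrite (_ : (fun _ => _) = fun=> 0); first exact: Ck_cst.
  by apply/funext => x; rewrite big_nil.
case Pi : (P i); last first.
  rewrite (_ : (fun _ => _) = fun x => \sum_(j <- r | P j) f j x) //.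
  by apply/funext => x; rewrite big_cons Pi.
rewrite (_ : (fun _ => _) = fun x => f i x + \sum_(j <- r | P j) f j x).
  by apply: CkD => //; exact: cf.
by apply/funext => x; rewrite big_cons Pi.
Qed.

Lemma Ck_bilin k E F G H (b : F -> G -> H) (A : set E) (f : E -> F) (g : E -> G) :
  bilin b -> open A -> Ck k A f -> Ck k A g -> Ck k A (fun x => b (f x) (g x)).
Proof.
move=> bb oA; elim: k f g => [|k IH] f g cf cg.
  by split=> // x Ax; apply: (derive_bilin 0 bb _ _).1;
    [exact: Ck_differentiable cf Ax|exact: Ck_differentiable cg Ax].
have [[df Df] [dg Dg]] := (cf, cg); split=> [x Ax|v].
  by apply: (derive_bilin 0 bb _ _).1; [exact: df|exact: dg].
apply: (@Ck_ext _ _ _ _ (fun x => b (f x) ('D_v g x) + b ('D_v f x) (g x))) => //.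
  by move=> x Ax; rewrite (derive_bilin v bb _ _).2 //; [exact: df|exact: dg].
by apply: CkD => //; apply: IH => //; first [exact: Dg|exact: Df|exact: CkW].
Qed.

Lemma CkZ k E F (A : set E) (f : E -> R^o) (g : E -> F) : open A ->
  Ck k A f -> Ck k A g -> Ck k A (fun x => f x *: g x).
Proof. exact: Ck_bilin (scale_bilin _). Qed.

Lemma CkM k E (A : set E) (f g : E -> R^o) : open A ->
  Ck k A f -> Ck k A g -> Ck k A (fun x => f x * g x : R^o).
Proof. exact: Ck_bilin mul_bilin. Qed.

Lemma Ck_prod k E (A : set E) I (r : seq I) (f : I -> E -> R^o) :
  open A -> (forall i, Ck k A (f i)) ->
  Ck k A (fun x => \prod_(i <- r) f i x : R^o).
Proof.
move=> oA cf; elim: r => [|i r IH].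
  rewrite (_ : (fun _ => _) = fun=> 1); first exact: Ck_cst.
  by apply/funext => x; rewrite big_nil.
rewrite (_ : (fun _ => _) = fun x => f i x * \prod_(j <- r) f j x : R^o).
  exact: CkM.
by apply/funext => x; rewrite big_cons.
Qed.

Lemma CkV k E (A : set E) (f : E -> R^o) : open A ->
  (forall x, A x -> f x != 0) -> Ck k A f -> Ck k A (fun x => (f x)^-1 : R^o).
Proof.
move=> oA f0; elim: k => [|k IH] cf.
  split=> // x Ax; apply: (@differentiableV _ _ f) => //; last exact: f0.
  exact: Ck_differentiable cf Ax.
have [df Df] := cf; split=> [x Ax|v].
  by apply: (@differentiableV _ _ f); [exact: df|exact: f0].
(* The two inverses stay separate factors so that the induction hypothesis applies to each of
   them. *)
apply: (@Ck_ext _ _ _ _ (fun x => - 1 * ((f x)^-1 * (f x)^-1) * 'D_v f x : R^o)) => //.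
  move=> x Ax; rewrite (@deriveV _ _ f) //; [|exact: f0|].
    by rewrite expr2 invfM mulN1r.
  by apply: diff_derivable; exact: df.
apply: CkM => //; last exact: Df.
have cV := IH (CkW cf).
by apply: CkM => //; [exact: Ck_cst|exact: CkM].
Qed.

Lemma Ck_pair k E F G (A : set E) (f : E -> F) (g : E -> G) : open A ->
  Ck k A f -> Ck k A g -> Ck k A (fun x => (f x, g x)).
Proof.
move=> oA; elim: k f g => [|k IH] f g [df Df] [dg Dg].
  by split=> // x Ax; apply: differentiable_pair; [exact: df|exact: dg].
split=> [x Ax|v]; first by apply: differentiable_pair; [exact: df|exact: dg].
apply: Ck_ext (IH _ _ (Df v) (Dg v)) => // x Ax.
have ? := df x Ax; have ? := dg x Ax.
by rewrite [RHS]deriveE ?diff_pair -?deriveE //; exact: differentiable_pair.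
Qed.

(** Coordinates are there for the chain rule of higher order: the direction ['D_v f x] varies with
    [x], and expanding it on fixed vectors turns the derivative along it into a sum of products. *)
Definition findim E := exists (n : nat) (e : 'I_n -> E) (l : 'I_n -> {linear E -> R^o}),
  (forall i, continuous (l i)) /\ forall x, x = \sum_i l i x *: e i.
Existing Class findim.

(** The derivative is the sum of the [l i ('D_v f x) *: 'D_(e i) g (f x)], all of whose factors are
    one order lower. *)
Lemma Ck_comp k E F G (A : set E) (B : set F) (f : E -> F) (g : F -> G) :
  findim F -> open A -> open B -> (forall x, A x -> B (f x)) ->
  Ck k A f -> Ck k B g -> Ck k A (g \o f).
Proof.
move=> [n [e [l [cl el]]]] oA oB AB; elim: k g => [|k IH] g cf cg.
  split=> // x Ax; apply: differentiable_comp.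
    exact: Ck_differentiable cf Ax.
  by apply: Ck_differentiable cg _; exact: AB.
have [[df Df] [dg Dg]] := (cf, cg); split=> [x Ax|v].
  by apply: differentiable_comp; [exact: df|exact/dg/AB].
apply: (@Ck_ext _ _ _ _ (fun x => \sum_i l i ('D_v f x) *: ('D_(e i) g \o f) x)) => //.
  move=> x Ax; rewrite derive_comp //; [|exact: df|exact/dg/AB].
  rewrite [in RHS]deriveE; last exact/dg/AB.
  rewrite {2}(el ('D_v f x)) linear_sum; apply: eq_bigr => i _.
  by rewrite linearZ -deriveE //; exact/dg/AB.
apply: Ck_sum => // i _; apply: CkZ => //.
  by apply: Ck_lin_comp => //; exact: Df.
by apply: IH => //; first [exact: Dg|exact: CkW].
Qed.

End Ck.

Section findim_theory.
Context {R : realType}.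
Implicit Types E F G H : normedModType R.

Lemma findim_fin E (I : finType) (e : I -> E) (l : I -> {linear E -> R^o}) :
  (forall i, continuous (l i)) -> (forall x, x = \sum_i l i x *: e i) -> findim E.
Proof.
move=> cl el; exists #|I|, (fun k => e (enum_val k)), (fun k => l (enum_val k)).
split=> // x; rewrite {1}(el x); symmetry.
by rewrite -(@big_enum_val _ _ _ _ I (fun i => l i x *: e i)); apply: eq_bigl => i; rewrite inE.
Qed.

Lemma findim_R : findim R^o.
Proof.
apply: (@findim_fin R^o unit (fun=> 1 : R^o) (fun=> (idfun : {linear R^o -> R^o}))) => [_ x|x]; first exact: cvg_id.
by rewrite (bigD1 tt) //= big1 ?addr0 /= => [|[]//]; rewrite [RHS]mulr1.
Qed.

Lemma mx_entry_linear m n i j : linear (fun M : 'M[R]_(m, n) => M i j : R^o).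
Proof. by move=> a u v; rewrite !mxE. Qed.

Definition mx_entry m n i j : {linear 'M[R]_(m, n) -> R^o} :=
  HB.pack (fun M : 'M[R]_(m, n) => M i j : R^o)
    (GRing.isLinear.Build _ _ _ _ _ (@mx_entry_linear m n i j)).

Lemma findim_mx m n : findim 'M[R]_(m, n).
Proof.
apply: (@findim_fin _ ('I_m * 'I_n)%type (fun k => delta_mx k.1 k.2)
  (fun k => mx_entry k.1 k.2)) => [k|M]; first exact: coord_continuous.
rewrite {1}(matrix_sum_delta M) pair_bigA /=; exact: eq_bigr.
Qed.

Lemma findim_prod E F : findim E -> findim F -> findim (E * F)%type.
Proof.
move=> [m [e [l [cl el]]]] [n [e' [l' [cl' el']]]].
pose L (k : 'I_m + 'I_n) : E * F -> R^o :=
  match k with inl i => fun x => l i x.1 | inr j => fun x => l' j x.2 end.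
have linL k : linear (L k) by case: k => i a u v /=; rewrite linearP.
pose LL k : {linear (E * F)%type -> R^o} :=
  HB.pack (L k) (GRing.isLinear.Build _ _ _ _ _ (linL k)).
apply: (@findim_fin _ ('I_m + 'I_n)%type
  (fun k => match k with inl i => (e i, 0) | inr j => (0, e' j) end) LL).
  case=> i p.
    by apply: (@continuous_comp _ _ _ fst (l i)); [exact: fst_cont|exact: cl].
  by apply: (@continuous_comp _ _ _ snd (l' i)); [exact: snd_cont|exact: cl'].
move=> [x y]; rewrite big_sumType /=.
rewrite {1}(el x) {1}(el' y).
apply: (@eq_trans _ _ (\sum_i (l i x *: e i, 0) + \sum_j (0, l' j y *: e' j))).
  have fs (V W : normedModType R) I (r : seq I) (f : I -> V) :
      \sum_(i <- r) (f i, 0 : W) = (\sum_(i <- r) f i, 0).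
    by elim: r => [|i r IH]; rewrite ?big_nil // !big_cons IH; congr pair; rewrite addr0.
  have sn (V W : normedModType R) I (r : seq I) (f : I -> V) :
      \sum_(i <- r) (0 : W, f i) = (0, \sum_(i <- r) f i).
    by elim: r => [|i r IH]; rewrite ?big_nil // !big_cons IH; congr pair; rewrite addr0.
  by rewrite fs sn; congr pair; rewrite ?addr0 ?add0r.
by congr (_ + _); apply: eq_bigr => i _; congr pair; rewrite scaler0.
Qed.

#[global] Existing Instance findim_R.
#[global] Existing Instance findim_mx.
#[global] Existing Instance findim_prod.

Lemma findim_lin_cont E F (L : {linear E -> F}) : findim E -> continuous L.
Proof.
move=> [n [e [l [cl el]]]] x; apply: differentiable_continuous.
rewrite (_ : (L : E -> F) = fun x => \sum_i l i x *: L (e i)).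
  apply: (@Ck_differentiable _ 0 _ _ setT) => //.
  apply: Ck_sum; first exact: openT.
  move=> i _; apply: CkZ; [exact: openT| |exact: Ck_cst].
  exact: Ck_lin.
by apply/funext => y; rewrite {1}(el y) linear_sum; apply: eq_bigr => i _; rewrite linearZ.
Qed.

Lemma lin_pack E F (L : E -> F) : linear L -> exists L' : {linear E -> F}, L = L'.
Proof.
move=> lL; pose LL : {linear E -> F} := HB.pack L (GRing.isLinear.Build _ _ _ _ _ lL).
by exists LL.
Qed.

Lemma findim_Ck_lin k E F (A : set E) (L : E -> F) : findim E -> linear L -> Ck k A L.
Proof.
by move=> fE /lin_pack [L' ->]; apply: Ck_lin; exact: findim_lin_cont.
Qed.

Lemma findim_bilin F G H (b : F -> G -> H) : findim F -> findim G ->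
  (forall x, linear (b x)) -> (forall y, linear (b^~ y)) -> bilin b.
Proof.
move=> fF fG l1 l2; split=> //.
move: (fF) (fG) => [m [e [l [cl el]]]] [n [e' [l' [cl' el']]]].
rewrite (_ : (fun p => _) = fun p : F * G =>
    \sum_i l i p.1 *: \sum_j l' j p.2 *: b (e i) (e' j)).
  move=> p; apply: differentiable_continuous.
  apply: (@Ck_differentiable _ 0 _ _ setT) => //.
  apply: Ck_sum; first exact: openT.
  move=> i _; apply: CkZ; first exact: openT.
    have [L' eL] := lin_pack (L := fun p : F * G => l i p.1) (fun a u v => linearP _ _ _ _).
    by rewrite eL; apply: Ck_lin; apply: findim_lin_cont; exact: findim_prod.
  apply: Ck_sum; first exact: openT.
  move=> j _; apply: CkZ; [exact: openT| |exact: Ck_cst].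
  have [L' eL] := lin_pack (L := fun p : F * G => l' j p.2) (fun a u v => linearP _ _ _ _).
  by rewrite eL; apply: Ck_lin; apply: findim_lin_cont; exact: findim_prod.
apply/funext => -[x y] /=; have [L1 eL1] := lin_pack (l2 y).
rewrite -[LHS]/((b^~ y) x) eL1 {1}(el x) linear_sum; apply: eq_bigr => i _.
rewrite linearZ -eL1 /=; congr (_ *: _).
have [L2 eL2] := lin_pack (l1 (e i)).
rewrite eL2 {1}(el' y) linear_sum; apply: eq_bigr => j _.
by rewrite linearZ.
Qed.

End findim_theory.

(** * Mean value inequalities and symmetry of second derivatives *)

Section mean_value.
Context {R : realType}.
Implicit Types E F G H : normedModType R.

Lemma mvt_line E (f : E -> R^o) x v :
  (forall t : R, 0 <= t <= 1 -> differentiable f (x + t *: v)) ->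
  exists2 t : R, 0 <= t <= 1 & f (x + v) - f x = 'D_v f (x + t *: v).
Proof.
move=> df; pose c : R^o -> E := fun t => x + t *: v.
have [Lv eL] : exists L : {linear R^o -> E}, (fun t : R^o => t *: v) = L.
  by apply: lin_pack => a b d; rewrite scalerDl scalerA.
have cL : continuous Lv by apply: findim_lin_cont; exact: findim_R.
have dlv t : differentiable (fun t : R^o => t *: v) t.
  by rewrite eL; exact: linear_differentiable.
have dc t : differentiable c t.
  exact: (differentiableD (differentiable_cst x t) (dlv t)).
have Dc t : 'D_1 c t = v.
  have d1 : derivable (cst x : R^o -> E) t 1 by exact: diff_derivable.
  have d2 : derivable (fun t : R^o => t *: v) t 1 by apply: diff_derivable; exact: dlv.
  rewrite [LHS](deriveD d1 d2).
  by rewrite derive_cst add0r eL derive_lin // -eL scale1r.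
have dfc (t : R^o) : 0 <= t <= 1 -> differentiable (f \o c) t.
  by move=> t01; apply: differentiable_comp => //; exact: df.
have Hd (t : R) : t \in `]0, 1[ -> is_derive t 1 (f \o c : R -> R) ('D_v f (x + t *: v)).
  rewrite in_itv /= => /andP[t0 t1].
  have t01 : 0 <= t <= 1 by rewrite !ltW.
  apply: DeriveDef; first by apply: diff_derivable; exact: dfc.
  by rewrite [LHS](derive_comp (f := c) (g := f)) ?Dc //; exact: df.
have Hc : {within `[0, 1], continuous (f \o c : R -> R)}.
  apply: continuous_in_subspaceT => t; rewrite inE /= in_itv /= => t01.
  exact/differentiable_continuous/dfc.
have [t t01 e] := MVT ltr01 Hd Hc.
exists t; first by move: t01; rewrite in_itv /= => /andP[? ?]; rewrite !ltW.
by move: e; rewrite /c /= scale1r scale0r addr0 subr0 mulr1.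
Qed.

Lemma findim_lin_bound E (l : {linear E -> R^o}) : continuous l ->
  exists2 k, 0 < k & forall x, `|l x| <= k * `|x|.
Proof. exact: linear_lipschitz. Qed.

(** The mean value theorem gives a different intermediate point for each coordinate of [f], so the
    bounds are summed over coordinates. The point of the order of quantifiers is that [K] depends on
    [F] alone. The summand 1 in the witness makes it positive. *)
Lemma mvi E F : findim F -> exists2 K, 0 < K & forall (f : E -> F) x v B,
  (forall t : R, 0 <= t <= 1 -> differentiable f (x + t *: v)) ->
  (forall t : R, 0 <= t <= 1 -> `|'D_v f (x + t *: v)| <= B) ->
  `|f (x + v) - f x| <= K * B.
Proof.
move=> [n [e [l [cl el]]]].
have /choice [k hk] : forall i, exists k, 0 < k /\ forall x, `|l i x| <= k * `|x|.
  by move=> i; have [k k0 hk] := findim_lin_bound (cl i); exists k.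
have S0 : 0 <= \sum_i k i * `|e i|.
  by apply: sumr_ge0 => i _; rewrite mulr_ge0 // ltW; case: (hk i).
exists (1 + \sum_i k i * `|e i|); first by rewrite ltr_pwDl.
move=> f x v B df bf.
have B0 : 0 <= B by apply: le_trans (bf 0 _); rewrite ?lexx ?ler01.
rewrite (el (f (x + v) - f x)) mulrDl; apply: ler_wpDl; first by rewrite mul1r.
rewrite mulr_suml; apply: le_trans (ler_norm_sum _ _ _) _; apply: ler_sum => i _.
rewrite normrZ mulrAC; apply: ler_wpM2r => //.
have dl t : 0 <= t <= 1 -> differentiable (fun y => l i (f y)) (x + t *: v).
  by move=> /df d; apply: (differentiable_comp d); exact: linear_differentiable.
have [t t01 et] := mvt_line dl; rewrite linearB et derive_lin_comp //; last exact: df.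
have [k0 hki] := hk i; apply: le_trans (hki _) _.
by rewrite ler_pM2l //; exact: bf.
Qed.

Lemma ball_segment E (x0 x y : E) (d t : R) : ball x0 d x -> ball x0 d y ->
  0 <= t <= 1 -> ball x0 d (y + t *: (x - y)).
Proof.
move=> + + /andP[t0 t1]; rewrite -!ball_normE /= => bx by_.
rewrite (_ : x0 - _ = (1 - t) *: (x0 - y) + t *: (x0 - x)); last first.
  rewrite scalerBl scale1r -addrA [- _ + _]addrC -scalerBr opprB addrC.
  by rewrite [x0 - x + _]addrC subrKA opprD addrA -scalerN opprB addrC.
apply: le_lt_trans (ler_normD _ _) _.
rewrite !normrZ ger0_norm ?subr_ge0 // ger0_norm //.
have [->|t0'] := eqVneq t 0; first by rewrite subr0 mul1r mul0r addr0.
apply: (@lt_le_trans _ _ ((1 - t) * d + t * d)); last by rewrite -mulrDl subrK mul1r.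
apply: ler_ltD.
  by rewrite ler_wpM2l ?subr_ge0 // ltW.
by rewrite ltr_pM2l // lt_neqAle eq_sym t0'.
Qed.

(** Near [x0] the derivatives along the basis vectors are small by continuity; the mean value
    inequality on segments of a ball makes this a Lipschitz bound. *)
Lemma small_lipschitz E F (A : set E) (f : E -> F) x0 (eps : R) :
  findim E -> findim F -> open A -> A x0 -> Ck 1 A f ->
  (forall v, 'D_v f x0 = 0) -> 0 < eps ->
  exists2 d : R, 0 < d & ball x0 d `<=` A /\
    forall x y, ball x0 d x -> ball x0 d y -> `|f x - f y| <= eps * `|x - y|.
Proof.
move=> [n [e [l [cl el]]]] fF oA Ax0 [df Df] D0 eps0.
have /choice [k hk] : forall i, exists k, 0 < k /\ forall x, `|l i x| <= k * `|x|.
  by move=> i; have [k k0 hk] := findim_lin_bound (cl i); exists k.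
have S0 : 0 <= \sum_i k i.
  by apply: sumr_ge0 => i _; rewrite ltW; case: (hk i).
have [K K0 hK] := mvi E fF.
(* [K] is lost in the mean value inequality, the sum of the [k i] in expanding the direction [x - y]
   on the basis. *)
pose eta := eps / (K * (1 + \sum_i k i)).
have S1 : 0 < 1 + \sum_i k i by rewrite ltr_pwDl.
have eta0 : 0 < eta by rewrite divr_gt0 // mulr_gt0.
have near1 : \forall x \near x0, A x /\ forall i, `|'D_(e i) f x| <= eta.
  near=> x; split.
    by near: x; exact: open_nbhs_nbhs.
  near: x; apply: filter_forall => i.
  have /differentiable_continuous ci : differentiable ('D_(e i) f) x0.
    exact: (@Ck_differentiable _ 0 _ _ A _ _ (Df (e i))).
  move: ci => /cvgrPdist_le /(_ _ eta0); apply: filterS => y.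
  by rewrite D0 sub0r normrN.
have /nbhs_ballP [d d0 hd] := near1.
exists d => //; split=> [x /hd []//|x y bx by_].
have bl t : 0 <= t <= 1 -> ball x0 d (y + t *: (x - y)).
  exact: ball_segment.
rewrite -[x in f x](subrK y) [x - y + y]addrC.
apply: le_trans (hK f y (x - y) (eta * (\sum_i k i) * `|x - y|) _ _) _.
- by move=> t /bl /hd [/df].
- move=> t /bl; move: (y + t *: _) => z /hd [At ht]; rewrite deriveE; last exact: df.
  rewrite {1}(el (x - y)) linear_sum.
  apply: le_trans (ler_norm_sum _ _ _) _; rewrite mulr_sumr mulr_suml; apply: ler_sum => i _.
  rewrite linearZ normrZ -deriveE; last exact: df.
  have [k0 hki] := hk i; rewrite -mulrA mulrC.
  by apply: ler_pM.
rewrite mulrA; apply: ler_wpM2r => //.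
rewrite /eta; set S := \sum_i k i; rewrite -/S in S0 S1.
rewrite (_ : K * _ = eps * (S / (1 + S))); last first.
  by field; rewrite -/S; move: S1 K0 => /gt_eqF -> /gt_eqF ->.
apply: ler_piMr; first exact: ltW.
by rewrite ler_pdivrMr // mul1r lerDr.
Unshelve. all: by end_near. Qed.

End mean_value.

Section schwarz.
Context {R : realType}.
Implicit Types E F G H : normedModType R.

Lemma derive_translate E F (f : E -> F) c x v :
  'D_v (fun y => f (y + c)) x = 'D_v f (x + c).
Proof.
rewrite /derive; suff -> : (fun h : R => h^-1 *:
    (((fun y => f (y + c)) \o shift x) (h *: v) - f (x + c))) =
  (fun h => h^-1 *: ((f \o shift (x + c)) (h *: v) - f (x + c))) by [].
by apply/funext => h /=; rewrite addrA.
Qed.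

Lemma differentiable_translate E F (f : E -> F) c x :
  differentiable f (x + c) -> differentiable (fun y => f (y + c)) x.
Proof.
move=> df; have did : differentiable (id : E -> E) x.
  by apply: (@linear_differentiable _ _ _ (idfun : {linear E -> E})) => y; exact: cvg_id.
have dt : differentiable (fun y : E => y + c) x.
  exact: (differentiableD did (differentiable_cst c x)).
exact: (differentiable_comp dt df).
Qed.

Lemma deriveZv E F (f : E -> F) x (t : R) v :
  differentiable f x -> 'D_(t *: v) f x = t *: 'D_v f x.
Proof. by move=> df; rewrite !deriveE // linearZ. Qed.

Lemma deriveDv E F (f : E -> F) x u v :
  differentiable f x -> 'D_(u + v) f x = 'D_u f x + 'D_v f x.
Proof. by move=> df; rewrite !deriveE // linearD. Qed.

(** Two mean value theorems: one for [g (y + t *: v) - g y] along [t *: u], one for ['D_u g] along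
    [t *: v]. *)
Lemma second_difference E (g : E -> R^o) (A : set E) x u v (d t : R) :
  Ck 2 A g -> ball x d `<=` A -> 0 <= t -> t * (`|u| + `|v|) < d ->
  exists2 p, `|x - p| <= t * (`|u| + `|v|) &
    g (x + t *: u + t *: v) - g (x + t *: u) - (g (x + t *: v) - g x) =
    t * (t * 'D_v ('D_u g) p).
Proof.
move=> [dg Dg] xA t0 td.
have inA r s : 0 <= r <= 1 -> 0 <= s <= 1 ->
    `|x - (x + r *: (t *: u) + s *: (t *: v))| <= t * (`|u| + `|v|).
  move=> /andP[r0 r1] /andP[s0 s1].
  rewrite -addrA opprD addrA subrr add0r normrN mulrDr.
  apply: le_trans (ler_normD _ _) _.
  rewrite !normrZ (ger0_norm r0) (ger0_norm s0) (ger0_norm t0).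
  by apply: lerD; rewrite -[leRHS]mul1r; apply: ler_wpM2r => //; rewrite mulr_ge0.
have inA' r s : 0 <= r <= 1 -> 0 <= s <= 1 -> A (x + r *: (t *: u) + s *: (t *: v)).
  by move=> r01 s01; apply: xA; rewrite -ball_normE /=; apply: le_lt_trans td; exact: inA.
have z01 : 0 <= (0 : R) <= 1 by rewrite lexx ler01.
have o01 : 0 <= (1 : R) <= 1 by rewrite lexx ler01.
have inA0 r : 0 <= r <= 1 -> A (x + r *: (t *: u)).
  by move=> r01; have := inA' r 0 r01 z01; rewrite scale0r addr0.
have inA1 r : 0 <= r <= 1 -> A (x + r *: (t *: u) + t *: v).
  by move=> r01; have := inA' r 1 r01 o01; rewrite scale1r.
pose phi y := g (y + t *: v) - g y.
have dphi r : 0 <= r <= 1 -> differentiable phi (x + r *: (t *: u)).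
  move=> r01; apply: (@differentiableB _ _ _ (fun y => g (y + t *: v)) g).
    by apply: differentiable_translate; exact/dg/inA1.
  exact/dg/inA0.
have [r r01 er] := mvt_line dphi.
have Dphi : 'D_(t *: u) phi (x + r *: (t *: u)) =
    t * ('D_u g (x + r *: (t *: u) + t *: v) - 'D_u g (x + r *: (t *: u))).
  rewrite (@deriveB _ _ _ (fun y => g (y + t *: v)) g).
  - rewrite derive_translate !deriveZv ?mulrBr //; [exact/dg/inA0|exact/dg/inA1].
  - by apply: diff_derivable; apply: differentiable_translate; exact/dg/inA1.
  - by apply: diff_derivable; exact/dg/inA0.
have [dDg DDg] := Dg u.
have dDu s : 0 <= s <= 1 -> differentiable ('D_u g) (x + r *: (t *: u) + s *: (t *: v)).
  by move=> s01; apply: dDg; exact: inA'.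
have [s s01 es] := mvt_line dDu.
exists (x + r *: (t *: u) + s *: (t *: v)); first exact: inA.
by rewrite -[LHS]/(phi (x + t *: u) - phi x) er Dphi es deriveZv //; exact: dDu.
Qed.

(** The second difference is symmetric in [u] and [v], so the two mixed derivatives agree when taken
    at suitable points [p] and [q] near [x], hence at [x] by continuity. *)
Lemma schwarz_scalar E (g : E -> R^o) (A : set E) x u v :
  open A -> A x -> Ck 2 A g -> 'D_u ('D_v g) x = 'D_v ('D_u g) x.
Proof.
move=> oA Ax cg.
have cont w w' : {for x, continuous ('D_w ('D_w' g))}.
  apply: differentiable_continuous; apply: (@Ck_differentiable _ 0 _ _ A) => //.
  by have [_ /(_ w')[_ ]] := cg; apply.
apply/eqP; rewrite -subr_eq0 -normr_le0; apply/ler_addgt0Pl => e e0; rewrite addr0.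
have e2 : 0 < e / 2 by rewrite divr_gt0.
have near1 : \forall p \near x, [/\ A p, `|'D_u ('D_v g) x - 'D_u ('D_v g) p| <= e / 2 &
    `|'D_v ('D_u g) x - 'D_v ('D_u g) p| <= e / 2].
  have n1 : \forall p \near x, `|'D_u ('D_v g) x - 'D_u ('D_v g) p| <= e / 2.
    by have /cvgrPdist_le h := cont u v; exact: h.
  have n2 : \forall p \near x, `|'D_v ('D_u g) x - 'D_v ('D_u g) p| <= e / 2.
    by have /cvgrPdist_le h := cont v u; exact: h.
  have n0 : \forall p \near x, A p by exact: open_nbhs_nbhs.
  apply: filterS (filterI n0 (filterI n1 n2)) => p [Ap [h1 h2]]; split.
  - exact: Ap.
  - exact: h1.
  - exact: h2.
have /nbhs_ballP [d /= d0 hd] := near1.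
have S0 : 0 < `|u| + `|v| + 1 by rewrite ltr_wpDl // addr_ge0.
(* The 1 keeps the denominator positive when [u] and [v] both vanish. *)
pose t := d / 2 / (`|u| + `|v| + 1).
have t0 : 0 < t by rewrite !divr_gt0.
have td : t * (`|u| + `|v|) < d.
  apply: (@le_lt_trans _ _ (t * (`|u| + `|v| + 1))).
    by rewrite ler_pM2l // lerDl.
  by rewrite /t divfK ?gt_eqF // ltr_pdivrMr // mulr2n mulrDr mulr1 ltrDl.
have xA : ball x d `<=` A by move=> p /hd [].
have [p px ep] := second_difference cg xA (ltW t0) td.
have td' := td; rewrite addrC in td'; have [q qx eq] := second_difference cg xA (ltW t0) td'.
have : t * (t * 'D_v ('D_u g) p) = t * (t * 'D_u ('D_v g) q).
  have aux (a b c e' : R) : a - b - (c - e') = a - c - (b - e') by ring.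
  have euv : x + t *: u + t *: v = x + t *: v + t *: u by rewrite addrAC.
  apply: (eq_trans (esym ep)); apply: (eq_trans _ eq); rewrite euv; exact: aux.
move=> /(mulfI (lt0r_neq0 t0)) /(mulfI (lt0r_neq0 t0)) epq.
have bp : ball x d p by rewrite -ball_normE; exact: le_lt_trans px td.
have bq : ball x d q by rewrite -ball_normE; exact: le_lt_trans qx td'.
have [_ _ hp] := hd _ bp; have [_ hq _] := hd _ bq.
have aux (a b c : R) : `|a - c| <= e / 2 -> `|b - c| <= e / 2 -> `|a - b| <= e.
  move=> ac bc; rewrite (_ : a - b = (a - c) - (b - c)); last by ring.
  by rewrite (splitr e); apply: le_trans (ler_normB _ _) _; exact: lerD.
by rewrite epq in hp; exact: aux hq hp.
Qed.

Lemma schwarz E F (f : E -> F) (A : set E) x u v : findim F ->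
  open A -> A x -> Ck 2 A f -> 'D_u ('D_v f) x = 'D_v ('D_u f) x.
Proof.
move=> [n [e [l [cl el]]]] oA Ax cf.
suff lE i w w' : l i ('D_w ('D_w' f) x) = 'D_w ('D_w' (fun y => l i (f y))) x.
  apply: (eq_trans (el _)); apply: (eq_trans _ (esym (el _))); apply: eq_bigr => i _.
  apply: (congr1 (fun a => a *: e i)).
  rewrite (lE i u v) (lE i v u); apply: (@schwarz_scalar _ _ A) => //.
  exact: Ck_lin_comp.
have [df Df] := cf; have [dDf _] := Df w'.
rewrite -(derive_lin_comp _ (cl i) (dDf _ Ax)).
apply: near_eq_derive; apply: filterS (open_nbhs_nbhs (conj oA Ax)) => y Ay.
by rewrite derive_lin_comp //; exact: df.
Qed.

End schwarz.

Section differentiability_criteria.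
Context {R : realType}.
Implicit Types E F G H : normedModType R.

Lemma differentiableI E F (g : E -> F) (L : {linear E -> F}) y : continuous L ->
  (forall e : R, 0 < e -> \forall k \near (0 : E), `|g (k + y) - g y - L k| <= e * `|k|) ->
  differentiable g y /\ 'd g y = L :> (E -> F).
Proof.
move=> cL HL.
have Hg : g \o shift y = cst (g y) + L +o_ 0 id.
  apply/eqaddoP => e e0; have := HL e e0; apply: filterS => k.
  by rewrite !fctE /= opprD addrA.
have dE := diff_unique cL Hg.
split=> //; apply/diff_locallyP; split; first by rewrite dE.
by rewrite dE.
Qed.

Lemma differentiable_near E F (f : E -> F) x (e : R) : differentiable f x -> 0 < e ->
  \forall h \near (0 : E), `|f (h + x) - f x - 'd f x h| <= e * `|h|.
Proof.
move=> df e0; have /eqaddoP /(_ e e0) := diff_locally df.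
by apply: filterS => k; rewrite !fctE /= opprD addrA.
Qed.

Lemma cvgr_of_le E F (f : E -> F) (x : E) (y : F) :
  (forall e : R, 0 < e -> \forall t \near x, `|y - f t| <= e) -> f @ x --> y.
Proof. by move=> h; apply/cvgrPdist_le. Qed.

Lemma near0_norm_le E (e : R) : 0 < e -> \forall k \near (0 : E), `|k| <= e.
Proof.
move=> e0; apply: filterS (nbhsx_ballx (0 : E) _ e0) => k.
by rewrite -ball_normE /= sub0r normrN => /ltW.
Qed.

Lemma cvg_translate E (y : E) : (fun k : E => k + y) @ (0 : E) --> y.
Proof.
apply/cvgrPdist_le => e e0; apply: filterS (nbhsx_ballx (0 : E) _ e0) => k.
by rewrite -ball_normE /= sub0r [k + y]addrC opprD addrA subrr add0r => /ltW.
Qed.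

End differentiability_criteria.

(** * Smooth matrices, inverse function theorem and constant rank theorem *)

Section smooth_matrices.
Context {R : realType}.
Implicit Types E F G H : normedModType R.

Lemma Ck_entry k E (A : set E) m n (M : E -> 'M[R]_(m, n)) i j : open A ->
  Ck k A M -> Ck k A (fun x => M x i j : R^o).
Proof.
move=> oA cM; apply: (@Ck_lin_comp _ _ _ _ _ _ (mx_entry i j)) => //.
exact: coord_continuous.
Qed.

Lemma Ck_mx k E (A : set E) m n (M : E -> 'M[R]_(m, n)) : open A ->
  (forall i j, Ck k A (fun x => M x i j : R^o)) -> Ck k A M.
Proof.
move=> oA cM.
apply: (@Ck_ext _ _ _ _ _ (fun x => \sum_i \sum_j M x i j *: delta_mx i j)) => //.
  by move=> x _; rewrite [RHS]matrix_sum_delta.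
apply: Ck_sum => // i _; apply: Ck_sum => // j _; apply: CkZ => //; exact: Ck_cst.
Qed.

Lemma Ck_det k E (A : set E) n (M : E -> 'M[R]_n) : open A ->
  Ck k A M -> Ck k A (fun x => \det (M x) : R^o).
Proof.
move=> oA cM; apply: Ck_sum => // s _; apply: CkM => //; first exact: Ck_cst.
by apply: Ck_prod => // i; exact: Ck_entry.
Qed.

(** By Cramer's rule the inverse is a rational expression in the entries. *)
Lemma Ck_invmx k E (A : set E) n (M : E -> 'M[R]_n) : open A ->
  (forall x, A x -> M x \in unitmx) -> Ck k A M -> Ck k A (fun x => invmx (M x)).
Proof.
move=> oA uM cM.
apply: (@Ck_ext _ _ _ _ _ (fun x => (\det (M x))^-1 *: \adj (M x))) => //.
  by move=> x Ax; rewrite /invmx uM.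
apply: CkZ => //; first apply: CkV => //; last 2 first.
- exact: Ck_det.
- apply: Ck_mx => // i j.
  apply: (@Ck_ext _ _ _ _ _ (fun x => (-1) ^+ (j + i) * \det (row' j (col' i (M x))) : R^o)) => //.
    by move=> x _; rewrite mxE.
  apply: CkM => //; first exact: Ck_cst.
  apply: Ck_det => //; apply: Ck_mx => // a b.
  apply: (@Ck_ext _ _ _ _ _ (fun x => M x (lift j a) (lift i b) : R^o)) => //.
    by move=> x _; rewrite !mxE.
  exact: Ck_entry.
- by move=> x Ax; have := uM x Ax; rewrite unitmxE unitfE.
Qed.

Lemma Ck_mulmx k E (A : set E) m n p (M : E -> 'M[R]_(m, n)) (N : E -> 'M[R]_(n, p)) :
  open A -> Ck k A M -> Ck k A N -> Ck k A (fun x => M x *m N x).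
Proof.
move=> oA cM cN; apply: Ck_mx => // i j.
apply: (@Ck_ext _ _ _ _ _ (fun x => \sum_l M x i l * N x l j : R^o)) => //.
  by move=> x _; rewrite mxE.
by apply: Ck_sum => // l _; apply: CkM => //; exact: Ck_entry.
Qed.

Lemma Ck_jacobian k m n (A : set 'rV[R]_m) (f : 'rV[R]_m -> 'rV[R]_n) : open A ->
  Ck k.+1 A f -> Ck k A (fun x => 'J f x).
Proof.
move=> oA [df Df]; apply: Ck_mx => // i j.
apply: (@Ck_ext _ _ _ _ _ (fun x => 'D_(delta_mx 0 i) f x 0 j : R^o)) => //.
  by move=> x Ax; rewrite !mxE deriveE //; exact: df.
by apply: Ck_entry => //; exact: Df.
Qed.

Lemma mulmxr_cont m n p (B : 'M[R]_(n, p)) : continuous (fun A : 'M[R]_(m, n) => A *m B).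
Proof. exact: (@findim_lin_cont _ _ _ (mulmxr B) (findim_mx m n)). Qed.

Lemma mulmxr_cont_lin m n p (B : 'M[R]_(n, p)) :
  continuous (mulmxr B : {linear 'M[R]_(m, n) -> 'M[R]_(m, p)}).
Proof. exact: mulmxr_cont. Qed.

End smooth_matrices.

Section inverse_function.
Context {R : realType} (N : nat).
Implicit Types (f g : 'rV[R]_N -> 'rV[R]_N).

Definition rV_complete : completeNormedModType R :=
  HB.pack 'rV[R]_N
    (CompletePseudoMetric.class ('rV[R]_N : completePseudoMetricType R))
    (NormedModule.class ('rV[R]_N : normedModType R)).

Lemma fixed_point (x0 : 'rV[R]_N) (d : R) (T : 'rV[R]_N -> 'rV[R]_N) : 0 < d ->
  (forall x, `|x0 - x| <= d -> `|x0 - T x| <= d) ->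
  (forall x y, `|x0 - x| <= d -> `|x0 - y| <= d -> `|T x - T y| <= 2^-1 * `|x - y|) ->
  exists2 x, `|x0 - x| <= d & x = T x.
Proof.
move=> d0 TB TL; pose U := closed_ball x0 d.
have UE x : U x <-> `|x0 - x| <= d by rewrite /U closed_ballE.
have TU : set_fun U U T by move=> x /UE /TB /UE.
pose Tf : {fun U >-> U} := mkfun_fun TU.
have [x /UE Ux ex] : exists2 p, U p & p = Tf p.
  apply: (@banach_fixed_point R rV_complete U Tf).
  - exists (2^-1)%:nng; split => /=; first by rewrite invf_lt1 // ltr1n.
    by move=> [x y] [/= /UE Ux /UE Uy]; exact: TL.
  - exact: closed_ball_closed.
  - by exists x0; apply/UE; rewrite subrr normr0 ltW.
by exists x.
Qed.

(** Since [f] has derivative the identity at [x0], it is [id + e] with [e] Lipschitz of constant one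
    half nearby. Solving [f x = y] is then finding the fixed point of the contraction
    [x |-> y - e x], and the same bound makes [f] injective with an inverse of Lipschitz constant
    2. *)
Lemma inverse_function (A : set 'rV[R]_N) f x0 : open A -> A x0 ->
  smooth_on A f -> (forall v, 'D_v f x0 = v) ->
  exists (U V : set 'rV[R]_N) g,
    [/\ open U, U x0, U `<=` A, open V & smooth_on V g] /\
    (forall x, U x -> V (f x) /\ g (f x) = x) /\
    (forall y, V y -> U (g y) /\ f (g y) = y).
Proof.
move=> oA Ax0 /smooth_onP sf Df0.
have fN : findim 'rV[R]_N := findim_mx 1 N.
pose e x := f x - x.
have df x : A x -> differentiable f x by exact: Ck_differentiable (sf 0%N).
have se k : Ck k A e.
  apply: CkD => //; apply: findim_Ck_lin => // a u v /=.
  by rewrite opprD scalerN.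
have De0 v : 'D_v e x0 = 0.
  have dN : differentiable (-%R : 'rV[R]_N -> 'rV[R]_N) x0.
    by apply: (@Ck_differentiable _ 0 _ _ setT) => //; apply: findim_Ck_lin.
  rewrite (@deriveD _ _ _ f (-%R)); [|exact: diff_derivable (df _ Ax0)|exact: diff_derivable].
  by rewrite Df0 (@derive_lin _ _ _ (-%R)) ?subrr // ; apply: findim_lin_cont.
have half0 : 0 < 2^-1 :> R by rewrite invr_gt0.
have [d d0 [dA eL]] := small_lipschitz fN fN oA Ax0 (se 1%N) De0 half0.
have d20 : 0 < d / 2 by rewrite divr_gt0.
have d40 : 0 < d / 4 by rewrite divr_gt0.
have inA x : `|x0 - x| <= d / 2 -> ball x0 d x.
  move=> h; rewrite -ball_normE /=; apply: le_lt_trans h _.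
  by rewrite ltr_pdivrMr // mulr2n mulrDr mulr1 ltrDl.
have fl x x' : ball x0 d x -> ball x0 d x' -> `|x - x'| <= 2 * `|f x - f x'|.
  move=> bx bx'; have := eL _ _ bx bx'; rewrite /e => h.
  have h1 : `|x - x'| <= `|f x - f x'| + 2^-1 * `|x - x'|.
    have {1}-> : x - x' = (f x - f x') - (f x - x - (f x' - x')).
      by apply/rowP => i; rewrite !mxE; ring.
    by apply: le_trans (ler_normB _ _) _; rewrite lerD2l; exact: h.
  lra.
(* With this radius [T] maps the closed ball of radius [d / 2] into itself: [d / 4] comes from [y],
   and half of [d / 2] from [e]. Strictness in [V] puts the fixed point in the open ball. *)
pose V := ball (f x0) (d / 4).
have solve y : V y -> exists2 x, ball x0 (d / 2) x & f x = y.
  rewrite /V -!ball_normE /= => Vy.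
  pose T x := y - e x.
  have TE x : x0 - T x = (f x0 - y) - (e x0 - e x).
    by apply/rowP => i; rewrite /T /e !mxE; ring.
  have [x hx xT] : exists2 x, `|x0 - x| <= d / 2 & x = T x.
    apply: fixed_point => // [x hx|x x' hx hx'].
      rewrite TE; apply: le_trans (ler_normB _ _) _.
      have h : `|e x0 - e x| <= 2^-1 * `|x0 - x| := eL _ _ (ballxx x0 d0) (inA _ hx).
      lra.
    have -> : T x - T x' = - (e x - e x') by apply/rowP => i; rewrite /T !mxE; ring.
    by rewrite normrN; exact: eL (inA _ hx) (inA _ hx').
  exists x.
    rewrite [in `|_|]xT TE; apply: le_lt_trans (ler_normB _ _) _.
    have h : `|e x0 - e x| <= 2^-1 * `|x0 - x| := eL _ _ (ballxx x0 d0) (inA _ hx).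
    lra.
  apply/eqP; rewrite -subr_eq0; apply/eqP.
  have -> : f x - y = x - T x by apply/rowP => i; rewrite /T /e !mxE; ring.
  by rewrite -xT subrr.
pose U := ball x0 (d / 2) `&` f @^-1` V.
have bd x : ball x0 (d / 2) x -> ball x0 d x.
  by rewrite -ball_normE /= => /ltW /inA; rewrite -ball_normE.
have UA x : U x -> A x by move=> [/bd /dA].
have oU : open U.
  rewrite openE => x [bx Vx]; apply: filterI.
    by apply: open_nbhs_nbhs; split; [exact: ball_open|].
  apply: (differentiable_continuous (df _ (dA _ (bd _ bx)))).
  by apply: open_nbhs_nbhs; split; [exact: ball_open|].
have oV : open V by exact: ball_open.
pose g y := xget x0 [set x | ball x0 (d / 2) x /\ f x = y].
have gP y : V y -> ball x0 (d / 2) (g y) /\ f (g y) = y.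
  move=> Vy; have [x bx fx] := solve y Vy.
  have h : exists x, [set x | ball x0 (d / 2) x /\ f x = y] x by exists x.
  exact: (xgetPex x0 h).
have gU y : V y -> U (g y) by move=> Vy; have [bg fg] := gP y Vy; split; rewrite /= ?fg.
have gf x : U x -> g (f x) = x.
  move=> [bx Vx]; have [bg fg] := gP _ Vx.
  apply/eqP; rewrite -subr_eq0 -normr_le0; apply: le_trans (fl _ _ (bd _ bg) (bd _ bx)) _.
  by rewrite fg subrr normr0 mulr0.
have gl y y' : V y -> V y' -> `|g y - g y'| <= 2 * `|y - y'|.
  move=> Vy Vy'; have [bg fg] := gP _ Vy; have [bg' fg'] := gP _ Vy'.
  by have := fl _ _ (bd _ bg) (bd _ bg'); rewrite fg fg'.
(* The lower bound [fl] passes to difference quotients and gives [|v| / 2 <= |'D_v f x|], so the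
   Jacobian has no kernel at any point of [U]. *)
have Junit x : U x -> 'J f x \in unitmx.
  move=> Ux; rewrite -row_free_unit -kermx_eq0; apply/eqP/row_matrixP => i.
  rewrite row0; set v := row i _.
  have vJ : v *m 'J f x = 0 by apply/sub_kermxP; exact: row_sub.
  have dv : 'D_v f x = 0 by rewrite deriveEjacobian //; exact/df/UA.
  apply/eqP; rewrite -normr_le0.
  suff : `|v| / 2 <= `|'D_v f x| by rewrite dv normr0; lra.
  have cv : (fun h : R => `|h^-1 *: ((f \o shift x) (h *: v) - f x)|) @ 0^' --> `|'D_v f x|.
    by apply: cvg_norm; apply: diff_derivable; exact/df/UA.
  apply: (cvgr_to_ge cv).
  have n0 : \forall h \near (0 : R), ball x0 d (h *: v + x).
    have c0 : (fun h : R => h *: v + x) @ (0 : R) --> x.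
      rewrite -[X in _ --> X]add0r -(scale0r v); apply: cvgD; last exact: cvg_cst.
      exact: scalel_continuous.
    by apply: c0; apply: open_nbhs_nbhs; split; [exact: ball_open|case: Ux => /bd].
  have n1 : \forall h \near (0 : R)^', ball x0 d (h *: v + x) by exact: nbhs_dnbhs.
  have n2 : \forall h \near (0 : R)^', h != 0 by exact: nbhs_dnbhs_neq.
  apply: filterS (filterI n1 n2) => h /= [bh h0].
  have := fl _ _ bh (bd _ Ux.1); rewrite addrK !normrZ normfV => h1.
  by rewrite ler_pdivlMl ?normr_gt0 // mulrA ler_pdivrMr // [leRHS]mulrC.
have Dg y : V y -> differentiable g y /\
    'd g y = (mulmxr (invmx ('J f (g y))) : {linear 'rV_N -> 'rV_N}) :> (_ -> _).
  move=> Vy; have Ux := gU y Vy; have [bg fg] := gP y Vy.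
  set x := g y in Ux bg fg *; set Ji := invmx _.
  apply: differentiableI; first exact: mulmxr_cont_lin.
  move=> eps eps0.
  have [c c0 hc] := linear_lipschitz (@mulmxr_cont_lin R 1 N N Ji).
  (* The remainder of [g] is the image under [Ji] of the remainder of [f] at [h], up to sign: [c]
     bounds [Ji], and 2 is the Lipschitz constant of [g] that compares [h] with [k]. *)
  have ec0 : 0 < eps / (2 * c) by rewrite divr_gt0 // mulr_gt0.
  have nf := differentiable_near (df _ (UA _ Ux)) ec0.
  have nV : \forall k \near (0 : 'rV[R]_N), V (k + y).
    have c0' : (fun k : 'rV[R]_N => k + y) @ (0 : 'rV[R]_N) --> y by exact: cvg_translate.
    by apply: c0'; apply: open_nbhs_nbhs; split; [exact: ball_open|].
  have gc : (fun k : 'rV[R]_N => g (k + y) - x) @ (0 : 'rV[R]_N) --> (0 : 'rV[R]_N).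
    apply: cvgr_of_le => e1 e10.
    have nb : \forall k \near (0 : 'rV[R]_N), `|k| <= e1 / 2.
      have e12 : 0 < e1 / 2 by rewrite divr_gt0.
      exact: near0_norm_le.
    apply: filterS (filterI nV nb) => k [Vk kb].
    rewrite sub0r normrN; apply: le_trans (gl _ _ Vk Vy) _.
    rewrite addrK; lra.
  apply: filterS (filterI nV (gc _ nf)) => k /= [Vk].
  set h := g (k + y) - x => hh.
  have hx : h + x = g (k + y) by rewrite /h subrK.
  rewrite hx (gP _ Vk).2 fg addrK in hh.
  have e1 : h - k *m Ji = - ((k - 'd f x h) *m Ji).
    rewrite mulmxBl opprB; congr (_ - _).
    rewrite -deriveE; last exact/df/UA.
    rewrite deriveEjacobian; last exact/df/UA.
    by rewrite -mulmxA mulmxV ?mulmx1 //; exact: Junit.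
  rewrite -/h /= e1 normrN; apply: le_trans (hc _) _.
  have h2 : `|h| <= 2 * `|k| by have := gl _ _ Vk Vy; rewrite addrK.
  rewrite -ler_pdivlMl //; apply: le_trans hh _.
  apply: (@le_trans _ _ (eps / (2 * c) * (2 * `|k|))).
    by rewrite ler_pM2l.
  rewrite le_eqVlt; apply/orP; left; apply/eqP; field.
  exact: lt0r_neq0.
exists U, V, g; split; first split => //.
- by split; [exact: ballxx|rewrite /= /V; exact: ballxx].
(* The derivative of [g] along [v] is [v *m invmx ('J f)] taken at [g], so each order of smoothness
   of [g] yields the next. *)
- apply/smooth_onP; elim=> [|k IH]; first by split=> // y Vy; have [] := Dg y Vy.
  split=> [y Vy|v]; first by have [] := Dg y Vy.
  apply: (@Ck_ext _ _ _ _ _ ((fun x => v *m invmx ('J f x)) \o g)) => //.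
    by move=> y Vy; have [dg e1] := Dg y Vy; rewrite deriveE // e1.
  apply: (@Ck_comp _ _ _ _ _ V U) => //.
  apply: Ck_mulmx => //; first exact: Ck_cst.
  apply: Ck_invmx => //.
  by apply: Ck_jacobian => //; apply: Ck_sub (sf k.+1).
- by split=> [x Ux|y Vy]; split; [case: Ux|exact: gf|exact: gU|have [] := gP y Vy].
Qed.

End inverse_function.

Section constant_rank.
Context {R : realType}.

Lemma jacobian_comp m n p (f : 'rV[R]_m -> 'rV[R]_n) (g : 'rV[R]_n -> 'rV[R]_p) x :
  differentiable f x -> differentiable g (f x) ->
  'J (g \o f) x = 'J f x *m 'J g (f x).
Proof.
move=> df dg; apply/row_matrixP => i.
have dgf : differentiable (g \o f) x by exact: differentiable_comp.
by rewrite !rowE mulmxA -(deriveEjacobian _ dgf) -(deriveEjacobian _ df)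
  -(deriveEjacobian _ dg) derive_comp.
Qed.

Lemma continuous_open_at (T U : topologicalType) (f : T -> U) (A : set T) (B : set U) :
  open A -> open B -> (forall x, A x -> {for x, continuous f}) -> open (A `&` f @^-1` B).
Proof.
move=> oA oB cf; rewrite openE => x [Ax Bfx]; apply: filterI.
  by apply: open_nbhs_nbhs.
by apply: (cf x Ax); apply: open_nbhs_nbhs.
Qed.

Lemma smooth_cont (E F : normedModType R) (A : set E) (f : E -> F) x :
  smooth_on A f -> A x -> {for x, continuous f}.
Proof. by move=> sf Ax; apply: differentiable_continuous; exact: (sf [::]). Qed.

(* Replacing [x] by [x - x p s + f x P s], where [s] and [P] are left and right
   inverses of the two factors of the rank factorisation of ['J f x0], gives a
   local diffeomorphism after which [f] only depends on [x p]. *)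
Theorem constant_rank N M r (A : set 'rV[R]_N) (f : 'rV[R]_N -> 'rV[R]_M) x0 :
  open A -> A x0 -> smooth_on A f -> (forall x, A x -> \rank ('J f x) = r) ->
  exists (B : set 'rV[R]_N) (V : set 'rV[R]_r) (s : 'rV[R]_r -> 'rV[R]_N) (P : 'M[R]_(M, r)),
    [/\ open B, B x0, B `<=` A, open V & smooth_on V s] /\
    (forall x, B x -> V (f x *m P) /\ f (s (f x *m P)) = f x) /\
    (forall y, V y -> B (s y) /\ f (s y) *m P = y).
Proof.
move=> oA Ax0 sf rf; have e0 := rf x0 Ax0.
have [J JE] : exists J, 'J f x0 = J by exists ('J f x0).
rewrite JE in e0; subst r.
have csf := (smooth_onP _ _).1 sf.
have fN : findim 'rV[R]_N := findim_mx 1 N.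
have [s [P sJP]] : exists (s : 'M[R]_(\rank J, N)) (P : 'M[R]_(M, \rank J)), s *m J *m P = 1%:M.
  pose P := pinvmx (row_base J); pose s := pinvmx (col_base J); exists s, P.
  have h1 : s *m col_base J = 1%:M by exact: mulVpmx (col_base_full J).
  have h2 : row_base J *m P = 1%:M by exact: mulmxVp (row_base_free J).
  transitivity (s *m (col_base J *m row_base J) *m P); first by rewrite mulmx_base.
  by rewrite (mulmxA s) h1 mul1mx h2.
have [p pE] : exists p, p = J *m P by exists (J *m P).
have sp : s *m p = 1%:M by rewrite pE mulmxA.
pose L1 : 'rV[R]_N -> 'rV[R]_N := fun x => x - x *m p *m s.
have lL1 : linear L1.
  by move=> a u v; rewrite /L1 !mulmxDl -!scalemxAl opprD addrACA scalerBr.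
pose psi x := L1 x + f x *m (P *m s).
have dfA x : A x -> differentiable f x by exact: Ck_differentiable (csf 0%N).
have spsi : smooth_on A psi.
  apply/smooth_onP => k; apply: CkD => //; first exact: findim_Ck_lin.
  by apply: (@Ck_lin_comp _ _ _ _ _ _ (mulmxr (P *m s))) => //; exact: mulmxr_cont_lin.
have Dpsi v : 'D_v psi x0 = v.
  have d1 : differentiable L1 x0.
    exact: (@Ck_differentiable _ 0 _ _ setT _ _ (findim_Ck_lin 0 setT fN lL1)).
  have cP := @mulmxr_cont_lin R 1 M N (P *m s).
  have dm : differentiable (mulmxr (P *m s) : {linear 'rV[R]_M -> 'rV[R]_N}) (f x0).
    by apply: linear_differentiable; exact: cP.
  have d2 : differentiable (fun x => f x *m (P *m s)) x0.
    exact: (differentiable_comp (dfA _ Ax0) dm).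
  rewrite (@deriveD _ _ _ L1 (fun x => f x *m (P *m s))); [|exact: diff_derivable..].
  rewrite (@derive_lin_comp _ _ _ _ (mulmxr (P *m s))) //=; last exact: dfA.
  have [L eL] := lin_pack lL1.
  have cL : continuous L by exact: findim_lin_cont.
  rewrite eL derive_lin // -eL.
  rewrite deriveEjacobian; last exact: dfA.
  by rewrite JE /L1 pE !mulmxA subrK.
have [U [V' [g [[oU Ux0 UA oV' sg] [hU hV]]]]] := inverse_function oA Ax0 spsi Dpsi.
have psip x : psi x *m p = f x *m P.
  by rewrite /psi /L1 mulmxDl mulmxBl -!mulmxA sp !mulmx1 subrr add0r.
pose w0 := psi x0.
have Vw0 : V' w0 by have [] := hU _ Ux0.
pose h := f \o g.
have gU w : V' w -> U (g w) by move=> /hV [].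
have csg := (smooth_onP _ _).1 sg.
have dgV w : V' w -> differentiable g w by exact: Ck_differentiable (csg 0%N).
have dh w : V' w -> differentiable h w.
  by move=> Vw; apply: differentiable_comp; [exact: dgV|exact/dfA/UA/gU].
have hP w : V' w -> h w *m P = w *m p.
  by move=> Vw; rewrite /h /= -psip (hV _ Vw).2.
(* From ['J h w *m P = p] the kernel of ['J h w] lies in that of [p]. The constant rank makes their
   dimensions equal, so they coincide. *)
have kerh w v : V' w -> v *m p = 0 -> 'D_v h w = 0.
  move=> Vw vp; rewrite deriveEjacobian; last exact: dh.
  have HP : 'J h w *m P = p.
    apply/row_matrixP => i; rewrite !rowE mulmxA -deriveEjacobian; last exact: dh.
    rewrite -[LHS](@derive_lin_comp _ _ _ _ (mulmxr P)) //; [|exact: mulmxr_cont_lin|exact: dh].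
    rewrite (_ : delta_mx 0 i *m p = 'D_(delta_mx 0 i) (mulmxr p : {linear _ -> _}) w).
      by apply: near_eq_derive; apply: filterS (open_nbhs_nbhs (conj oV' Vw)) => y /hP.
    by rewrite derive_lin //; exact: mulmxr_cont_lin.
  have rp : \rank p = \rank J.
    apply/eqP; rewrite eqn_leq {1}pE mxrankM_maxl /=.
    by rewrite -{1}(mxrank1 R (\rank J)) -sp mxrankM_maxr.
  have rh : \rank ('J h w) = \rank J.
    apply/eqP; rewrite eqn_leq; apply/andP; split; last first.
      by rewrite -rp -HP; exact: mxrankM_maxl.
    have -> : 'J h w = 'J g w *m 'J f (g w).
      by rewrite jacobian_comp //; [exact: dgV|exact/dfA/UA/gU].
    rewrite -(rf (g w)); last exact/UA/gU.
    exact: mxrankM_maxr.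
  have kk : (kermx p <= kermx ('J h w))%MS.
    have k1 : (kermx ('J h w) <= kermx p)%MS.
      by apply/sub_kermxP; rewrite -HP mulmxA mulmx_ker mul0mx.
    by rewrite -(geq_leqif (mxrank_leqif_sup k1)) !mxrank_ker rp rh.
  have /sub_kermxP v1 : (v <= kermx ('J h w))%MS by apply: submx_trans kk; apply/sub_kermxP.
  exact: v1.
have /nbhs_ballP [d /= d0 dV] : nbhs w0 V' by apply: open_nbhs_nbhs.
have hconst w w' : ball w0 d w -> ball w0 d w' -> (w - w') *m p = 0 -> h w = h w'.
  move=> bw bw' kw; apply/eqP; rewrite -subr_eq0 -normr_le0.
  have [K K0 hK] := @mvi R 'rV[R]_N 'rV[R]_M (findim_mx 1 M).
  rewrite -[w](subrK w') [w - w' + w']addrC -(mulr0 K).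
  have inV t : 0 <= t <= 1 -> V' (w' + t *: (w - w')).
    by move=> t01; apply: dV; exact: ball_segment.
  apply: hK => t t01; first exact/dh/inV.
  by rewrite kerh ?normr0 //; exact: inV.
(* The affine slice through [w0] directed by [s], a section of [w |-> w *m p]. *)
pose q (y : 'rV[R]_(\rank J)) := w0 + (y - w0 *m p) *m s.
have sq : smooth_on setT q.
  apply/smooth_onP => k; have oT := @openT 'rV[R]_(\rank J).
  apply: CkD => //; first exact: Ck_cst.
  apply: (@Ck_lin_comp _ _ _ _ _ _ (mulmxr s)) => //; first exact: mulmxr_cont_lin.
  apply: CkD => //; last exact: Ck_cst.
  by apply: findim_Ck_lin => //; exact: findim_mx.
have cq y : {for y, continuous q} by exact: smooth_cont sq _.
have qp y : q y *m p = y by rewrite /q mulmxDl -mulmxA sp mulmx1 addrC subrK.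
have qq y : q (q y *m p) = q y by rewrite qp.
(* Points whose projection to the slice also stays in the ball; by [hconst], [h] takes the same
   value at a point and at its projection. *)
pose W := ball w0 d `&` (fun w => q (w *m p)) @^-1` ball w0 d.
have oW : open W.
  apply: continuous_open_at; [exact: ball_open|exact: ball_open|].
  move=> w _; have c1 := @mulmxr_cont R 1 N _ p w.
  exact: (@continuous_comp _ _ _ (fun w : 'rV[R]_N => w *m p) q w c1 (cq _)).
have WV w : W w -> V' w by move=> [/dV].
have Ww0 : W w0.
  by split; rewrite /= /q ?subrr ?mul0mx ?addr0; exact: ballxx.
exists (U `&` psi @^-1` W), (setT `&` q @^-1` W), (g \o q), P; split; first split.
- by apply: continuous_open_at; [exact: oU|exact: oW|move=> x Ux; apply: smooth_cont spsi _; exact: UA].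
- by split.
- by move=> x [/UA].
- by apply: continuous_open_at; [exact: openT|exact: oW|move=> y _; exact: cq].
- apply/smooth_onP => k; apply: (@Ck_comp _ _ _ _ _ _ V') => //.
  + by apply: continuous_open_at; [exact: openT|exact: oW|move=> y _; exact: cq].
  + by move=> y [_ /WV].
  + by apply: Ck_sub ((smooth_onP _ _).1 sq k).
split=> [x [Ux Wx]|y [_ Wy]].
  have [bw bqw] := Wx; rewrite /= psip in bqw.
  split; first by split=> //; split; rewrite /= ?qq ?qp.
  rewrite -[RHS]/(f x) -{2}(hU _ Ux).2; apply: (hconst _ _ bqw bw).
  by rewrite mulmxBl qp psip subrr.
have Vq := WV _ Wy; split.
  by split; [exact: gU|rewrite /= (hV _ Vq).2].
by rewrite -psip /= (hV _ Vq).2 qp.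
Qed.

End constant_rank.

(** * Plots of manifolds *)

Section smooth_on_theory.
Context {R : realType}.
Implicit Types E F G H : normedModType R.

Lemma open_locally (T : topologicalType) (D : set T) :
  (forall y, D y -> exists Z, [/\ open Z, Z y & Z `<=` D]) -> open D.
Proof.
move=> h; rewrite openE => y /h [Z [oO Oy OD]].
by apply: (filterS OD _); exact: open_nbhs_nbhs.
Qed.

Lemma smooth_on_locally E F (D : set E) (f : E -> F) :
  (forall y, D y -> exists Z, Z y /\ smooth_on Z f) -> smooth_on D f.
Proof. by move=> h vs y /h [Z [Oy sO]]; exact: sO. Qed.

Lemma smooth_on_sub E F (A B : set E) (f : E -> F) :
  B `<=` A -> smooth_on A f -> smooth_on B f.
Proof. by move=> BA sf vs x /BA; exact: sf. Qed.

Lemma smooth_on_ext E F (A : set E) (f g : E -> F) : open A ->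
  (forall x, A x -> f x = g x) -> smooth_on A f -> smooth_on A g.
Proof. by move=> oA fg /smooth_onP cf; apply/smooth_onP => k; exact: Ck_ext (cf k). Qed.

Lemma smooth_on_comp E F G (A : set E) (B : set F) (f : E -> F) (g : F -> G) :
  findim F -> open A -> open B -> (forall x, A x -> B (f x)) ->
  smooth_on A f -> smooth_on B g -> smooth_on A (g \o f).
Proof.
move=> fF oA oB AB /smooth_onP cf /smooth_onP cg; apply/smooth_onP => k.
exact: (@Ck_comp _ _ _ _ _ A B).
Qed.

Lemma smooth_on_differentiable E F (A : set E) (f : E -> F) x :
  smooth_on A f -> A x -> differentiable f x.
Proof. by move=> sf Ax; exact: (sf [::]). Qed.

Lemma smooth_on_D E F (A : set E) (f : E -> F) v : smooth_on A f -> smooth_on A ('D_v f).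
Proof. by move=> /smooth_on_deriv [_]; apply. Qed.

Lemma smooth_on_lin E F (A : set E) (L : E -> F) : findim E -> linear L -> smooth_on A L.
Proof. by move=> fE lL; apply/smooth_onP => k; exact: findim_Ck_lin. Qed.

Lemma smooth_on_cst E F (A : set E) (c : F) : smooth_on A (fun=> c).
Proof. by apply/smooth_onP => k; exact: Ck_cst. Qed.

Lemma smooth_on_add E F (A : set E) (f g : E -> F) : open A ->
  smooth_on A f -> smooth_on A g -> smooth_on A (fun x => f x + g x).
Proof. by move=> oA /smooth_onP cf /smooth_onP cg; apply/smooth_onP => k; exact: CkD. Qed.

Lemma smooth_on_bilin E F G H (b : F -> G -> H) (A : set E) (f : E -> F) (g : E -> G) :
  bilin b -> open A -> smooth_on A f -> smooth_on A g ->
  smooth_on A (fun x => b (f x) (g x)).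
Proof.
by move=> bb oA /smooth_onP cf /smooth_onP cg; apply/smooth_onP => k; exact: Ck_bilin.
Qed.

Lemma smooth_on_pair E F G (A : set E) (f : E -> F) (g : E -> G) : open A ->
  smooth_on A f -> smooth_on A g -> smooth_on A (fun x => (f x, g x)).
Proof. by move=> oA /smooth_onP cf /smooth_onP cg; apply/smooth_onP => k; exact: Ck_pair. Qed.

Lemma smooth_on_fst E F (A : set (E * F)) : smooth_on A fst.
Proof. by apply/smooth_onP => k; apply: Ck_lin; exact: fst_cont. Qed.

Lemma smooth_on_snd E F (A : set (E * F)) : smooth_on A snd.
Proof. by apply/smooth_onP => k; apply: Ck_lin; exact: snd_cont. Qed.

Lemma near_open (T : topologicalType) (A : set T) (x : T) :
  open A -> A x -> \forall y \near x, A y.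
Proof. by move=> oA Ax; exact: open_nbhs_nbhs. Qed.

End smooth_on_theory.

Section plots.
Context {R : realType}.

(* Plots, i.e. smooth maps from an open subset of a normed space into a
   manifold, let tangent vectors and forms on a manifold be handled as
   functions on normed spaces, independently of the preferred charts. *)
Definition plot (E F : normedModType R) (M : Type) (A : manifold F M)
    (U : set E) (g : E -> M) : Prop :=
  forall y, U y -> exists p Z, [/\ open Z, Z y,
    Z `<=` U `&` g @^-1` chart_dom A p & smooth_on Z (chart A p \o g)].

(** The chart is that of [g y], in keeping with the convention on tangent spaces; hence the result
    need not be continuous in [y]. *)
Definition velocity (E F : normedModType R) (M : Type) (A : manifold F M)
    (g : E -> M) (y v : E) : F := 'D_v (chart A (g y) \o g) y.

Definition chart_image (F : normedModType R) (M : Type) (A : manifold F M) (p : M) : set F :=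
  chart A p @` chart_dom A p.

End plots.

Section plot_theory.
Context {R : realType} (F : normedModType R) (M : Type) (A : manifold F M).
Context {fF : findim F}.

Lemma chart_image_open p : open (chart_image A p).
Proof. by have := chart_open A p p; rewrite setIid. Qed.

Lemma chart_imageP p q : chart_dom A p q -> chart_image A p (chart A p q).
Proof. by move=> pq; exists q. Qed.

Lemma chart_image_self p : chart_image A p (chart A p p).
Proof. exact/chart_imageP/chart_domP. Qed.

Lemma chart_inv_dom p x : chart_image A p x -> chart_dom A p (chart_inv A p x).
Proof. by move=> [q pq <-]; rewrite chartK. Qed.

Lemma chart_invK p x : chart_image A p x -> chart A p (chart_inv A p x) = x.
Proof. by move=> [q pq <-]; rewrite chartK. Qed.

Lemma chart_inter p (W : set M) : chart A p @` (chart_dom A p `&` W) =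
  chart_image A p `&` chart_inv A p @^-1` W.
Proof.
apply/seteqP; split=> [_ [x [px Wx] <-]|_ [[x px <-] /=]].
  by split; [exact: chart_imageP|rewrite /= chartK].
by rewrite chartK // => Wx; exists x.
Qed.

Section on_domain.
Context (E : normedModType R).
Implicit Types (U : set E) (g : E -> M).

(** A plot is smooth in every chart and not only in the one that witnesses it: insert the transition
    map. *)
Lemma plot_chart U g q : plot A U g ->
  open (U `&` g @^-1` chart_dom A q) /\
  smooth_on (U `&` g @^-1` chart_dom A q) (chart A q \o g).
Proof.
move=> pg.
have key y : (U `&` g @^-1` chart_dom A q) y -> exists Z, [/\ open Z, Z y,
    Z `<=` U `&` g @^-1` chart_dom A q & smooth_on Z (chart A q \o g)].
  move=> [Uy qy]; have [p [Z [oO Oy OU sO]]] := pg y Uy.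
  pose T := chart A p @` (chart_dom A p `&` chart_dom A q).
  have oT : open T by exact: chart_open.
  have oO' : open (Z `&` (chart A p \o g) @^-1` T).
    by apply: continuous_open_at => // x Ox; exact: smooth_cont sO Ox.
  exists (Z `&` (chart A p \o g) @^-1` T); split => //.
  - by split=> //=; exists (g y) => //; split=> //; have [] := OU _ Oy.
  - move=> z [Oz [x [px qx] /= xz]]; have [Uz pz] := OU _ Oz; split=> //=.
    by rewrite -(chartK pz) -xz chartK.
  - apply: (@smooth_on_ext _ _ _ _ ((chart A q \o chart_inv A p) \o (chart A p \o g))) => //.
      by move=> z [Oz _] /=; have [_ pz] := OU _ Oz; rewrite chartK.
    apply: (@smooth_on_comp _ _ _ _ _ T) => //; first by move=> z [].
      by apply: smooth_on_sub sO => z [].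
    exact: chart_smooth.
split; first by apply: open_locally => y /key [Z [? ? ? _]]; exists Z.
by apply: smooth_on_locally => y /key [Z [? ? ? ?]]; exists Z.
Qed.

Lemma plot_open U g : plot A U g -> open U.
Proof.
move=> pg; apply: open_locally => y /pg [p [Z [oO Oy OU _]]]; exists Z; split=> //.
by move=> z /OU [].
Qed.

Lemma plot_sub U W g : open W -> W `<=` U -> plot A U g -> plot A W g.
Proof.
move=> oW WU pg y Wy; have [p [Z [oO Oy OU sO]]] := pg y (WU _ Wy).
exists p, (Z `&` W); split=> //; first exact: openI.
  by move=> z [/OU [_ ?] ?].
by apply: smooth_on_sub sO => z [].
Qed.

Lemma plot_ext U g g' : (forall y, U y -> g y = g' y) -> plot A U g -> plot A U g'.
Proof.
move=> gg pg y Uy; have [p [Z [oO Oy OU sO]]] := pg y Uy.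
exists p, Z; split=> //.
  by move=> z /OU [Uz gz]; split=> //=; rewrite -gg.
by apply: smooth_on_ext sO => // z /OU [Uz _] /=; rewrite gg.
Qed.

Lemma plot_preimage U g (W : set M) : plot A U g -> mopen A W -> open (U `&` g @^-1` W).
Proof.
move=> pg oW; apply: open_locally => y [Uy Wy].
have [oD sD] := plot_chart (g y) pg.
exists ((U `&` g @^-1` chart_dom A (g y)) `&`
  (chart A (g y) \o g) @^-1` (chart A (g y) @` (chart_dom A (g y) `&` W))); split.
- by apply: continuous_open_at => // x Ux; exact: smooth_cont sD Ux.
- split; first by split=> //=; exact: chart_domP.
  by exists (g y) => //; split=> //; exact: chart_domP.
- move=> z [[Uz pz] [x [px Wx] /= e]]; split=> //=.
  by rewrite -(chartK pz) -e chartK.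
Qed.

Lemma plot_near U g y : plot A U g -> U y -> \forall z \near y, U z /\ chart_dom A (g y) (g z).
Proof.
move=> pg Uy; have [oD _] := plot_chart (g y) pg.
by apply: filterS (near_open oD (conj Uy (chart_domP A (g y)))) => z [].
Qed.

Lemma plot_differentiable U g y q : plot A U g -> U y -> chart_dom A q (g y) ->
  differentiable (chart A q \o g) y.
Proof.
move=> pg Uy qy; have [oD sD] := plot_chart q pg.
by apply: (smooth_on_differentiable sD _).
Qed.

Lemma velocityE U g y v : plot A U g -> U y ->
  velocity A g y v = 'd (chart A (g y) \o g) y v.
Proof.
by move=> pg Uy; rewrite /velocity deriveE //; apply: (plot_differentiable pg _ _) => //;
  exact: chart_domP.
Qed.

End on_domain.

Lemma plot_comp_smooth (E E' : normedModType R) (U : set E) (W : set E') (g : E -> M)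
    (h : E' -> E) : findim E -> open W -> (forall x, W x -> U (h x)) -> smooth_on W h ->
  plot A U g -> plot A W (g \o h).
Proof.
move=> fE oW WU sh pg y Wy; have [p [Z [oO Oy OU sO]]] := pg _ (WU _ Wy).
have oWO : open (W `&` h @^-1` Z).
  by apply: continuous_open_at => // x Wx; exact: smooth_cont sh Wx.
exists p, (W `&` h @^-1` Z); split=> //.
- by move=> z [Wz Oz]; split=> //=; have [] := OU _ Oz.
- apply: (@smooth_on_comp _ _ _ _ _ Z h (chart A p \o g)) => //; first by move=> z [].
  by apply: smooth_on_sub sh => z [].
Qed.

Lemma velocity_comp (E E' : normedModType R) (U : set E) (g : E -> M)
    (h : E' -> E) y v : plot A U g -> U (h y) -> differentiable h y ->
  velocity A (g \o h) y v = velocity A g (h y) ('D_v h y).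
Proof.
move=> pg Uy dh; rewrite /velocity /=.
rewrite -[LHS]/('D_v ((chart A (g (h y)) \o g) \o h) y) derive_comp //.
by apply: (plot_differentiable pg _ _) => //; exact: chart_domP.
Qed.

Lemma plot_chart_inv p : plot A (chart_image A p) (chart_inv A p).
Proof.
move=> y [x px <-]; exists p, (chart_image A p); split.
- exact: chart_image_open.
- exact: chart_imageP.
- by move=> _ [z pz <-]; split=> /=; [exact: chart_imageP|rewrite chartK].
- apply: (@smooth_on_ext _ _ _ _ id); [exact: chart_image_open| |exact: smooth_on_id].
  by move=> z pz /=; rewrite chart_invK.
Qed.

(** Every tangent vector at [p] is thus a velocity of the plot [chart_inv A p], which reduces
    statements on tangent vectors to statements on plots. *)
Lemma velocity_chart_inv p v : velocity A (chart_inv A p) (chart A p p) v = v.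
Proof.
rewrite /velocity chartK; last exact: chart_domP.
rewrite -[RHS](derive_id (chart A p p)); apply: near_eq_derive.
by apply: filterS (near_open (chart_image_open p) (chart_image_self p)) => z /chart_invK.
Qed.

Lemma chart_vectorE p x v : chart_image A p x ->
  chart_vector A p x v = velocity A (chart_inv A p) x v.
Proof. by move=> px; rewrite (velocityE _ (@plot_chart_inv p) px). Qed.

End plot_theory.

Section smooth_map_theory.
Context {R : realType} (E F G : normedModType R) (M N L : Type).
Context (A : manifold E M) (B : manifold F N) (C : manifold G L).
Context {fE : findim E} {fF : findim F} {fG : findim G}.

Lemma smooth_map_plot (f : M -> N) p : smooth_map A B f ->
  plot B (chart_image A p) (f \o chart_inv A p).
Proof.
move=> sf y py; have [oD sD] := sf p (f (chart_inv A p y)).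
exists (f (chart_inv A p y)); eexists; split; [exact: oD| | |exact: sD].
  by rewrite chart_inter; split=> //=; exact: chart_domP.
by rewrite chart_inter.
Qed.

(** The passage from pairs of charts to plots: composites and products are afterwards treated on the
    source side only. *)
Lemma smooth_mapP (f : M -> N) :
  smooth_map A B f <-> forall p, plot B (chart_image A p) (f \o chart_inv A p).
Proof.
split=> [sf p|pf p q]; first exact: smooth_map_plot.
rewrite chart_inter; exact: (plot_chart q (pf p)).
Qed.

Lemma plot_comp (D : normedModType R) (U : set D) (f : M -> N) g :
  smooth_map A B f -> plot A U g -> plot B U (f \o g).
Proof.
move=> sf pg y Uy; have [oD sD] := plot_chart (g y) pg.
have [oT sT] := sf (g y) (f (g y)); set T := _ @` _ in oT sT.
have oO : open ((U `&` g @^-1` chart_dom A (g y)) `&` (chart A (g y) \o g) @^-1` T).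
  by apply: continuous_open_at => // x Ux; exact: smooth_cont sD Ux.
have TE : T = chart_image A (g y) `&` chart_inv A (g y) @^-1` (f @^-1` chart_dom B (f (g y))).
  by rewrite -chart_inter.
exists (f (g y)); eexists; split; [exact: oO| | |].
- split; first by split=> //=; exact: chart_domP.
  by exists (g y) => //; split=> /=; exact: chart_domP.
- move=> z [[Uz pz]]; rewrite TE => -[_ qz]; split=> //=.
  by move: qz; rewrite /= chartK.
- apply: (@smooth_on_ext _ _ _ _ ((chart B (f (g y)) \o f \o chart_inv A (g y)) \o
      (chart A (g y) \o g))) => //.
    by move=> z [[Uz pz] _] /=; rewrite chartK.
  apply: (@smooth_on_comp _ _ _ _ _ T) => //; first by move=> z [].
  by apply: smooth_on_sub sD => z [].
Qed.

Lemma velocity_smooth_map (D : normedModType R) (U : set D) (f : M -> N) g y v :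
  smooth_map A B f -> plot A U g -> U y ->
  velocity B (f \o g) y v = tangent_map A B f (g y) (velocity A g y v).
Proof.
move=> sf pg Uy.
have dg : differentiable (chart A (g y) \o g) y.
  by apply: (plot_differentiable pg Uy); exact: chart_domP.
have df : differentiable (chart B (f (g y)) \o f \o chart_inv A (g y)) (chart A (g y) (g y)).
  have [oT sT] := sf (g y) (f (g y)); apply: (smooth_on_differentiable sT _).
  by exists (g y) => //; split=> /=; exact: chart_domP.
rewrite /velocity /tangent_map -deriveE // -[in RHS](derive_comp _ dg df).
apply: near_eq_derive; apply: filterS (plot_near pg Uy) => z [Uz pz] /=.
by rewrite chartK.
Qed.

Lemma tangent_mapE (f : M -> N) p v : smooth_map A B f ->
  tangent_map A B f p v = velocity B (f \o chart_inv A p) (chart A p p) v.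
Proof.
move=> sf; rewrite (velocity_smooth_map _ sf (@plot_chart_inv _ _ _ A p)).
  by rewrite velocity_chart_inv chartK //; exact: chart_domP.
exact: chart_image_self.
Qed.

Lemma smooth_map_open (f : M -> N) (W : set N) : smooth_map A B f -> mopen B W ->
  mopen A (f @^-1` W).
Proof.
move=> /smooth_mapP sf oW p; rewrite chart_inter.
exact: (plot_preimage (sf p) oW).
Qed.

End smooth_map_theory.

Section smooth_map_comp.
Context {R : realType} (E F G : normedModType R) (M N L : Type).
Context (A : manifold E M) (B : manifold F N) (C : manifold G L).
Context {fE : findim E} {fF : findim F} {fG : findim G}.

Lemma smooth_map_comp (f : M -> N) (g : N -> L) :
  smooth_map A B f -> smooth_map B C g -> smooth_map A C (g \o f).
Proof.
move=> sf sg; apply/smooth_mapP => // p.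
rewrite -[_ \o _]/(g \o (f \o chart_inv A p)).
by apply: plot_comp sg _; exact: smooth_map_plot.
Qed.

Lemma tangent_map_comp (f : M -> N) (g : N -> L) p v :
  smooth_map A B f -> smooth_map B C g ->
  tangent_map A C (g \o f) p v = tangent_map B C g (f p) (tangent_map A B f p v).
Proof.
move=> sf sg; have sgf := smooth_map_comp sf sg.
rewrite (tangent_mapE _ _ sgf) (tangent_mapE _ _ sf).
have pf := smooth_map_plot (p := p) sf.
rewrite -[LHS]/(velocity C (g \o (f \o chart_inv A p)) (chart A p p) v).
rewrite (velocity_smooth_map _ sg pf); last exact: chart_image_self.
by rewrite /= chartK //; exact: chart_domP.
Qed.

Lemma smooth_map_id : smooth_map A A id.
Proof. by apply/smooth_mapP => // p; exact: plot_chart_inv. Qed.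

Lemma tangent_map_id p v : tangent_map A A id p v = v.
Proof. by rewrite (tangent_mapE _ _ smooth_map_id) velocity_chart_inv. Qed.

End smooth_map_comp.

Section plots_products.
Context {R : realType} (D E F : normedModType R) (M N : Type).
Context (A : manifold E M) (B : manifold F N).
Context {fE : findim E} {fF : findim F}.

Lemma plot_vmanifold (U : set D) (g : D -> E) :
  plot (vmanifold E) U g <-> open U /\ smooth_on U g.
Proof.
split=> [pg|[oU sg] y Uy]; last by exists 0, U; split.
split; first exact: plot_open pg.
by apply: smooth_on_locally => y /pg [p [Z [_ Oy _ sO]]]; exists Z.
Qed.

Lemma velocity_vmanifold (g : D -> E) y v : velocity (vmanifold E) g y v = 'D_v g y.
Proof. by []. Qed.

Lemma plot_pair (U : set D) (g : D -> M) (h : D -> N) :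
  plot A U g -> plot B U h -> plot (prod_manifold A B) U (fun y => (g y, h y)).
Proof.
move=> pg ph y Uy; have [p [Z [oO Oy OU sO]]] := pg y Uy.
have [q [Z' [oO' Oy' OU' sO']]] := ph y Uy.
exists (p, q), (Z `&` Z'); split; [exact: openI|by split| |].
  by move=> z [/OU [Uz pz] /OU' [_ qz]]; split.
apply: (@smooth_on_ext _ _ _ _ (fun y => ((chart A p \o g) y, (chart B q \o h) y))) => //.
  exact: openI.
by apply: smooth_on_pair; [exact: openI|apply: smooth_on_sub sO|apply: smooth_on_sub sO'] => z [].
Qed.

Lemma velocity_pair (U : set D) (g : D -> M) (h : D -> N) y v :
  plot A U g -> plot B U h -> U y ->
  velocity (prod_manifold A B) (fun y => (g y, h y)) y v =
  (velocity A g y v, velocity B h y v).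
Proof.
move=> pg ph Uy; rewrite /velocity /=.
have d1 : differentiable (chart A (g y) \o g) y.
  by apply: (plot_differentiable pg Uy); exact: chart_domP.
have d2 : differentiable (chart B (h y) \o h) y.
  by apply: (plot_differentiable ph Uy); exact: chart_domP.
rewrite -[LHS]/('D_v (fun z => ((chart A (g y) \o g) z, (chart B (h y) \o h) z)) y).
by rewrite deriveE ?diff_pair -?deriveE //; exact: differentiable_pair.
Qed.

End plots_products.

Section product_maps.
Context {R : realType} (E F : normedModType R) (M N : Type).
Context (A : manifold E M) (B : manifold F N).
Context {fE : findim E} {fF : findim F}.

Lemma smooth_map_fst : smooth_map (prod_manifold A B) A fst.
Proof.
apply/smooth_mapP => // -[p q].
apply: (@plot_comp_smooth _ _ _ _ _ _ (chart_image A p) _ _ fst).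
- exact: chart_image_open.
- by move=> _ [[x y] [px _] <-]; exists x.
- exact: smooth_on_fst.
- exact: plot_chart_inv.
Qed.

Lemma smooth_map_snd : smooth_map (prod_manifold A B) B snd.
Proof.
apply/smooth_mapP => // -[p q].
apply: (@plot_comp_smooth _ _ _ _ _ _ (chart_image B q) _ _ snd).
- exact: chart_image_open.
- by move=> _ [[x y] [_ py] <-]; exists y.
- exact: smooth_on_snd.
- exact: plot_chart_inv.
Qed.

Lemma tangent_map_fst p v : tangent_map (prod_manifold A B) A fst p v = v.1.
Proof.
have fEF := findim_prod fE fF.
rewrite (tangent_mapE _ _ smooth_map_fst).
rewrite -[fst \o _]/(chart_inv A p.1 \o fst).
rewrite (velocity_comp _ (@plot_chart_inv _ _ _ A p.1)).
- rewrite -[(chart (prod_manifold A B) p p).1]/(chart A p.1 p.1) velocity_chart_inv.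
  by rewrite derive_lin //; exact: fst_cont.
- exact: chart_image_self.
- exact: differentiable_fst.
Qed.

Lemma tangent_map_snd p v : tangent_map (prod_manifold A B) B snd p v = v.2.
Proof.
have fEF := findim_prod fE fF.
rewrite (tangent_mapE _ _ smooth_map_snd).
rewrite -[snd \o _]/(chart_inv B p.2 \o snd).
rewrite (velocity_comp _ (@plot_chart_inv _ _ _ B p.2)).
- rewrite -[(chart (prod_manifold A B) p p).2]/(chart B p.2 p.2) velocity_chart_inv.
  by rewrite derive_lin //; exact: snd_cont.
- exact: chart_image_self.
- exact: differentiable_snd.
Qed.

End product_maps.

(** * Lie groups and the Maurer-Cartan equation *)

Section partial_derivatives.
Context {R : realType} (E F G : normedModType R).

Lemma derive_fstv (f : E * F -> G) x y v : 'D_(v, 0) f (x, y) = 'D_v (fun z => f (z, y)) x.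
Proof.
rewrite /derive; suff -> : (fun h : R => h^-1 *: ((f \o shift (x, y)) (h *: (v, 0)) - f (x, y))) =
  (fun h => h^-1 *: (((fun z => f (z, y)) \o shift x) (h *: v) - f (x, y))) by [].
apply/funext => h /=; congr (_ *: (f _ - _)).
by apply/pair_eqP; rewrite /pair_eq /= scaler0 add0r !eqxx.
Qed.

Lemma derive_sndv (f : E * F -> G) x y v : 'D_(0, v) f (x, y) = 'D_v (fun z => f (x, z)) y.
Proof.
rewrite /derive; suff -> : (fun h : R => h^-1 *: ((f \o shift (x, y)) (h *: (0, v)) - f (x, y))) =
  (fun h => h^-1 *: (((fun z => f (x, z)) \o shift y) (h *: v) - f (x, y))) by [].
apply/funext => h /=; congr (_ *: (f _ - _)).
by apply/pair_eqP; rewrite /pair_eq /= scaler0 add0r !eqxx.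
Qed.

End partial_derivatives.

Lemma eq_derive {R : realType} (E F : normedModType R) (f g : E -> F) x v :
  f =1 g -> 'D_v f x = 'D_v g x.
Proof. by move=> /funext ->. Qed.

Section lie_theory.
Context {R : realType} {n : nat} {G : groupType} (A : manifold 'rV[R]_n G).
Context (hG : lie_group A).
Local Notation g_ := 'rV[R]_n.
Local Notation e0 := (chart A 1%g 1%g).

Lemma plot_mul (E : normedModType R) (U : set E) (g h : E -> G) :
  plot A U g -> plot A U h -> plot A U (fun y => (g y * h y)%g).
Proof.
move=> pg ph; rewrite -[fun y => _]/((fun x : G * G => (x.1 * x.2)%g) \o (fun y => (g y, h y))).
by apply: plot_comp hG.1 _; exact: plot_pair.
Qed.

Lemma plot_invg (E : normedModType R) (U : set E) (g : E -> G) :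
  plot A U g -> plot A U (fun y => (g y)^-1%g).
Proof.
by move=> pg; rewrite -[fun y => _]/((fun x => x^-1%g) \o g); exact: plot_comp hG.2 _.
Qed.

Lemma plot_const (E F : normedModType R) M (B : manifold F M) (U : set E) (k : M) :
  open U -> plot B U (fun=> k).
Proof.
move=> oU y Uy; exists k, U; split => //.
  by move=> z Uz; split=> //=; exact: chart_domP.
by rewrite (_ : _ \o _ = fun=> chart B k k) //; exact: smooth_on_cst.
Qed.

Lemma smooth_map_mulr k : smooth_map A A (fun x => (x * k)%g).
Proof.
apply/smooth_mapP => p.
rewrite -[_ \o _]/(fun y => (chart_inv A p y * k)%g).
by apply: plot_mul; [exact: plot_chart_inv|apply: plot_const; exact: chart_image_open].
Qed.

Lemma smooth_map_mull k : smooth_map A A (fun x => (k * x)%g).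
Proof.
apply/smooth_mapP => p.
rewrite -[_ \o _]/(fun y => (k * chart_inv A p y)%g).
by apply: plot_mul; [apply: plot_const; exact: chart_image_open|exact: plot_chart_inv].
Qed.

Lemma smooth_map_conj k : smooth_map A A (fun x => (k * x * k^-1)%g).
Proof.
have := smooth_map_comp (smooth_map_mull k) (smooth_map_mulr (k^-1)%g).
exact.
Qed.

(* The right logarithmic derivative of a plot [g], i.e. the velocity of [g]
   translated to the identity. *)
Definition logd (E : normedModType R) (g : E -> G) (y v : E) : g_ :=
  'D_v (fun z => chart A 1%g (g z * (g y)^-1)%g) y.

Lemma velocity_at1 (E : normedModType R) (g : E -> G) (y v : E) :
  g y = 1%g -> velocity A g y v = logd g y v.
Proof.
move=> gy; rewrite /velocity /logd gy.
by apply: eq_derive => z /=; rewrite invg1 mulg1.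
Qed.

Lemma logd_mulr (E : normedModType R) (g : E -> G) (k : G) (y v : E) :
  logd (fun z => (g z * k)%g) y v = logd g y v.
Proof.
rewrite /logd; apply: eq_derive => z.
by rewrite mulgKA.
Qed.

Lemma logd_TR (E : normedModType R) (U : set E) (g : E -> G) (y v : E) :
  plot A U g -> U y -> logd g y v = TR A (g y)^-1%g (g y) (velocity A g y v).
Proof.
move=> pg Uy; rewrite /TR -(velocity_smooth_map v (smooth_map_mulr (g y)^-1%g) pg Uy).
by rewrite velocity_at1; [exact: esym (logd_mulr _ _ _ _)|exact: mulgV].
Qed.

Lemma AdE g v : Ad A g v = 'D_v (fun x => chart A 1%g (g * chart_inv A 1 x * g^-1)%g) e0.
Proof.
rewrite /Ad (tangent_mapE _ _ (smooth_map_conj g)) /velocity /=.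
by rewrite chartK ?mulg1 ?mulgV //; exact: chart_domP.
Qed.

Lemma Ad_linear g : linear (Ad A g).
Proof. exact: linearP. Qed.

Lemma Ad1 v : Ad A 1%g v = v.
Proof.
rewrite AdE -[RHS](velocity_chart_inv A 1%g v) /velocity chartK; last exact: chart_domP.
by apply: eq_derive => x /=; rewrite mul1g invg1 mulg1.
Qed.

Lemma AdM g h v : Ad A (g * h)%g v = Ad A g (Ad A h v).
Proof.
have := tangent_map_comp 1%g v (smooth_map_conj h) (smooth_map_conj g).
rewrite /Ad mulg1 mulgV => <-; congr (tangent_map A A _ 1%g v).
by apply/funext => x /=; rewrite invgM !mulgA.
Qed.

Lemma Ad_velocity (E : normedModType R) (U : set E) (h : E -> G) k y v :
  plot A U h -> U y -> h y = 1%g ->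
  'D_v (fun z => chart A 1%g (k * h z * k^-1)%g) y = Ad A k (logd h y v).
Proof.
move=> ph Uy hy; have := velocity_smooth_map v (smooth_map_conj k) ph Uy.
by rewrite hy (velocity_at1 _ hy) /Ad => <-; rewrite /velocity /= hy mulg1 mulgV.
Qed.

Lemma plot_fst (E F : normedModType R) (U : set E) (W : set F) (g : E -> G) :
  findim E -> open W -> plot A U g -> plot A (U `*` W) (fun x => g x.1).
Proof.
move=> fE oW pg; have oU := plot_open pg.
apply: (@plot_comp_smooth _ _ _ _ _ _ U (U `*` W) g fst) => //; first exact: openX_set.
  by move=> x [].
exact: smooth_on_fst.
Qed.

Lemma plot_snd (E F : normedModType R) (U : set E) (W : set F) (g : F -> G) :
  findim F -> open U -> plot A W g -> plot A (U `*` W) (fun x => g x.2).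
Proof.
move=> fF oU pg; have oW := plot_open pg.
apply: (@plot_comp_smooth _ _ _ _ _ _ W (U `*` W) g snd) => //; first exact: openX_set.
  by move=> x [].
exact: smooth_on_snd.
Qed.

Section Ad_smooth.
Context (E : normedModType R) {fE : findim E}.

(** [Ad A (g y) eta] is a partial derivative, at [(y, e0)], of the conjugation [P] read in the chart
    at the identity, and [P] is a plot in both variables jointly. *)
Lemma Ad_smooth (U : set E) (g : E -> G) eta :
  plot A U g -> smooth_on U (fun y => Ad A (g y) eta).
Proof.
move=> pg; have oU := plot_open pg.
pose C := chart_image A 1%g; have oC : open C := @chart_image_open _ _ _ A 1%g.
pose P (x : E * g_) := (g x.1 * chart_inv A 1 x.2 * (g x.1)^-1)%g.
have pP : plot A (U `*` C) P.
  apply: plot_mul; first apply: plot_mul.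
  - exact: plot_fst.
  - exact: (plot_snd (g := chart_inv A 1%g) _ _ (@plot_chart_inv _ _ _ A 1%g)).
  - by apply: plot_invg; exact: plot_fst.
have [oD sD] := plot_chart 1%g pP; set D := _ `&` _ in oD sD.
apply: (@smooth_on_ext _ _ _ _ ('D_(0, eta) (chart A 1%g \o P) \o (fun y => (y, e0)))) => //.
  by move=> y Uy /=; rewrite derive_sndv AdE.
apply: (@smooth_on_comp _ _ _ _ _ D) => //.
- move=> y Uy; split; first by split=> //=; exact: chart_image_self.
  rewrite /= /P /= chartK ?mulg1 ?mulgV; exact: chart_domP.
- by apply: smooth_on_pair => //; [exact: smooth_on_id|exact: smooth_on_cst].
- exact: smooth_on_D.
Qed.

End Ad_smooth.

Lemma smooth_map_Ad eta : smooth_map A (vmanifold g_) (fun g => Ad A g eta).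
Proof.
apply/smooth_mapP => p; apply/plot_vmanifold; split; first exact: chart_image_open.
by apply: (@Ad_smooth _ _ (chart_image A p) (chart_inv A p)); exact: plot_chart_inv.
Qed.

(** The differential of [Ad] at the identity. Bilinearity, antisymmetry and the Jacobi identity are
    proved for it before any exponential exists. *)
Definition bracket (xi eta : g_) : g_ :=
  tangent_map A (vmanifold g_) (fun g => Ad A g eta) 1%g xi.

Lemma bracketE xi eta : bracket xi eta = 'D_xi (fun x => Ad A (chart_inv A 1%g x) eta) e0.
Proof. by rewrite /bracket (tangent_mapE _ _ (smooth_map_Ad eta)). Qed.

Lemma bracket_linl eta : linear (bracket^~ eta).
Proof. by move=> a u v; rewrite /bracket /tangent_map linearP. Qed.

Lemma Ad_chart_inv_diff eta : differentiable (fun x => Ad A (chart_inv A 1%g x) eta) e0.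
Proof.
apply: (@smooth_on_differentiable _ _ _ (chart_image A 1%g)); last exact: chart_image_self.
by apply: (@Ad_smooth _ _ _ (chart_inv A 1%g)); exact: plot_chart_inv.
Qed.

Lemma bracket_linr xi : linear (bracket xi).
Proof.
move=> a u v; rewrite !bracketE.
pose f eta x := Ad A (chart_inv A 1%g x) eta.
have d w : derivable (f w) e0 xi by apply: diff_derivable; exact: Ad_chart_inv_diff.
have e1 := deriveD (derivableZ (k := a) (d u)) (d v).
rewrite (deriveZ a (d u)) in e1; apply: (eq_trans _ e1).
by apply: eq_derive => x; exact: Ad_linear.
Qed.

Lemma bracket_bilin : bilin bracket.
Proof. by apply: findim_bilin; [exact: bracket_linr|exact: bracket_linl]. Qed.

(** Near [y], [Ad (g z)] is [Ad (g z * (g y)^-1)] applied after [Ad (g y)], which moves the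
    derivative to the identity. *)
Lemma derive_Ad (E : normedModType R) (U : set E) (g : E -> G) y v eta :
  findim E -> plot A U g -> U y ->
  'D_v (fun z => Ad A (g z) eta) y = bracket (logd g y v) (Ad A (g y) eta).
Proof.
move=> fE pg Uy; pose h z := (g z * (g y)^-1)%g.
have ph : plot A U h by apply: plot_mul => //; apply: plot_const; exact: plot_open pg.
have hy : h y = 1%g by rewrite /h mulgV.
have := velocity_smooth_map v (smooth_map_Ad (Ad A (g y) eta)) ph Uy.
rewrite hy (velocity_at1 _ hy) logd_mulr /bracket => <-.
rewrite velocity_vmanifold; apply: eq_derive => z /=.
by rewrite -AdM /h mulgVK.
Qed.

End lie_theory.

(** * The Maurer-Cartan equation and the Lie algebra identities *)

Section maurer_cartan.
Context {R : realType} {n : nat} {G : groupType} (A : manifold 'rV[R]_n G).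
Context (hG : lie_group A).
Local Notation g_ := 'rV[R]_n.
Local Notation e0 := (chart A 1%g 1%g).
Local Notation logd := (logd A).
Local Notation bracket := (bracket A).

Section plot.
Context (E : normedModType R) {fE : findim E} (U : set E) (g : E -> G).
Context (pg : plot A U g).

Let oU : open U := plot_open pg.

Section at_point.
Context (y0 : E) (Uy0 : U y0).

Let h z := (g z * (g y0)^-1)%g.

Let hy0 : h y0 = 1%g.
Proof. by rewrite /h mulgV. Qed.

Let ph : plot A U h.
Proof. by apply: (plot_mul hG) => //; exact: plot_const. Qed.

(** Both sides of the Maurer-Cartan equation are second partial derivatives at [x0] of this one map
    read in a chart: along [diag], the first partial derivative is [logd g], and the second is
    [Ad (h y)] of a fixed vector. What remains is the symmetry of second derivatives and two
    relations between them. *)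
Let P (x : E * E * E) := (h x.1.1 * h x.1.2 * (h x.2)^-1)%g.

Let pP : plot A (U `*` U `*` U) P.
Proof.
have oUU : open (U `*` U) by exact: openX_set.
apply: (plot_mul hG); first apply: (plot_mul hG).
- apply: (plot_fst (g := fun x : E * E => h x.1)) => //; exact: plot_fst.
- apply: (plot_fst (g := fun x : E * E => h x.2)) => //; exact: plot_snd.
- apply: (plot_invg hG); exact: (plot_snd (g := h)).
Qed.

Let D := (U `*` U `*` U) `&` P @^-1` chart_dom A 1%g.
Let f := chart A 1%g \o P.

Let oD : open D. Proof. by have [] := plot_chart 1%g pP. Qed.
Let sD : smooth_on D f. Proof. by have [] := plot_chart 1%g pP. Qed.

Let x0 : E * E * E := (y0, y0, y0).

Let Dx0 : D x0.
Proof. by split=> //; rewrite /P /= hy0 mulg1 mulgV; exact: chart_domP. Qed.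

Let diag (y : E) : E * E * E := (y, y0, y).

Let f1E (y : E) v : 'D_(v, 0, 0) f (diag y) = logd g y v.
Proof.
rewrite /diag (derive_fstv f) (derive_fstv (fun z => f (z, y))).
apply: eq_derive => z; rewrite /f /= /P /= hy0 mulg1 /h.
by rewrite mulgKA.
Qed.

Let f2E (y : E) v : U y -> 'D_(0, v, 0) f (diag y) = Ad A (h y) (logd g y0 v).
Proof.
move=> Uy; rewrite /diag (derive_fstv f) (derive_sndv (fun z => f (z, y))).
by rewrite -(logd_mulr A g (g y0)^-1%g) -/h -(Ad_velocity hG (h y) v ph).
Qed.

Let S a b := 'D_a ('D_b f) x0.

Let dDf b x : D x -> differentiable ('D_b f) x.
Proof. by move=> Dx; exact: smooth_on_differentiable (smooth_on_D b sD) Dx. Qed.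

Let SC a b : S a b = S b a.
Proof. by apply: (schwarz (A := D)) => //; exact: (smooth_onP _ _).1. Qed.

Let SD a b c : S (a + b) c = S a c + S b c.
Proof. by rewrite /S deriveDv //; exact: dDf. Qed.

Let diag_derive y v : differentiable diag y /\ 'D_v diag y = (v, 0, v).
Proof.
have did : differentiable (id : E -> E) y.
  by apply: (@linear_differentiable _ _ _ (idfun : {linear E -> E})) => z; exact: cvg_id.
have dc : differentiable (cst y0 : E -> E) y by exact: differentiable_cst.
have d1 : differentiable (fun y => (y, y0) : E * E) y by exact: (differentiable_pair did dc).
have d2 : differentiable diag y by exact: (differentiable_pair d1 did).
split=> //; rewrite deriveE // (diff_pair d1 did) /= (diff_pair did dc) /=.
by rewrite -!deriveE // derive_id derive_cst.
Qed.

Let S_diag u b : 'D_u ('D_b f \o diag) y0 = S (u, 0, u) b.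
Proof.
have [dd Dd] := diag_derive y0 u.
have db : differentiable ('D_b f) (diag y0) := dDf b Dx0.
exact: (eq_trans (derive_comp u dd db) (congr1 (fun w => 'D_w ('D_b f) x0) Dd)).
Qed.

Let S_logd u v : 'D_u (fun y => logd g y v) y0 = S (u, 0, u) (v, 0, 0).
Proof.
have e := S_diag u (v, 0, 0).
by apply: (eq_trans _ e); apply: eq_derive => y; exact: esym (f1E y v).
Qed.

Let S_bracket u v : bracket (logd g y0 u) (logd g y0 v) = S (u, 0, u) (0, v, 0).
Proof.
have e := S_diag u (0, v, 0).
have := derive_Ad hG u (logd g y0 v) fE ph Uy0.
rewrite hy0 (Ad1 hG) logd_mulr => e'; apply: (eq_trans (esym e')); apply: (eq_trans _ e).
apply: near_eq_derive; apply: filterS (near_open oU Uy0) => y Uy.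
exact: esym (f2E v Uy).
Qed.

(** With one of the first two variables at [y0], where [h] is 1, the map is [h z * (h y)^-1]
    whichever of the two is left. *)
Let S13 u v : S (0, 0, u) (v, 0, 0) = S (0, 0, u) (0, v, 0).
Proof.
rewrite /S /x0 !derive_sndv; apply: eq_derive => y.
rewrite !(derive_fstv f) (derive_fstv (fun z => f (z, y))) (derive_sndv (fun z => f (z, y))).
by apply: eq_derive => z; rewrite /f /= /P /= hy0 mulg1 mul1g.
Qed.

(** On [x2 = x3] the last two factors cancel and the map depends on the first variable alone. *)
Let S23 u v : S (0, v, v) (u, 0, 0) = 0.
Proof.
pose k (y : E) : E * E * E := (y0, y, y).
have did : differentiable (id : E -> E) y0.
  by apply: (@linear_differentiable _ _ _ (idfun : {linear E -> E})) => z; exact: cvg_id.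
have dc : differentiable (cst y0 : E -> E) y0 by exact: differentiable_cst.
have d1 : differentiable (fun y => (y0, y) : E * E) y0 by exact: (differentiable_pair dc did).
have d2 : differentiable k y0 by exact: (differentiable_pair d1 did).
have Dk : 'D_v k y0 = (0, v, v).
  rewrite deriveE // (diff_pair d1 did) /= (diff_pair dc did) /=.
  by rewrite -!deriveE // derive_id derive_cst.
have db : differentiable ('D_(u, 0, 0) f) (k y0) := dDf (u, 0, 0) Dx0.
have e : 'D_v ('D_(u, 0, 0) f \o k) y0 = S (0, v, v) (u, 0, 0).
  exact: (eq_trans (derive_comp v d2 db) (congr1 (fun w => 'D_w ('D_(u, 0, 0) f) x0) Dk)).
apply: (eq_trans (esym e)).
apply: (eq_trans _ (derive_cst ('D_u (fun w => chart A 1%g (h w)) y0) y0 v)).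
apply: eq_derive => y /=; rewrite /k (derive_fstv f) (derive_fstv (fun z => f (z, y))).
by apply: eq_derive => w; rewrite /f /= /P /= mulgK.
Qed.

Lemma maurer_cartan_at u v :
  'D_u (fun y => logd g y v) y0 - 'D_v (fun y => logd g y u) y0 =
  bracket (logd g y0 u) (logd g y0 v).
Proof.
have split13 (a b : E) : (a, 0 : E, b) = (a, 0, 0) + (0, 0, b) :> E * E * E.
  by apply/pair_eqP; rewrite /pair_eq /= !add0r addr0 !eqxx.
have split23 (a b : E) : (0 : E, a, b) = (0, a, 0) + (0, 0, b) :> E * E * E.
  by apply/pair_eqP; rewrite /pair_eq /= !add0r addr0 !eqxx.
(* The terms in [(u, 0, 0)] and [(v, 0, 0)] cancel by symmetry, and [T23] turns
   [- T (0, 0, v) (u, 0, 0)] into [T (0, v, 0) (u, 0, 0)]. An abstract [T] keeps the derivatives out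
   of the rewriting. *)
have key (T : E * E * E -> E * E * E -> g_) : (forall a b, T a b = T b a) ->
    (forall a b c, T (a + b) c = T a c + T b c) -> T (0, v, v) (u, 0, 0) = 0 ->
    T (0, 0, u) (v, 0, 0) = T (0, 0, u) (0, v, 0) ->
    T (u, 0, u) (v, 0, 0) - T (v, 0, v) (u, 0, 0) = T (u, 0, u) (0, v, 0).
  move=> TC TD; rewrite split23 TD => T23 T13.
  rewrite (split13 u u) (split13 v v) !TD T13 [T (v, 0, 0) (u, 0, 0)]TC [T (u, 0, 0) (0, v, 0)]TC.
  have -> : T (0, v, 0) (u, 0, 0) = - T (0, 0, v) (u, 0, 0).
    by apply/eqP; rewrite -addr_eq0; apply/eqP.
  by rewrite opprD addrACA subrr add0r addrC.
apply: (eq_trans (congr2 (fun a b => a - b) (S_logd u v) (S_logd v u))).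
exact: (eq_trans (key S SC SD (S23 u v) (S13 u v)) (esym (S_bracket u v))).
Qed.

(** [logd g] is the first partial derivative of the three-variable map along the smooth curve
    [diag]. *)
Lemma logd_smooth_at v : exists W, [/\ open W, W y0 & smooth_on W (fun y => logd g y v)].
Proof.
have sdiag : smooth_on setT diag.
  apply: smooth_on_pair; [exact: openT| |exact: smooth_on_id].
  by apply: smooth_on_pair; [exact: openT|exact: smooth_on_id|exact: smooth_on_cst].
have oW : open (setT `&` diag @^-1` D).
  apply: continuous_open_at => //; first exact: openT.
  by move=> x _; exact: smooth_cont sdiag _.
exists (setT `&` diag @^-1` D); split=> //.
apply: (@smooth_on_ext _ _ _ _ ('D_(v, 0, 0) f \o diag)); [exact: oW|by move=> y _ /=; rewrite f1E|].
apply: (@smooth_on_comp _ _ _ _ _ D) => //; first by move=> y [].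
  by apply: smooth_on_sub sdiag.
exact: smooth_on_D.
Qed.

End at_point.

Lemma logd_smooth v : smooth_on U (fun y => logd g y v).
Proof.
apply: smooth_on_locally => y Uy.
by have [W [oW Wy sW]] := logd_smooth_at Uy v; exists W.
Qed.

Lemma maurer_cartan y u v : U y ->
  'D_u (fun z => logd g z v) y - 'D_v (fun z => logd g z u) y =
  bracket (logd g y u) (logd g y v).
Proof. by move=> Uy; exact: maurer_cartan_at. Qed.

End plot.

Lemma logd_chart_inv1 v : logd (chart_inv A 1%g) e0 v = v.
Proof.
rewrite -[RHS](velocity_chart_inv A 1%g v) velocity_at1 // chartK //.
exact: chart_domP.
Qed.

(** The left side of the Maurer-Cartan equation is antisymmetric, and for the plot [chart_inv A 1]
    the map [logd] is the identity at the base point. *)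
Lemma bracketC u v : bracket u v = - bracket v u.
Proof.
have px := @chart_image_self _ _ _ A 1%g.
have mc a b := maurer_cartan (fE := findim_mx 1 n) (@plot_chart_inv _ _ _ A 1%g) a b px.
by have := mc u v; have := mc v u; rewrite !logd_chart_inv1 => <- <-; rewrite opprB.
Qed.

(** Differentiate [Ad g (Ad x eta) = Ad (g * x * g^-1) (Ad g eta)] in [x] at the identity. *)
Lemma Ad_bracket g xi eta : Ad A g (bracket xi eta) = bracket (Ad A g xi) (Ad A g eta).
Proof.
have pi1 := @plot_chart_inv _ _ _ A 1%g.
have px := @chart_image_self _ _ _ A 1%g.
have i1 : chart_inv A 1%g e0 = 1%g by rewrite chartK //; exact: chart_domP.
pose c x := (g * chart_inv A 1%g x * g^-1)%g.
have pc : plot A (chart_image A 1%g) c.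
  apply: (plot_mul hG); [apply: (plot_mul hG) => //|];
    by apply: plot_const; exact: chart_image_open.
have c1 : c e0 = 1%g by rewrite /c i1 mulg1 mulgV.
have := derive_Ad hG xi (Ad A g eta) (findim_mx 1 n) pc px.
have lc : logd c e0 xi = Ad A g xi.
  by rewrite -velocity_at1 // /velocity c1 AdE.
rewrite lc c1 (Ad1 hG) => e; apply: (eq_trans _ e).
have [L eL] := lin_pack (@Ad_linear _ _ _ A g).
have cL : continuous L by exact: findim_lin_cont.
have e2 := derive_lin_comp xi cL (Ad_chart_inv_diff hG eta).
rewrite -(bracketE hG) -eL in e2; apply: (eq_trans (esym e2)).
by apply: eq_derive => x; rewrite -(AdM hG) -(AdM hG) /c mulgVK.
Qed.

(** Differentiate [Ad_bracket] in the group variable at the identity; the right side obeys the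
    Leibniz rule. *)
Lemma jacobi a xi eta :
  bracket a (bracket xi eta) = bracket (bracket a xi) eta + bracket xi (bracket a eta).
Proof.
rewrite bracketE //.
have d w := Ad_chart_inv_diff hG w.
have [_ e] := derive_bilin a (bracket_bilin hG) (d xi) (d eta).
have i1 : chart_inv A 1%g e0 = 1%g by rewrite chartK //; exact: chart_domP.
rewrite -(bracketE hG a eta) -(bracketE hG a xi) i1 !(Ad1 hG) addrC in e.
by apply: (eq_trans _ e); apply: eq_derive => x; rewrite Ad_bracket.
Qed.

End maurer_cartan.

(** * One-parameter subgroups *)

Section real_estimates.
Context {R : realType}.
Implicit Types a b c t : R.

(** Induction step of [lg_pow]: the squared error absorbs one more factor as long as the norm [x] of
    the power is at most twice [J * a]. *)
Lemma sqr_step_bound (C J a x : R) : 0 <= C -> 0 <= J -> 0 <= a -> x <= 2 * (J * a) ->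
  C * x * a + C * (J * a) ^+ 2 <= C * ((J + 1) * a) ^+ 2.
Proof.
move=> C0 J0 a0 xb; have h : C * x * a <= C * (2 * (J * a)) * a.
  by apply: ler_wpM2r => //; apply: ler_wpM2l.
apply: le_trans (lerD h (lexx _)) _.
rewrite -subr_ge0 (_ : _ - _ = C * a ^+ 2); last by ring.
by rewrite mulr_ge0 // sqr_ge0.
Qed.

Lemma sqr_bound_lin (C t d : R) : 0 <= C -> 0 <= t -> t <= d -> C * d <= 1 ->
  t + C * t ^+ 2 <= 2 * t.
Proof.
move=> C0 t0 td Cd; rewrite mulr2n mulrDl mul1r lerD2l expr2 mulrA -[leRHS]mul1r.
by apply: ler_wpM2r => //; apply: le_trans Cd; exact: ler_wpM2l.
Qed.

(** Induction step of [lg_pow_diff]; the quadratic term in [J] absorbs the loss [C * d * a] of each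
    multiplication. *)
Lemma diff_step_bound (C a J D d : R) : 0 <= C -> 0 <= a -> 0 <= J -> 0 <= D ->
  C * (J * a) <= 1 -> d <= C * D * (J + C * a * J ^+ 2) ->
  d + C * d * a + C * D <= C * D * ((J + 1) + C * a * (J + 1) ^+ 2).
Proof.
move=> C0 a0 J0 D0 h hd.
have h1 : d * (1 + C * a) <= C * D * (J + C * a * J ^+ 2) * (1 + C * a).
  by apply: ler_wpM2r => //; rewrite addr_ge0 // mulr_ge0.
rewrite (_ : d + _ = d * (1 + C * a)); last by ring.
apply: le_trans (lerD h1 (lexx _)) _.
rewrite -subr_ge0 (_ : _ - _ = C * D * (C * a) * ((1 - C * (J * a)) * J + 1)); last by ring.
by rewrite mulr_ge0 ?addr_ge0 ?mulr_ge0 // subr_ge0.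
Qed.

Lemma telescoped_norm_bound (V : normedZmodType R) (p q p' q' a : V) (w1 w2 w3 w4 : R) :
  `|p - p' - a| <= w3 -> `|p' - q'| <= w4 -> w3 <= `|a| -> w4 <= w1 -> `|a| <= w2 ->
  `|q - q'| <= 2 * w2 -> 0 <= w1 -> 0 <= w2 -> `|p - q| <= 5 * w1 + 5 * w2.
Proof.
move=> h1 h2 h3 h4 h5 h6 z1 z2.
have -> : p - q = (p - p' - a) + a + (p' - q') - (q - q').
  by rewrite subrK opprB (addrA (p - p')) subrK addrA subrK.
apply: le_trans (ler_normB _ _) _; apply: le_trans (lerD (ler_normD _ _) (lexx _)) _.
apply: le_trans (lerD (lerD (ler_normD _ _) (lexx _)) (lexx _)) _.
lra.
Qed.

Lemma div_small (K e : R) : 0 <= K -> 0 < e ->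
  exists N : nat, forall i, (N <= i)%N -> K / i.+1%:R <= e.
Proof.
move=> K0 e0; have Ke : 0 <= K / e by rewrite divr_ge0 // ltW.
exists (Num.truncn (K / e)) => i hi; have /andP[_ hN] := truncn_itv Ke.
rewrite ler_pdivrMr ?ltr0n // mulrC -ler_pdivrMr //.
by apply: le_trans (ltW hN) _; rewrite ler_nat ltnS.
Qed.

(** The explicit rate survives in the limit: let [j] tend to infinity. *)
Lemma rV_cauchy n (u : nat -> 'rV[R]_n) (K : R) : 0 <= K ->
  (forall i j, `|u i - u j| <= K / i.+1%:R + K / j.+1%:R) ->
  exists l, forall i, `|l - u i| <= K / i.+1%:R.
Proof.
move=> K0 hu.
have cu : cvg (u @ \oo).
  apply: (@cauchy_cvg (rV_complete (R := R) n)); apply: cauchy_exP => e e0.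
  have e4 : 0 < e / 4 by rewrite divr_gt0.
  have [N hN] := div_small K0 e4; exists (u N); exists N => // i /= Ni.
  rewrite -ball_normE /=; apply: le_lt_trans (hu N i) _.
  apply: le_lt_trans (lerD (hN N (leqnn N)) (hN i Ni)) _.
  by rewrite -mulr2n -mulr_natl; move: e0; lra.
exists (lim (u @ \oo)) => i; apply/ler_addgt0Pr => e e0.
have e2 : 0 < e / 2 by rewrite divr_gt0.
have [N hN] := div_small K0 e2.
have n1 : \forall j \near \oo, `|lim (u @ \oo) - u j| <= e / 2.
  by have /cvgrPdist_le h := cu; exact: h.
have n2 : \forall j \near \oo, K / j.+1%:R <= e / 2 by exists N => // j /= /hN.
have [j [j1 j2]] := filter_ex (filterI n1 n2).
have -> : lim (u @ \oo) - u i = (lim (u @ \oo) - u j) + (u j - u i) by rewrite subrKA.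
apply: le_trans (ler_normD _ _) _; apply: le_trans (lerD j1 (hu j i)) _; move: j2 => /=.
by move: (K / j.+1%:R) (K / i.+1%:R) => a b; lra.
Qed.

Lemma le_all_inv (x K : R) : (forall N : nat, x <= K / N.+1%:R) -> x <= 0.
Proof.
move=> h; apply/ler_addgt0Pl => e e0; rewrite addr0.
have [K0|K0] := leP K 0.
  apply: le_trans (h 0%N) _; rewrite divr1; exact: le_trans K0 (ltW e0).
have Ke : 0 <= K / e by rewrite ltW // divr_gt0.
pose N := Num.truncn (K / e).
have /andP[_ hN] := truncn_itv Ke.
apply: le_trans (h N) _; rewrite ler_pdivrMr ?ltr0n // mulrC -ler_pdivrMr //.
exact: ltW.
Qed.

End real_estimates.

Section one_parameter_subgroups.
Context {R : realType} {n : nat} {G : groupType}.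
Local Notation g_ := 'rV[R]_n.
(** [lg] and [gam] stand for a chart centred at the identity and its inverse. [lg_mull] says that
    right multiplication by [h] preserves differences up to a relative error [C * |lg h|], [lg_mulr]
    that left multiplication is Lipschitz; powers are then controlled by inequalities alone. *)
Context (lg : G -> g_) (gam : g_ -> G) (D : set G) (eps C delta : R).
Let N g := D g /\ `|lg g| < eps.
Context (C1 : 1 <= C) (D1 : D 1%g) (lg1 : lg 1%g = 0).
Context (gamK : forall g, D g -> gam (lg g) = g).
Context (lgK : forall x, `|x| < eps -> D (gam x) /\ lg (gam x) = x).
Context (DM : forall g h, N g -> N h -> D (g * h)%g).
Context (lg_mull : forall g g' h, N g -> N g' -> N h ->
  `|lg (g * h)%g - lg (g' * h)%g - (lg g - lg g')| <= C * `|lg g - lg g'| * `|lg h|).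
Context (lg_mulr : forall g h h', N g -> N h -> N h' ->
  `|lg (g * h)%g - lg (g * h')%g| <= C * `|lg h - lg h'|).
(** [4 * delta <= eps] keeps elements of norm at most [2 * delta] in [N]. The factor 16 leaves room
    for the largest second order constant met below, [8 * C + 4 * C ^+ 2] in [Ex_neg]. *)
Context (delta0 : 0 < delta) (delta_eps : 4 * delta <= eps) (delta_C : 16 * C ^+ 2 * delta <= 1).
Context (NV : forall g, N g -> `|lg g| <= 2 * delta -> N (g^-1)%g).

Let C0 : 0 <= C. Proof. exact: le_trans C1. Qed.
Let CC : C <= C ^+ 2. Proof. by rewrite expr2 ler_peMl. Qed.
Let dC : C * delta <= 8^-1.
Proof.
have h : C * delta <= C ^+ 2 * delta by rewrite ler_pM2r.
by move: delta_C h; set a := C * delta; rewrite -mulrA; set b := C ^+ 2 * delta; lra.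
Qed.
Let dC1 : C * delta <= 1. Proof. by move: dC; lra. Qed.
Let eps0 : 0 < eps. Proof. by move: delta_eps delta0; lra. Qed.
Let N1 : N 1%g. Proof. by split=> //; rewrite lg1 normr0. Qed.

Let NE g : D g -> `|lg g| <= 2 * delta -> N g.
Proof. by move=> Dg h; split=> //; move: delta_eps delta0 h; lra. Qed.

Lemma lg_mul g h : N g -> N h -> `|lg (g * h)%g - lg g - lg h| <= C * `|lg g| * `|lg h|.
Proof.
move=> Ng Nh; have := lg_mull Ng N1 Nh; rewrite mul1g lg1 !subr0.
by rewrite -!addrA [- lg h + _]addrC.
Qed.

(** The error of one more multiplication is at most [C] times twice [j * |lg g|] times [|lg g|],
    which sums to a square. The last bound keeps the power in [N] for the next step. *)
Lemma lg_pow g (j : nat) : N g -> j%:R * `|lg g| <= delta ->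
  [/\ D (g ^+ j)%g, `|lg (g ^+ j)%g - j%:R *: lg g| <= C * (j%:R * `|lg g|) ^+ 2 &
      `|lg (g ^+ j)%g| <= 2 * (j%:R * `|lg g|)].
Proof.
move=> Ng; elim: j => [|j IH] hj.
  by rewrite expg0 lg1 scale0r subrr mul0r normr0 expr2 !mulr0.
have a0 : 0 <= `|lg g| by exact: normr_ge0.
have J0 : 0 <= j%:R :> R by [].
have jS : j.+1%:R = j%:R + 1 :> R by rewrite -natr1.
have hj' : j%:R * `|lg g| <= delta.
  by apply: le_trans hj; rewrite jS ler_wpM2r // lerDl.
have [Dj e1 e2] := IH hj'.
have Nj : N (g ^+ j)%g.
  by apply: NE => //; apply: le_trans e2 _; rewrite ler_wpM2l.
have e3 : `|lg (g ^+ j.+1)%g - j.+1%:R *: lg g| <= C * (j.+1%:R * `|lg g|) ^+ 2.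
  rewrite expgSr jS scalerDl scale1r.
  have -> : lg (g ^+ j * g)%g - (j%:R *: lg g + lg g) =
      (lg (g ^+ j * g)%g - lg (g ^+ j)%g - lg g) + (lg (g ^+ j)%g - j%:R *: lg g).
    by apply/rowP => i; rewrite !mxE; ring.
  apply: le_trans (ler_normD _ _) _.
  apply: le_trans (lerD (lg_mul Nj Ng) e1) _.
  exact: sqr_step_bound.
split=> //; first by rewrite expgSr; exact: DM.
rewrite -[lg (g ^+ j.+1)%g](subrK (j.+1%:R *: lg g)) addrC.
apply: le_trans (ler_normD _ _) _; rewrite normrZ ger0_norm //.
apply: le_trans (lerD (lexx _) e3) _; by apply: (sqr_bound_lin _ _ hj) => //; rewrite mulr_ge0.
Qed.

Lemma N_pow g (j : nat) : N g -> j%:R * `|lg g| <= delta -> N (g ^+ j)%g.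
Proof.
move=> Ng hj; have [Dj _ e2] := lg_pow Ng hj.
by apply: NE => //; apply: le_trans e2 _; rewrite ler_wpM2l.
Qed.

Lemma lg_pow_diff g h (j : nat) : N g -> N h -> j%:R * `|lg g| <= delta ->
  j%:R * `|lg h| <= delta ->
  `|lg (g ^+ j)%g - lg (h ^+ j)%g| <= 2 * C * (j%:R * `|lg g - lg h|).
Proof.
move=> Ng Nh hg hh.
(* The bound with a quadratic term in [j] is the one stable under induction; since [C * j * |lg g|]
   is at most 1, it is then absorbed in the factor 2. *)
suff key : `|lg (g ^+ j)%g - lg (h ^+ j)%g| <=
    C * `|lg g - lg h| * (j%:R + C * `|lg g| * j%:R ^+ 2).
  apply: le_trans key _; rewrite -subr_ge0.
  rewrite (_ : _ - _ = C * `|lg g - lg h| * j%:R * (1 - C * (j%:R * `|lg g|))); last by ring.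
  rewrite mulr_ge0 ?mulr_ge0 // subr_ge0; apply: le_trans dC1; exact: ler_wpM2l.
elim: j hg hh => [|j IH] hg hh.
  by rewrite !expg0 subrr normr0 expr2 !mulr0 addr0 mulr0.
have jS : j.+1%:R = j%:R + 1 :> R by rewrite -natr1.
have hg' : j%:R * `|lg g| <= delta.
  by apply: le_trans hg; rewrite jS ler_wpM2r // lerDl.
have hh' : j%:R * `|lg h| <= delta.
  by apply: le_trans hh; rewrite jS ler_wpM2r // lerDl.
have Nj := N_pow Ng hg'; have Nj' := N_pow Nh hh'.
have := IH hg' hh'; set d := `|_ - _|; set DD := `|lg g - lg h| => hd.
have e1 := lg_mull Nj Nj' Ng; have e2 := lg_mulr Nj' Ng Nh.
rewrite !expgSr jS; apply: (@le_trans _ _ (d + C * d * `|lg g| + C * DD)); last first.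
  apply: diff_step_bound => //; try exact: normr_ge0.
  by apply: le_trans dC1; exact: ler_wpM2l.
have -> : lg (g ^+ j * g)%g - lg (h ^+ j * h)%g =
    (lg (g ^+ j)%g - lg (h ^+ j)%g) +
    (lg (g ^+ j * g)%g - lg (h ^+ j * g)%g - (lg (g ^+ j)%g - lg (h ^+ j)%g)) +
    (lg (h ^+ j * g)%g - lg (h ^+ j * h)%g).
  by apply/rowP => i; rewrite !mxE; ring.
apply: le_trans (ler_normD _ _) _; apply: lerD e2.
by apply: le_trans (ler_normD _ _) _; exact: lerD.
Qed.

Let k1_gt0 (k : nat) : 0 < k.+1%:R :> R. Proof. by rewrite ltr0n. Qed.

(* Two curves tangent to second order have the same limit of [f (x / k) ^+ k]. *)
Lemma root_diff (f h : g_ -> G) (K : R) (x : g_) (k : nat) : 0 <= K ->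
  let y := k.+1%:R^-1 *: x in
  N (f y) -> N (h y) ->
  `|lg (f y) - y| <= K * `|y| ^+ 2 -> `|lg (h y) - y| <= K * `|y| ^+ 2 ->
  2 * `|x| <= delta -> K * delta <= 1 ->
  `|lg (f y ^+ k.+1)%g - lg (h y ^+ k.+1)%g| <= (4 * C * K * `|x| ^+ 2) / k.+1%:R.
Proof.
move=> K0 y Nf Nh ef eh hx Kd.
have ny : k.+1%:R * `|y| = `|x|.
  by rewrite normrZ normfV ger0_norm // mulrA mulfV ?mul1r // gt_eqF.
have bnd (z : g_) : `|z - y| <= K * `|y| ^+ 2 -> k.+1%:R * `|z| <= delta.
  move=> hz; have y1 : `|y| <= `|x| by rewrite -ny ler_peMl // ler1n.
  have zy : `|z| <= `|y| + K * `|y| ^+ 2.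
    rewrite -[z](subrK y) addrC; apply: le_trans (ler_normD _ _) _.
    by rewrite lerD2l.
  have zy2 : `|z| <= 2 * `|y|.
    apply: le_trans zy _; apply: (@sqr_bound_lin _ _ _ delta) => //.
    apply: le_trans y1 _; apply: le_trans hx.
    by rewrite ler_peMl // ler1n.
  apply: le_trans hx; rewrite -ny mulrCA; exact: ler_wpM2l.
apply: le_trans (lg_pow_diff Nf Nh (bnd _ ef) (bnd _ eh)) _.
have e1 : `|lg (f y) - lg (h y)| <= 2 * (K * `|y| ^+ 2).
  have -> : lg (f y) - lg (h y) = (lg (f y) - y) - (lg (h y) - y).
    by apply/rowP => i; rewrite !mxE; ring.
  by apply: le_trans (ler_normB _ _) _; lra.
apply: (@le_trans _ _ (2 * C * (k.+1%:R * (2 * (K * `|y| ^+ 2))))).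
  by rewrite ler_wpM2l ?mulr_ge0 // ler_wpM2l.
rewrite le_eqVlt; apply/orP; left; apply/eqP; rewrite -ny; field.
by rewrite gt_eqF.
Qed.

Let lg_near0 (x : g_) : 2 * `|x| <= delta -> N (gam x) /\ lg (gam x) = x.
Proof.
move=> hx; have xe : `|x| < eps.
  by have := normr_ge0 x; move: delta_eps delta0 hx; lra.
by have [Dx lx] := lgK xe; split=> //; split=> //; rewrite lx.
Qed.

Let scale_norm (k : nat) (x : g_) : k.+1%:R * `|k.+1%:R^-1 *: x| = `|x|.
Proof. by rewrite normrZ normfV ger0_norm // mulrA mulfV ?mul1r // gt_eqF. Qed.

Let scale_norm_le (k : nat) (x : g_) : `|k.+1%:R^-1 *: x| <= `|x|.
Proof. by rewrite -(scale_norm k x) ler_peMl // ler1n. Qed.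

Let C4 : 4 * C ^+ 2 * delta <= 1.
Proof.
have : 0 <= C ^+ 2 * delta by rewrite mulr_ge0 ?sqr_ge0 // ltW.
by move: delta_C; rewrite -!mulrA; lra.
Qed.

(** Approximations of the exponential in the chart; index [k] stands for the exponent [k + 1], which
    avoids division by zero. *)
Let u (k : nat) (x : g_) : g_ := lg (gam (k.+1%:R^-1 *: x) ^+ k.+1)%g.

Let scaled k (x : g_) : 2 * `|x| <= delta -> N (gam (k.+1%:R^-1 *: x)) /\
  lg (gam (k.+1%:R^-1 *: x)) = k.+1%:R^-1 *: x.
Proof.
move=> hx; apply: lg_near0; apply: le_trans hx.
by rewrite ler_pM2l.
Qed.

Let pow_scaled k (x : g_) : 2 * `|x| <= delta -> let g := gam (k.+1%:R^-1 *: x) in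
  [/\ N (g ^+ k.+1)%g, `|u k x - x| <= C * `|x| ^+ 2 & `|u k x| <= 2 * `|x|].
Proof.
move=> hx g; have [Ng eg] := scaled k hx.
have x0 := normr_ge0 x.
have hg : k.+1%:R * `|lg g| <= delta by rewrite eg scale_norm; lra.
have [Dg e1 e2] := lg_pow Ng hg.
rewrite eg scale_norm scalerA mulfV ?gt_eqF // scale1r in e1.
rewrite eg scale_norm in e2.
by split=> //; exact: N_pow.
Qed.

Let invf_prod (i j : nat) (x : g_) :
  i.+1%:R^-1 *: (j.+1%:R^-1 *: x) = (j.+1 * i.+1)%:R^-1 *: x.
Proof. by rewrite scalerA -invfM -natrM mulnC. Qed.

(** The map [y |-> gam (y / (j + 1)) ^ (j + 1)] is tangent to [gam] to second order, so [root_diff]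
    compares their powers of exponent [i + 1]. Two indices are later compared through the product of
    their exponents. *)
Let u_mul i j (x : g_) : 2 * `|x| <= delta ->
  `|lg (gam ((i.+1 * j.+1)%:R^-1 *: x) ^+ (i.+1 * j.+1))%g - u i x| <=
  4 * C ^+ 2 * `|x| ^+ 2 / i.+1%:R.
Proof.
move=> hx; pose f y := (gam (j.+1%:R^-1 *: y) ^+ j.+1)%g.
have hy : 2 * `|i.+1%:R^-1 *: x| <= delta.
  by apply: le_trans hx; rewrite ler_pM2l.
have [Nf ef _] := pow_scaled j hy.
have [Nh eh] := scaled i hx.
have -> : (gam ((i.+1 * j.+1)%:R^-1 *: x) ^+ (i.+1 * j.+1))%g = (f (i.+1%:R^-1 *: x) ^+ i.+1)%g.
  by rewrite /f invf_prod -expgnA mulnC.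
rewrite (_ : 4 * C ^+ 2 * `|x| ^+ 2 = 4 * C * C * `|x| ^+ 2); last by ring.
apply: (@root_diff f gam C x i) => //.
by rewrite eh subrr normr0 mulr_ge0 // sqr_ge0.
Qed.

Let K0 (x : g_) : 0 <= 4 * C ^+ 2 * `|x| ^+ 2.
Proof. by rewrite !mulr_ge0 // sqr_ge0. Qed.

Let L (x : g_) : g_ := xget 0 [set l | forall i, `|l - u i x| <= 4 * C ^+ 2 * `|x| ^+ 2 / i.+1%:R].

Let LP (x : g_) i : 2 * `|x| <= delta -> `|L x - u i x| <= 4 * C ^+ 2 * `|x| ^+ 2 / i.+1%:R.
Proof.
move=> hx; have [l hl] : exists l, forall i, `|l - u i x| <= 4 * C ^+ 2 * `|x| ^+ 2 / i.+1%:R.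
  apply: rV_cauchy => // a b.
  have h1 := u_mul a b hx; have h2 := u_mul b a hx; rewrite mulnC in h2.
  set w := lg _ in h1 h2.
  have -> : u a x - u b x = (w - u b x) - (w - u a x).
    by apply/rowP => k; rewrite !mxE; ring.
  by apply: le_trans (ler_normB _ _) _; rewrite addrC; exact: lerD.
have hex : exists l, [set l | forall i, `|l - u i x| <= 4 * C ^+ 2 * `|x| ^+ 2 / i.+1%:R] l.
  by exists l.
exact: (xgetPex 0 hex).
Qed.

Let u0 (x : g_) : 2 * `|x| <= delta -> u 0 x = x.
Proof. by move=> hx; rewrite /u expg1; have [_ ->] := scaled 0 hx; rewrite invr1 scale1r. Qed.

Let L_germ (x : g_) : 2 * `|x| <= delta -> `|L x - x| <= 4 * C ^+ 2 * `|x| ^+ 2.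
Proof. by move=> hx; have := LP 0 hx; rewrite u0 // divr1. Qed.

Let L_bound (x : g_) : 2 * `|x| <= delta -> `|L x| <= 2 * `|x|.
Proof.
move=> hx; rewrite -[L x](subrK x) addrC; apply: le_trans (ler_normD _ _) _.
apply: le_trans (lerD (lexx _) (L_germ hx)) _.
apply: (@sqr_bound_lin _ _ _ delta) => //; first by rewrite mulr_ge0 // sqr_ge0.
by have := normr_ge0 x; lra.
Qed.

Let Ex (x : g_) := gam (L x).

Let ExP (x : g_) : 2 * `|x| <= delta -> N (Ex x) /\ lg (Ex x) = L x.
Proof.
move=> hx; have xe : `|L x| < eps.
  by have := L_bound hx; move: delta_eps delta0 hx; lra.
by have [Dx lx] := lgK xe; split=> //; split=> //; rewrite lx.
Qed.

Let eq_Ex g (x : g_) (K : R) : D g -> 2 * `|x| <= delta ->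
  (forall i : nat, `|lg g - L x| <= K / i.+1%:R) -> g = Ex x.
Proof.
move=> Dg hx h; have /le_all_inv := h; rewrite normr_le0 subr_eq0 => /eqP e.
by rewrite -(gamK Dg) e.
Qed.

(** The power [k + 1] of the approximation of index [i] at [x / (k + 1)] is exactly an approximation
    at [x], of exponent [(k + 1) * (i + 1)]; both sides are within a multiple of [1 / (i + 1)] of
    it. *)
Let Ex_root k (x : g_) : 2 * `|x| <= delta -> (Ex (k.+1%:R^-1 *: x) ^+ k.+1)%g = Ex x.
Proof.
move=> hx; set y := _ *: x.
have hy : 2 * `|y| <= delta.
  by apply: le_trans hx; rewrite ler_pM2l //; exact: scale_norm_le.
have [Ny ey] := ExP hy.
have kL (z : g_) : `|z| <= 2 * `|y| -> k.+1%:R * `|z| <= delta.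
  by move=> hz; apply: le_trans hx; rewrite -(scale_norm k x) mulrCA; apply: ler_wpM2l.
have hE : k.+1%:R * `|lg (Ex y)| <= delta by rewrite ey; apply: kL; exact: L_bound.
have [DE _ _] := lg_pow Ny hE.
apply: (@eq_Ex _ _ (2 * C * (k.+1%:R * (4 * C ^+ 2 * `|y| ^+ 2)) + 4 * C ^+ 2 * `|x| ^+ 2)) => // i.
have [Ni _ bi] := pow_scaled i hy; set h := (_ ^+ _)%g in Ni.
have hh : k.+1%:R * `|lg h| <= delta by exact: kL.
have e1 := lg_pow_diff Ny Ni hE hh.
have e2 : lg (Ex y) - lg h = L y - u i y by rewrite ey.
have e3 := LP i hy; rewrite -e2 in e3.
have hi : (h ^+ k.+1)%g = (gam (((k.+1 * i.+1).-1.+1)%:R^-1 *: x) ^+ (k.+1 * i.+1).-1.+1)%g.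
  by rewrite prednK // /h /y invf_prod -expgnA mulnC.
have e4 := LP (k.+1 * i.+1).-1 hx; rewrite /u -hi prednK // in e4.
have e5 : 4 * C ^+ 2 * `|x| ^+ 2 / (k.+1 * i.+1)%:R <= 4 * C ^+ 2 * `|x| ^+ 2 / i.+1%:R.
  apply: ler_wpM2l => //; rewrite lef_pV2 ?posrE ?ltr0n // ler_nat.
  exact: leq_pmull.
rewrite mulrDl; have -> : lg (Ex y ^+ k.+1)%g - L x =
    (lg (Ex y ^+ k.+1)%g - lg (h ^+ k.+1)%g) - (L x - lg (h ^+ k.+1)%g).
  by apply/rowP => a; rewrite !mxE; ring.
apply: le_trans (ler_normB _ _) _; apply: lerD; last exact: le_trans e4 e5.
apply: le_trans e1 _; rewrite -[leRHS]mulrA -[X in _ <= _ * X]mulrA.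
by apply: ler_wpM2l; [rewrite mulr_ge0|apply: ler_wpM2l].
Qed.

Let L0 : L 0 = 0.
Proof.
have h : 2 * `|0 : g_| <= delta by rewrite normr0 mulr0 ltW.
by apply/eqP; have := L_germ h; rewrite subr0 normr0 expr0n mulr0 normr_le0.
Qed.

Let Ex0 : Ex 0 = 1%g.
Proof. by rewrite /Ex L0 -lg1 gamK. Qed.

Let Ex_pow (j : nat) (y : g_) : 2 * (j%:R * `|y|) <= delta -> (Ex y ^+ j)%g = Ex (j%:R *: y).
Proof.
case: j => [|j] h; first by rewrite expg0 scale0r Ex0.
have h' : 2 * `|j.+1%:R *: y| <= delta by rewrite normrZ ger0_norm.
by rewrite -(Ex_root j h') scalerA mulVf ?scale1r // gt_eqF.
Qed.

Let L_lip (x z : g_) : 2 * `|x| <= delta -> 2 * `|z| <= delta -> `|L x - L z| <= 2 * C * `|x - z|.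
Proof.
move=> hx hz; rewrite -subr_le0.
apply: (@le_all_inv _ _ (4 * C ^+ 2 * `|x| ^+ 2 + 4 * C ^+ 2 * `|z| ^+ 2)) => i.
have [Nx ex] := scaled i hx; have [Nz ez] := scaled i hz.
have e1 : `|u i x - u i z| <= 2 * C * `|x - z|.
  have := @lg_pow_diff _ _ i.+1 Nx Nz; rewrite ex ez -scalerBr !scale_norm; apply.
    by have := normr_ge0 x; lra.
  by have := normr_ge0 z; lra.
have e2 := LP i hx; have e3 := LP i hz.
rewrite lerBlDr mulrDl.
have -> : L x - L z = (L x - u i x) + ((u i x - u i z) - (L z - u i z)).
  by apply/rowP => a; rewrite !mxE; ring.
apply: le_trans (ler_normD _ _) _.
apply: le_trans (lerD (lexx _) (ler_normB _ _)) _.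
apply: le_trans (lerD e2 (lerD e1 e3)) _.
by rewrite addrA addrAC.
Qed.

(** If [s] and [t] are multiples of [1 / M], both sides are powers of [Ex (x / M)]. In general,
    truncating [s] and [t] to such multiples changes each side by a multiple of [1 / M], by [L_lip]
    and the chart estimates, and [M] is arbitrary. *)
Let Ex_add_pos (x : g_) (s t : R) : 0 <= s -> 0 <= t -> 2 * ((s + t) * `|x|) <= delta ->
  (Ex (s *: x) * Ex (t *: x))%g = Ex ((s + t) *: x).
Proof.
move=> s0 t0 hst; have x0 := normr_ge0 x.
have small r : 0 <= r -> r <= s + t -> 2 * `|r *: x| <= delta.
  move=> r0 rst; rewrite normrZ ger0_norm //; apply: le_trans hst.
  by rewrite ler_pM2l // ler_wpM2r.
have hs : 2 * `|s *: x| <= delta by apply: small => //; rewrite lerDl.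
have ht : 2 * `|t *: x| <= delta by apply: small => //; rewrite lerDr.
have hst' : 2 * `|(s + t) *: x| <= delta by apply: small; rewrite ?addr_ge0.
have [Ns es] := ExP hs; have [Nt et] := ExP ht.
apply: (@eq_Ex _ _ ((10 * C ^+ 2 + 10 * C) * `|x|)) => // [|i].
  exact: DM.
pose M : R := i.+1%:R; have M0 : 0 < M by rewrite /M ltr0n.
have approx r : 0 <= r -> exists a : nat, let r' := a%:R / M in
    [/\ 0 <= r', r' <= r & r - r' <= M^-1].
  move=> r0; have rM : 0 <= r * M by rewrite mulr_ge0 // ltW.
  exists (Num.truncn (r * M)) => /=; have /andP[h1 h2] := truncn_itv rM.
  split; [by rewrite divr_ge0 // ltW|by rewrite ler_pdivrMr|].
  rewrite lerBlDr -[X in X + _]mul1r -mulrDl ler_pdivlMr // addrC natr1.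
  exact: ltW.
have [a [a0 a1 a2]] := approx _ s0; have [b [b0 b1 b2]] := approx _ t0.
set s' := a%:R / M in a0 a1 a2; set t' := b%:R / M in b0 b1 b2.
have hs' : 2 * `|s' *: x| <= delta.
  by apply: small => //; apply: le_trans a1 _; rewrite lerDl.
have ht' : 2 * `|t' *: x| <= delta.
  by apply: small => //; apply: le_trans b1 _; rewrite lerDr.
have hst1 : 2 * `|(s' + t') *: x| <= delta.
  by apply: small; [rewrite addr_ge0|exact: lerD].
have frac (c : nat) : 2 * `|(c%:R / M) *: x| <= delta ->
    Ex ((c%:R / M) *: x) = (Ex (M^-1 *: x) ^+ c)%g.
  move=> hc; rewrite -scalerA Ex_pow //.
  by move: hc; rewrite -scalerA normrZ ger0_norm.
have eab : (Ex (s' *: x) * Ex (t' *: x))%g = Ex ((s' + t') *: x).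
  have e : s' + t' = (a + b)%:R / M by rewrite natrD mulrDl.
  by rewrite e !frac -?expgnDr -?e.
have [Ns' es'] := ExP hs'; have [Nt' et'] := ExP ht'; have [_ est'] := ExP hst1.
have d1 : `|L (s *: x) - L (s' *: x)| <= 2 * C * (M^-1 * `|x|).
  apply: le_trans (L_lip hs hs') _; rewrite -scalerBl normrZ ger0_norm ?subr_ge0 //.
  by rewrite ler_wpM2l ?mulr_ge0 // ler_wpM2r.
have d2 : `|L (t *: x) - L (t' *: x)| <= 2 * C * (M^-1 * `|x|).
  apply: le_trans (L_lip ht ht') _; rewrite -scalerBl normrZ ger0_norm ?subr_ge0 //.
  by rewrite ler_wpM2l ?mulr_ge0 // ler_wpM2r.
have d3 : `|L ((s + t) *: x) - L ((s' + t') *: x)| <= 2 * C * (2 * (M^-1 * `|x|)).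
  apply: le_trans (L_lip hst' hst1) _; rewrite -scalerBl normrZ ger0_norm; last first.
    by rewrite subr_ge0; exact: lerD.
  rewrite ler_wpM2l ?mulr_ge0 // mulrA ler_wpM2r //.
  by move: a2 b2; move: (M^-1) => z; lra.
have f1 := lg_mull Ns Ns' Nt; have f2 := lg_mulr Ns' Nt Nt'.
rewrite eab est' et et' in f2; rewrite es es' et in f1.
have Lt : C * `|L (t *: x)| <= 1.
  apply: le_trans dC1; apply: ler_wpM2l => //.
  by apply: le_trans (L_bound ht) _; exact: ht.
have f3 : C * `|L (s *: x) - L (s' *: x)| * `|L (t *: x)| <= `|L (s *: x) - L (s' *: x)|.
  by rewrite mulrAC -[leRHS]mul1r; apply: ler_wpM2r.
have f4 : C * `|L (t *: x) - L (t' *: x)| <= C * (2 * C * (M^-1 * `|x|)).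
  exact: ler_wpM2l.
have e : (10 * C ^+ 2 + 10 * C) * `|x| / M =
  5 * (C * (2 * C * (M^-1 * `|x|))) + 5 * (2 * C * (M^-1 * `|x|)) by ring.
rewrite e; have z1 : 0 <= C * (2 * C * (M^-1 * `|x|)).
  by rewrite !mulr_ge0 // invr_ge0 ltW.
have z2 : 0 <= 2 * C * (M^-1 * `|x|) by rewrite !mulr_ge0 // invr_ge0 ltW.
rewrite mulrCA in d3; exact: telescoped_norm_bound f1 f2 f3 f4 d1 d3 z1 z2.
Qed.

(** The map [y |-> (Ex (- y))^-1] has the root property of [Ex] and agrees with the identity to
    second order in the chart; [root_diff] then forces it to be [Ex]. *)
Let Ex_neg (x : g_) : 2 * `|x| <= delta -> Ex (- x) = (Ex x)^-1%g.
Proof.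
move=> hx; have hnx : 2 * `|- x| <= delta by rewrite normrN.
have small (y : g_) : 2 * `|y| <= delta -> 2 * `|- y| <= delta by rewrite normrN.
(* [8 * C] comes from [lg_mul] applied to [Ex (- y)] and its inverse, of norms at most [2 * |y|] and
   [4 * |y|]; [4 * C ^+ 2] comes from [L_germ]. *)
pose K : R := 8 * C + 4 * C ^+ 2.
have K0' : 0 <= K by rewrite addr_ge0 ?mulr_ge0 // sqr_ge0.
have Kd : K * delta <= 1.
  have h : C * delta <= C ^+ 2 * delta by rewrite ler_pM2r.
  have d16 : 16 * (C ^+ 2 * delta) <= 1 by rewrite mulrA.
  have -> : K * delta = 8 * (C * delta) + 4 * (C ^+ 2 * delta) by rewrite /K; ring.
  by move: d16 h; move: (C * delta) (C ^+ 2 * delta) => a b; lra.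
pose f y := ((Ex (- y))^-1)%g.
have fP (y : g_) : 2 * `|y| <= delta -> N (f y) /\ `|lg (f y) - y| <= K * `|y| ^+ 2.
  move=> hy; have [Ny ey] := ExP (small _ hy).
  have Ly : `|lg (Ex (- y))| <= 2 * `|y| by rewrite ey -[`|y|]normrN; exact: (L_bound (small _ hy)).
  have Nf : N (f y).
    apply: NV => //; apply: le_trans Ly _; apply: le_trans hy _.
    by move: delta0; lra.
  split=> //; have Dm := lg_mul Ny Nf; rewrite /f mulgV lg1 -/(f y) in Dm.
  have g0 := normr_ge0 (lg (Ex (- y))); have f0 := normr_ge0 (lg (f y)).
  have Cg : C * `|lg (Ex (- y))| <= 8^-1.
    by apply: le_trans dC; apply: ler_wpM2l => //; apply: le_trans Ly _.
  have Dm1 : `|lg (f y) + lg (Ex (- y))| <= C * `|lg (Ex (- y))| * `|lg (f y)|.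
    by rewrite -normrN opprD addrC -[- _ - _]add0r addrA.
  have Dm2 : C * `|lg (Ex (- y))| * `|lg (f y)| <= 8^-1 * `|lg (f y)| by exact: ler_wpM2r.
  have fb : `|lg (f y)| <= 2 * `|lg (Ex (- y))|.
    have : `|lg (f y)| <= `|lg (f y) + lg (Ex (- y))| + `|lg (Ex (- y))|.
      by rewrite -{1}[lg (f y)](addrK (lg (Ex (- y)))); exact: ler_normB.
    by move: Dm1 Dm2; move: `|_ + _| (C * _ * _) => a b; lra.
  have e1 : `|lg (f y) + lg (Ex (- y))| <= 8 * C * `|y| ^+ 2.
    apply: le_trans Dm1 _.
    apply: (@le_trans _ _ (C * (2 * `|y|) * (2 * (2 * `|y|)))).
      apply: ler_pM => //; first by rewrite mulr_ge0.
        by apply: ler_wpM2l.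
      by apply: le_trans fb _; rewrite ler_wpM2l.
    by rewrite le_eqVlt; apply/orP; left; apply/eqP; ring.
  have e2 := L_germ (small _ hy); rewrite normrN -ey opprK in e2.
  have -> : lg (f y) - y = (lg (f y) + lg (Ex (- y))) - (lg (Ex (- y)) + y).
    by apply/rowP => k; rewrite !mxE; ring.
  by apply: le_trans (ler_normB _ _) _; rewrite mulrDl; exact: lerD.
have fpow k : (f (k.+1%:R^-1 *: x) ^+ k.+1)%g = f x.
  by rewrite /f expVgn -scalerN Ex_root.
have [Nf _] := fP _ hx.
suff fE : f x = Ex x by rewrite -fE /f invgK.
have [Df _] := Nf.
apply: (@eq_Ex _ _ (4 * C * K * `|x| ^+ 2)) => // k.
have hk : 2 * `|k.+1%:R^-1 *: x| <= delta.
  by apply: le_trans hx; rewrite ler_pM2l //; exact: scale_norm_le.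
have [Nfk efk] := fP _ hk; have [Nk ek] := ExP hk.
have := @root_diff f Ex K x k K0' Nfk Nk efk.
rewrite fpow Ex_root // (ExP hx).2; apply => //.
rewrite ek; apply: le_trans (L_germ hk) _; apply: ler_wpM2r; first exact: sqr_ge0.
by rewrite /K lerDr mulr_ge0.
Qed.

(** For mixed signs, terms are moved across the identity until all the arguments are nonnegative. *)
Let Ex_add (x : g_) (s t : R) : 2 * ((`|s| + `|t|) * `|x|) <= delta ->
  (Ex (s *: x) * Ex (t *: x))%g = Ex ((s + t) *: x).
Proof.
have x0 := normr_ge0 x; move=> h.
have pos a b : 0 <= a -> 0 <= b -> a + b <= `|s| + `|t| ->
    (Ex (a *: x) * Ex (b *: x))%g = Ex ((a + b) *: x).
  move=> a0 b0 hab; apply: Ex_add_pos => //; apply: le_trans h.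
  by rewrite ler_pM2l // ler_wpM2r.
have neg a : `|a| <= `|s| + `|t| -> Ex (- a *: x) = (Ex (a *: x))^-1%g.
  move=> ha; rewrite scaleNr Ex_neg // normrZ; apply: le_trans h.
  by rewrite ler_pM2l // ler_wpM2r.
have ns : `|s| <= `|s| + `|t| by rewrite lerDl.
have nt : `|t| <= `|s| + `|t| by rewrite lerDr.
have nst : `|s + t| <= `|s| + `|t| by exact: ler_normD.
have [sp|sn] := leP 0 s; have [tp|tn] := leP 0 t.
- by apply: pos => //; rewrite !ger0_norm.
- have nt0 : 0 <= - t by rewrite oppr_ge0 ltW.
  have et : Ex (t *: x) = (Ex (- t *: x))^-1%g by rewrite -[t in LHS]opprK neg // normrN.
  have as_ : `|s| = s by rewrite ger0_norm.
  have at_ : `|t| = - t by rewrite ltr0_norm.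
  rewrite et; have [stp|stn] := leP 0 (s + t).
    have hb : s + t - t <= `|s| + `|t| by rewrite as_ at_; lra.
    by have := pos _ _ stp nt0 hb; rewrite addrK => <-; rewrite mulgK.
  have hb : - (s + t) + s <= `|s| + `|t| by rewrite as_ at_; lra.
  have nst0 : 0 <= - (s + t) by rewrite oppr_ge0 ltW.
  have := pos _ _ nst0 sp hb; rewrite (_ : - (s + t) + s = - t); last by ring.
  by move=> <-; rewrite invgM mulVKg -neg ?opprK // normrN.
- have ns0 : 0 <= - s by rewrite oppr_ge0 ltW.
  have es : Ex (s *: x) = (Ex (- s *: x))^-1%g by rewrite -[s in LHS]opprK neg // normrN.
  have as_ : `|s| = - s by rewrite ltr0_norm.
  have at_ : `|t| = t by rewrite ger0_norm.
  rewrite es; have [stp|stn] := leP 0 (s + t).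
    have hb : - s + (s + t) <= `|s| + `|t| by rewrite as_ at_; lra.
    by have := pos _ _ ns0 stp hb; rewrite addrA addNr add0r => <-; rewrite mulKg.
  have hb : t + - (s + t) <= `|s| + `|t| by rewrite as_ at_; lra.
  have nst0 : 0 <= - (s + t) by rewrite oppr_ge0 ltW.
  have := pos _ _ tp nst0 hb; rewrite (_ : t + - (s + t) = - s); last by ring.
  by move=> <-; rewrite invgM mulgVK -neg ?opprK // normrN.
- have ns0 : 0 <= - s by rewrite oppr_ge0 ltW.
  have nt0 : 0 <= - t by rewrite oppr_ge0 ltW.
  have es : Ex (s *: x) = (Ex (- s *: x))^-1%g by rewrite -[s in LHS]opprK neg // normrN.
  have et : Ex (t *: x) = (Ex (- t *: x))^-1%g by rewrite -[t in LHS]opprK neg // normrN.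
  have hb : - t - s <= `|s| + `|t| by rewrite !ltr0_norm // addrC.
  have := pos _ _ nt0 ns0 hb; rewrite (_ : - t - s = - (s + t)); last by ring.
  by move=> e; rewrite es et -invgM e -neg ?opprK // normrN.
Qed.

Theorem one_parameter_subgroup (x : g_) : exists c : R -> G,
  (forall s t, c (s + t) = (c s * c t)%g) /\
  exists K e : R, [/\ 0 <= K, 0 < e & forall t, `|t| <= e ->
    D (c t) /\ `|lg (c t) - t *: x| <= K * `|t| ^+ 2].
Proof.
have x0 := normr_ge0 x.
have ub (y : R) : exists k : nat, 2 * (y * `|x|) <= k.+1%:R * delta.
  have [y0|y0] := leP y 0.
    exists 0%N; rewrite mul1r; apply: le_trans (ltW delta0).
    by rewrite pmulr_rle0 //; exact: mulr_le0_ge0.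
  have r0 : 0 <= 2 * (y * `|x|) / delta.
    by apply: divr_ge0; [rewrite !mulr_ge0 // ltW|exact: ltW].
  exists (Num.truncn (2 * (y * `|x|) / delta)); have /andP[_ h] := truncn_itv r0.
  by rewrite -ler_pdivrMr // ltW.
have /choice [kk hkk] : forall t : R, exists k : nat, 2 * (`|t| * `|x|) <= k.+1%:R * delta.
  by move=> t; exact: ub.
have sc (r : R) k : `|r / k.+1%:R| = `|r| / k.+1%:R.
  by rewrite normrM normfV (ger0_norm (ltW (k1_gt0 k))).
have resc (t : R) k l : 2 * (`|t| * `|x|) <= k.+1%:R * delta ->
    (Ex ((t / k.+1%:R) *: x) ^+ k.+1)%g = (Ex ((t / (k.+1 * l.+1)%:R) *: x) ^+ (k.+1 * l.+1))%g.
  move=> h; rewrite mulnC expgnA; congr (_ ^+ _)%g.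
  rewrite -(@Ex_root l); last first.
    by rewrite normrZ sc mulrAC mulrA ler_pdivrMr // [leRHS]mulrC.
  by rewrite scalerA natrM invfM mulrCA.
have resc2 (t : R) k l : 2 * (`|t| * `|x|) <= k.+1%:R * delta ->
    2 * (`|t| * `|x|) <= l.+1%:R * delta ->
    (Ex ((t / k.+1%:R) *: x) ^+ k.+1)%g = (Ex ((t / l.+1%:R) *: x) ^+ l.+1)%g.
  by move=> hk hl; rewrite (resc t k l hk) (resc t l k hl) mulnC.
(* [kk t] is large enough to bring the argument into the domain of [Ex]. By [resc2] the value does
   not depend on it, so [s], [t] and [s + t] can share one denominator. *)
exists (fun t => Ex ((t / (kk t).+1%:R) *: x) ^+ (kk t).+1)%g; split=> [s t|].
  have [k hk] := ub (`|s| + `|t|).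
  have h (r : R) : `|r| <= `|s| + `|t| -> 2 * (`|r| * `|x|) <= k.+1%:R * delta.
    by move=> hr; apply: le_trans hk; rewrite ler_pM2l // ler_wpM2r.
  have hs : 2 * (`|s| * `|x|) <= k.+1%:R * delta by apply: h; rewrite lerDl.
  have ht : 2 * (`|t| * `|x|) <= k.+1%:R * delta by apply: h; rewrite lerDr.
  have hst := h _ (ler_normD s t).
  rewrite (resc2 _ _ _ (hkk s) hs) (resc2 _ _ _ (hkk t) ht) (resc2 _ _ _ (hkk (s + t)) hst).
  have hd : 2 * ((`|s / k.+1%:R| + `|t / k.+1%:R|) * `|x|) <= delta.
    rewrite !sc -mulrDl mulrAC mulrA ler_pdivrMr // [leRHS]mulrC.
    exact: hk.
  (* The swapped sum gives the commutation under which the power distributes over the product. *)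
  have hd' : 2 * ((`|t / k.+1%:R| + `|s / k.+1%:R|) * `|x|) <= delta.
    by rewrite [`|t / _| + _]addrC.
  have e1 := Ex_add hd; have e2 := Ex_add hd'.
  by rewrite mulrDl -e1 expgMn // /commute e1 e2 addrC.
exists (4 * C ^+ 2 * `|x| ^+ 2), (delta / (2 * (`|x| + 1))).
have x1 : 0 < `|x| + 1 by rewrite ltr_wpDl.
split=> [//||t ht]; first by rewrite divr_gt0 // mulr_gt0.
have htx : 2 * `|t *: x| <= delta.
  rewrite normrZ; move: ht; rewrite ler_pdivlMr ?mulr_gt0 // => ht.
  apply: le_trans ht; rewrite mulrCA ler_wpM2l // ler_wpM2l //.
  by rewrite lerDl.
have -> : (Ex ((t / (kk t).+1%:R) *: x) ^+ (kk t).+1)%g = Ex (t *: x).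
  rewrite (resc2 t (kk t) 0%N) ?expg1 ?divr1 //.
  by rewrite mul1r -normrZ.
have [[Dt _] et] := ExP htx; split=> //; rewrite et.
by apply: le_trans (L_germ htx) _; rewrite normrZ exprMn [X in _ <= X]mulrAC mulrA.
Qed.

End one_parameter_subgroups.

(** * From smooth charts to the exponential *)

Section lipschitz_estimates.
Context {R : realType}.

Lemma common_radius (n : nat) (P : 'I_n -> R -> Prop) :
  (forall i, exists2 d, 0 < d & forall d', 0 < d' -> d' <= d -> P i d') ->
  exists2 d, 0 < d & forall i, P i d.
Proof.
move=> h.
have n1 : \forall d \near (0 : R)^'+, forall i, P i d.
  apply: filter_forall => i; have [d d0 hd] := h i.
  have m1 : \forall d' \near (0 : R)^'+, 0 < d' by exact: nbhs_right_gt.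
  have m2 : \forall d' \near (0 : R)^'+, d' < d by exact: nbhs_right_lt.
  by apply: filterS (filterI m1 m2) => d' [h1 h2]; apply: hd => //; exact: ltW.
have n2 : \forall d \near (0 : R)^'+, 0 < d by exact: nbhs_right_gt.
have [d [d1 d2]] := @filter_ex _ _ (at_right_proper_filter _) _ (filterI n1 n2).
by exists d.
Qed.

(** Subtracting the differential at [x0] leaves a map to which [small_lipschitz] applies. *)
Lemma lipschitz_at (E F : normedModType R) {fE : findim E} {fF : findim F} (A : set E)
    (f : E -> F) x0 : open A -> A x0 -> smooth_on A f ->
  exists2 d, 0 < d & ball x0 d `<=` A /\ exists2 L, 0 <= L &
    forall x y, ball x0 d x -> ball x0 d y -> `|f x - f y| <= L * `|x - y|.
Proof.
move=> oA Ax0 /smooth_onP cf.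
have df0 : differentiable f x0 by exact: Ck_differentiable (cf 0%N) Ax0.
have cL : continuous ('d f x0 : E -> F) by exact: diff_continuous.
have cN : continuous (-%R \o 'd f x0 : {linear E -> F}) by exact: findim_lin_cont.
pose f1 x := f x + (-%R \o 'd f x0 : {linear E -> F}) x.
have cf1 k : Ck k A f1 by apply: CkD => //; exact: Ck_lin.
have D0 v : 'D_v f1 x0 = 0.
  have d2 : differentiable (-%R \o 'd f x0 : {linear E -> F}) x0.
    exact: linear_differentiable.
  have e := deriveD (diff_derivable (v := v) df0) (diff_derivable (v := v) d2).
  apply: (eq_trans e); rewrite derive_lin // deriveE //=; exact: subrr.
have [d d0 [dA hd]] := small_lipschitz fE fF oA Ax0 (cf1 1%N) D0 ltr01.
have [k k0 hk] := linear_lipschitz cL.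
exists d => //; split=> //; exists (1 + k); first by rewrite addr_ge0 // ltW.
move=> x y bx by_; have := hd _ _ bx by_; rewrite mul1r /f1 /= => h.
have -> : f x - f y = (f x - 'd f x0 x - (f y - 'd f x0 y)) + 'd f x0 (x - y).
  have aux (a b X Y : F) : X - Y = (X - a - (Y - b)) + (a - b).
    transitivity ((X - a) + a - ((Y - b) + b)); first by rewrite !subrK.
    by rewrite [- (_ + b)]opprD addrACA.
  apply: (eq_trans (aux ('d f x0 x) ('d f x0 y) _ _)).
  by congr (_ + _); rewrite linearB.
apply: le_trans (ler_normD _ _) _; rewrite mulrDl mul1r; exact: lerD.
Qed.

(** A mean value inequality in the second variable for [f (p, z) - f (q, z)]: its derivative is a
    difference of partial derivatives of [f], which are Lipschitz. *)
Lemma mixed_lipschitz (E F H : normedModType R) {fE : findim E} {fF : findim F}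
    {fH : findim H} (A : set (E * F)) (f : E * F -> H) (x0 : E) (y0 : F) :
  open A -> A (x0, y0) -> smooth_on A f ->
  exists2 d, 0 < d & (forall p a, ball x0 d p -> ball y0 d a -> A (p, a)) /\
  exists2 L, 0 <= L & forall p q a b, ball x0 d p -> ball x0 d q -> ball y0 d a -> ball y0 d b ->
    `|f (p, a) - f (q, a) - (f (p, b) - f (q, b))| <= L * `|p - q| * `|a - b|.
Proof.
move=> oA A0 sf; move: (fF) => [n [e [l [cl el]]]].
have /choice [k hk] : forall i, exists k, 0 < k /\ forall x, `|l i x| <= k * `|x|.
  by move=> i; have [k k0 hk] := findim_lin_bound (cl i); exists k.
have key i : exists2 d, 0 < d & forall d', 0 < d' -> d' <= d ->
    ball (x0, y0) d' `<=` A /\ exists2 L, 0 <= L & forall x y, ball (x0, y0) d' x -> ball (x0, y0) d' y ->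
    `|'D_(0, e i) f x - 'D_(0, e i) f y| <= L * `|x - y|.
  have [d d0 [dA [L L0 hL]]] := lipschitz_at oA A0 (smooth_on_D (0, e i) sf).
  exists d => // d' d'0 dd; have sub := le_ball dd (x := (x0, y0)); split.
    by move=> z /sub /dA.
  by exists L => // x y /sub hx /sub hy; exact: hL.
have [d d0 hd] := common_radius key.
have /choice [L hL] : forall i, exists L, 0 <= L /\ forall x y, ball (x0, y0) d x -> ball (x0, y0) d y ->
    `|'D_(0, e i) f x - 'D_(0, e i) f y| <= L * `|x - y|.
  by move=> i; have [_ [L L0 h]] := hd i; exists L.
have [da da0 [dA _]] := lipschitz_at oA A0 sf.
have [K K0 hK] := mvi F fH.
pose d' := Num.min d da; have d'0 : 0 < d' by rewrite lt_min d0.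
have bd : ball (x0, y0) d' `<=` ball (x0, y0) d by apply: le_ball; rewrite ge_min lexx.
have bda : ball (x0, y0) d' `<=` ball (x0, y0) da by apply: le_ball; rewrite ge_min lexx orbT.
have inA p a : ball x0 d' p -> ball y0 d' a -> A (p, a).
  by move=> bp ba; apply: dA; apply: bda; split.
exists d' => //; split=> //.
have S0 : 0 <= \sum_i k i * L i.
  by apply: sumr_ge0 => i _; rewrite mulr_ge0 //; [case: (hk i) => /ltW|case: (hL i)].
exists (K * \sum_i k i * L i); first by rewrite mulr_ge0 // ltW.
move=> p q a b bp bq ba bb.
pose h z := f (p, z) - f (q, z).
have seg t : 0 <= t <= 1 -> ball y0 d' (b + t *: (a - b)) by move=> t01; exact: ball_segment.
have dpart r z : ball x0 d' r -> ball y0 d' z -> differentiable (fun z => f (r, z)) z.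
  move=> br bz; have d1 : differentiable (fun z : F => (r, z)) z.
    have did : differentiable (id : F -> F) z.
      by apply: (@linear_differentiable _ _ _ (idfun : {linear F -> F})) => ?; exact: cvg_id.
    exact: (differentiable_pair (differentiable_cst r z) did).
  apply: (differentiable_comp d1); apply: smooth_on_differentiable sf _; exact: inA.
have dh z : ball y0 d' z -> differentiable h z.
  by move=> bz; exact: (differentiableB (dpart _ _ bp bz) (dpart _ _ bq bz)).
have Dh z v : ball y0 d' z -> 'D_v h z = 'D_(0, v) f (p, z) - 'D_(0, v) f (q, z).
  move=> bz; rewrite !derive_sndv.
  exact: (deriveB (diff_derivable (dpart _ _ bp bz)) (diff_derivable (dpart _ _ bq bz))).
have e1 : f (p, a) - f (q, a) - (f (p, b) - f (q, b)) = h (b + (a - b)) - h b.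
  by rewrite [b + _]addrC subrK.
rewrite e1 -!mulrA; apply: hK => t /seg; move: (b + t *: _) => z bz; first exact: dh.
rewrite Dh // mulr_suml.
have lin r v : ball x0 d' r -> 'D_(0, v) f (r, z) = \sum_i l i v *: 'D_(0, e i) f (r, z).
  move=> br; have dr : differentiable f (r, z) by apply: smooth_on_differentiable sf _; exact: inA.
  rewrite deriveE // (_ : (0, v) = \sum_i l i v *: (0, e i)).
    by rewrite linear_sum; apply: eq_bigr => i _; rewrite linearZ -deriveE.
  apply/pair_eqP; rewrite /pair_eq; apply/andP; split; apply/eqP.
    by rewrite -[LHS]/(fst _); rewrite (big_morph fst (id1 := 0) (op1 := +%R)) //= big1 // => i _; rewrite scaler0.
  by rewrite (big_morph snd (id1 := 0) (op1 := +%R)) //=; exact: el.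
rewrite !lin // -sumrB; apply: le_trans (ler_norm_sum _ _ _) _; apply: ler_sum => i _.
rewrite -scalerBr normrZ.
have [k0 hki] := hk i; have [L0 hLi] := hL i.
have b1 : ball (x0, y0) d (p, z) by apply: bd; split.
have b2 : ball (x0, y0) d (q, z) by apply: bd; split.
have := hLi _ _ b1 b2.
have -> : `|(p, z) - (q, z)| = `|p - q|.
  by rewrite prod_normE /= subrr normr0; apply/max_idPl; exact: normr_ge0.
move=> h2; apply: (@le_trans _ _ (k i * `|a - b| * (L i * `|p - q|))); first exact: ler_pM.
by rewrite le_eqVlt; apply/orP; left; apply/eqP; ring.
Qed.

End lipschitz_estimates.

Section exponential.
Context {R : realType} {n : nat} {G : groupType} (A : manifold 'rV[R]_n G).
Context (hG : lie_group A).
Local Notation g_ := 'rV[R]_n.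
Local Notation e0 := (chart A 1%g 1%g).
Let lg (g : G) : g_ := chart A 1%g g - e0.
Let gam (x : g_) : G := chart_inv A 1%g (x + e0).
Let C0 : set g_ := [set x | chart_image A 1%g (x + e0)].

Let oC0 : open C0.
Proof.
have -> : C0 = setT `&` (fun x : g_ => x + e0) @^-1` chart_image A 1%g.
  by rewrite setTI.
apply: continuous_open_at; [exact: openT|exact: chart_image_open|].
move=> x _; apply: (@smooth_cont _ _ _ setT) => //; apply: smooth_on_add.
- exact: openT.
- exact: smooth_on_id.
- exact: smooth_on_cst.
Qed.

Let sshift : smooth_on C0 (fun x : g_ => x + e0).
Proof. by apply: smooth_on_add => //; [exact: smooth_on_id|exact: smooth_on_cst]. Qed.

Let pgam : plot A C0 gam.
Proof.
apply: (@plot_comp_smooth _ _ _ _ _ _ (chart_image A 1%g) _ (chart_inv A 1%g)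
  (fun x : g_ => x + e0)) => //; exact: plot_chart_inv.
Qed.

Let C00 : C0 0.
Proof. by rewrite /C0 /= add0r; exact: chart_image_self. Qed.

Let gam0 : gam 0 = 1%g.
Proof. by rewrite /gam add0r chartK //; exact: chart_domP. Qed.

Let gamlg g : chart_dom A 1%g g -> gam (lg g) = g.
Proof. by move=> Dg; rewrite /gam /lg subrK chartK. Qed.

Let lggam x : C0 x -> chart_dom A 1%g (gam x) /\ lg (gam x) = x.
Proof. by move=> Cx; split; [exact: chart_inv_dom|rewrite /lg chart_invK // addrK]. Qed.

Let Pm (x : g_ * g_) := (gam x.1 * gam x.2)%g.
Let pPm : plot A (C0 `*` C0) Pm.
Proof. by apply: (plot_mul hG); [exact: plot_fst|exact: plot_snd]. Qed.

Lemma local_one_parameter (xi : g_) : exists c : R -> G,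
  (forall s t, c (s + t) = (c s * c t)%g) /\
  exists K e : R, [/\ 0 <= K, 0 < e & forall t, `|t| <= e ->
    chart_dom A 1%g (c t) /\ `|chart A 1%g (c t) - e0 - t *: xi| <= K * `|t| ^+ 2].
Proof.
have [oD sD] := plot_chart 1%g pPm; set D := _ `&` _ in oD sD.
set f := chart A 1%g \o Pm in sD.
have D0 : D (0, 0).
  by split; [split|rewrite /= /Pm /= gam0 mulg1; exact: chart_domP].
have [d1 d10 [D1 [L1 L10 h1]]] := mixed_lipschitz oD D0 sD.
have [d2 d20 [D2 [L2 L20 h2]]] := lipschitz_at oD D0 sD.
have [d3 /= d30 D3] : exists2 d : R, 0 < d & ball (0 : g_) d `<=` C0.
  have /nbhs_ballP [d d0 hd] : nbhs (0 : g_) C0 by apply: open_nbhs_nbhs; split.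
  by exists d.
pose eps := Num.min d1 (Num.min d2 d3).
have eps0 : 0 < eps by rewrite !lt_min d10 d20.
have [d4 /= d40 D4] : exists2 d : R, 0 < d & forall x : g_, `|x| < d ->
    chart_dom A 1%g (gam x)^-1%g /\ `|lg (gam x)^-1%g| < eps.
  have pV := plot_invg hG pgam.
  have [oV sV] := plot_chart 1%g pV.
  have V0 : (C0 `&` (fun y => (gam y)^-1%g) @^-1` chart_dom A 1%g) 0.
    by split=> //=; rewrite gam0 invg1; exact: chart_domP.
  have cV := smooth_cont sV V0.
  have n1 : \forall x \near (0 : g_), chart_dom A 1%g (gam x)^-1%g.
    by apply: filterS (near_open oV V0) => x [].
  have n2 : \forall x \near (0 : g_), `|lg (gam x)^-1%g| < eps.
    have /cvgrPdist_lt /(_ eps eps0) := cV; apply: filterS => x /=.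
    by rewrite gam0 invg1 -normrN opprB.
  have /nbhs_ballP [d d0 hd] : nbhs (0 : g_) [set x | chart_dom A 1%g (gam x)^-1%g /\ `|lg (gam x)^-1%g| < eps].
    exact: filterI n1 n2.
  exists d => // x hx.
  by apply: hd; rewrite -ball_normE /= sub0r normrN.
(* [L1] serves the estimate [lg_mull], [L2] the estimate [lg_mulr], and 1 the requirement
   [1 <= C]. *)
pose C := 1 + L1 + L2.
have C1 : 1 <= C by rewrite /C -addrA lerDl addr_ge0.
have C16 : 0 < 16 * C ^+ 2 by rewrite mulr_gt0 // exprn_gt0 // (lt_le_trans ltr01).
pose delta := Num.min (eps / 4) (Num.min (d4 / 4) (16 * C ^+ 2)^-1).
have delta0 : 0 < delta by rewrite !lt_min !divr_gt0 // invr_gt0.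
have bE (d : R) (x : g_) : eps <= d -> `|x| < eps -> ball (0 : g_) d x.
  by move=> ed xe; rewrite -ball_normE /= sub0r normrN; exact: lt_le_trans xe ed.
have ed1 : eps <= d1 by rewrite ge_min lexx.
have ed2 : eps <= d2 by rewrite !ge_min lexx orbT.
have ed3 : eps <= d3 by rewrite !ge_min lexx !orbT.
have fE g h : chart_dom A 1%g g -> chart_dom A 1%g h -> f (lg g, lg h) = lg (g * h)%g + e0.
  by move=> Dg Dh; rewrite /f /= /Pm /= !gamlg // subrK.
have b0 (d : R) : 0 < d -> ball (0 : g_) d 0 by move=> d0; exact: ballxx.
have fE0 g : chart_dom A 1%g g -> f (lg g, 0) = lg g + e0.
  by move=> Dg; rewrite /f /= /Pm /= gam0 mulg1 gamlg // subrK.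
apply: (@one_parameter_subgroup R n G lg gam (chart_dom A 1%g) eps C delta).
- exact: C1.
- exact: chart_domP.
- by rewrite /lg subrr.
- exact: gamlg.
- by move=> x xe; apply: lggam; apply: D3; exact: bE.
- move=> g h [Dg eg] [Dh eh].
  have [_] := D1 _ _ (bE _ _ ed1 eg) (bE _ _ ed1 eh).
  by rewrite /= /Pm /= !gamlg.
- move=> g g' h [Dg eg] [Dg' eg'] [Dh eh].
  (* The fourth point is 0, the coordinate of the identity, where [f] reduces to the first
     factor. *)
  have := h1 _ _ _ _ (bE _ _ ed1 eg) (bE _ _ ed1 eg') (bE _ _ ed1 eh) (b0 _ d10).
  rewrite !fE // !fE0 // !subr0.
  have -> : lg (g * h)%g + e0 - (lg (g' * h)%g + e0) - (lg g + e0 - (lg g' + e0)) =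
     lg (g * h)%g - lg (g' * h)%g - (lg g - lg g').
    by apply/rowP => i; rewrite !mxE; ring.
  move=> h3; apply: le_trans h3 _; rewrite -!mulrA ler_wpM2r ?mulr_ge0 //.
  by rewrite /C; move: L10 L20; lra.
- move=> g h h' [Dg eg] [Dh eh] [Dh' eh'].
  have b1 : ball ((0, 0) : g_ * g_) d2 (lg g, lg h) by split; exact: bE.
  have b2 : ball ((0, 0) : g_ * g_) d2 (lg g, lg h') by split; exact: bE.
  have := h2 _ _ b1 b2; rewrite !fE //.
  have -> : lg (g * h)%g + e0 - (lg (g * h')%g + e0) = lg (g * h)%g - lg (g * h')%g.
    by apply/rowP => i; rewrite !mxE; ring.
  have -> : `|(lg g, lg h) - (lg g, lg h')| = `|lg h - lg h'|.
    by rewrite prod_normE /= subrr normr0; apply/max_idPr; exact: normr_ge0.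
  move=> h3; apply: le_trans h3 _; rewrite ler_wpM2r //.
  by rewrite /C; move: L10 L20; lra.
- exact: delta0.
- have : delta <= eps / 4 by rewrite ge_min lexx.
  by move: eps0; lra.
- have : delta <= (16 * C ^+ 2)^-1 by rewrite !ge_min lexx !orbT.
  by rewrite -[X in _ <= X]div1r ler_pdivlMr // mulrC.
- move=> g [Dg eg] hg.
  have dd4 : delta <= d4 / 4 by rewrite !ge_min lexx orbT.
  have gd4 : `|lg g| < d4 by apply: le_lt_trans hg _; move: d40 dd4; lra.
  by have := D4 _ gd4; rewrite gamlg.
Qed.

Section hom.
Context (c : R^o -> G) (xi : g_) (K e : R).
Context (cM : forall s t, c (s + t) = (c s * c t)%g) (K0 : 0 <= K) (egt0 : 0 < e).
Context (cE : forall t : R, `|t| <= e ->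
  chart_dom A 1%g (c t) /\ `|chart A 1%g (c t) - e0 - t *: xi| <= K * `|t| ^+ 2).

Let c0 : c 0 = 1%g.
Proof. by apply: (mulgI (c 0)); rewrite -cM addr0 mulg1. Qed.

Let w (t : R^o) : g_ := chart A 1%g (c t).

Let dw : differentiable w 0 /\ 'D_1 w 0 = xi.
Proof.
have lL : linear (fun t : R^o => t *: xi) by move=> a s t; rewrite scalerDl scalerA.
have [L eL] := lin_pack lL; have cL : continuous L by exact: findim_lin_cont.
have [dw0 ew] : differentiable w 0 /\ 'd w 0 = L :> (_ -> _).
  apply: differentiableI => // eps eps0.
  have r0 : 0 < Num.min e (eps / (K + 1)).
    by rewrite lt_min egt0 divr_gt0 // ltr_wpDl.
  apply: filterS (@near0_norm_le _ R^o _ r0) => t /= ht.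
  have te : `|t| <= e by apply: le_trans ht _; rewrite ge_min lexx.
  have te2 : `|t| <= eps / (K + 1) by apply: le_trans ht _; rewrite ge_min lexx orbT.
  have [_ h] := cE te; rewrite addr0 /w c0 -eL; apply: le_trans h _.
  rewrite expr2 mulrA ler_wpM2r //.
  apply: (@le_trans _ _ (K * (eps / (K + 1)))); first exact: ler_wpM2l.
  rewrite mulrCA; apply: ler_piMr; first exact: ltW.
  by rewrite ler_pdivrMr ?ltr_wpDl // mul1r lerDl; exact: ler01.
by split=> //; rewrite deriveE // ew -eL scale1r.
Qed.

(** Near [t0], [c t = c t0 * c (t - t0)]: differentiability at 0 spreads to [t0], and the derivative
    there is the value of a left-invariant vector field. *)
Let chart_at (p : G) (t0 : R^o) : chart_dom A p (c t0) ->
  (\forall t \near t0, chart_dom A p (c t)) /\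
  differentiable (chart A p \o c) t0 /\
  'D_1 (chart A p \o c) t0 = 'D_xi (fun x => chart A p (c t0 * chart_inv A 1%g x)%g) e0.
Proof.
move=> pt0; pose Q (x : g_) := (c t0 * chart_inv A 1%g x)%g.
have pQ : plot A (chart_image A 1%g) Q.
  apply: (plot_mul hG); last exact: plot_chart_inv.
  by apply: plot_const; exact: chart_image_open.
have [oD sD] := plot_chart p pQ; set D := _ `&` _ in oD sD.
have De0 : D e0.
  split; first exact: chart_image_self.
  by rewrite /= /Q chartK ?mulg1 //; exact: chart_domP.
have [dw0 Dw0] := dw.
pose sh (t : R^o) : R^o := t - t0.
have did : differentiable (id : R^o -> R^o) t0.
  by apply: (@linear_differentiable _ _ _ (idfun : {linear R^o -> R^o})) => ?; exact: cvg_id.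
have dsh : differentiable sh t0 by exact: (differentiableD did (differentiable_cst _ _)).
have Dsh : 'D_1 sh t0 = 1.
  have e1 := deriveD (diff_derivable (v := 1 : R^o) did)
    (diff_derivable (v := 1 : R^o) (differentiable_cst (- t0 : R^o) t0)).
  by apply: (eq_trans e1); rewrite derive_id derive_cst addr0.
have sh0 : sh t0 = 0 by rewrite /sh subrr.
have dws : differentiable (w \o sh) t0 by apply: differentiable_comp => //; rewrite sh0.
have wst0 : (w \o sh) t0 = e0 by rewrite /= sh0 /w c0.
have Dws : 'D_1 (w \o sh) t0 = xi.
  have dw1 : differentiable w (sh t0) by rewrite sh0.
  by rewrite (derive_comp (1 : R^o) dsh dw1) Dsh sh0.
have n1 : \forall t \near t0, D ((w \o sh) t).
  have cws := differentiable_continuous dws; apply: cws.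
  by rewrite wst0; apply: open_nbhs_nbhs; split.
have n2 : \forall t \near t0, chart_dom A 1%g (c (sh t)).
  have csh : sh @ t0 --> (0 : R^o) by rewrite -[X in _ --> X]sh0; exact: differentiable_continuous.
  have : \forall t \near (0 : R^o), chart_dom A 1%g (c t).
    by apply: filterS (@near0_norm_le _ R^o _ egt0) => t /cE [].
  by move=> /csh.
have n3 : \forall t \near t0, chart_dom A p (c t) /\ chart A p (c t) = (chart A p \o Q) ((w \o sh) t).
  apply: filterS (filterI n1 n2) => t [[_ Qt] st].
  have eQ : Q ((w \o sh) t) = c t.
    by rewrite /Q /= /w chartK // -cM /sh addrC subrK.
  by rewrite /= eQ; split=> //; rewrite -eQ.
have dQ : differentiable (chart A p \o Q) ((w \o sh) t0).
  by rewrite wst0; exact: smooth_on_differentiable sD De0.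
have n4 : \forall t \near t0, ((chart A p \o Q) \o (w \o sh)) t = (chart A p \o c) t.
  by apply: filterS n3 => t [_ /= ->].
split; first by apply: filterS n3 => t [].
split; first exact: near_eq_differentiable n4 (differentiable_comp dws dQ).
rewrite -(near_eq_derive _ n4) (derive_comp (1 : R^o) dws dQ) Dws wst0.
by [].
Qed.

(** The left-invariant vector field of [xi], read in the chart at [p]. *)
Let X p (z : g_) : g_ := 'D_xi (fun x => chart A p (chart_inv A p z * chart_inv A 1%g x)%g) e0.

Let sX p : smooth_on (chart_image A p) (X p).
Proof.
pose Q (x : g_ * g_) := (chart_inv A p x.1 * chart_inv A 1%g x.2)%g.
have oP : open (chart_image A p) by exact: chart_image_open.
have o1 : open (chart_image A 1%g) by exact: chart_image_open.
have pQ : plot A (chart_image A p `*` chart_image A 1%g) Q.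
  apply: (plot_mul hG).
    exact: (plot_fst (g := chart_inv A p) _ _ (@plot_chart_inv _ _ _ A p)).
  exact: (plot_snd (g := chart_inv A 1%g) _ _ (@plot_chart_inv _ _ _ A 1%g)).
have [oD sD] := plot_chart p pQ; set D := _ `&` _ in oD sD.
apply: (@smooth_on_ext _ _ _ _ ('D_(0, xi) (chart A p \o Q) \o (fun z => (z, e0))));
  [exact: oP|by move=> z _ /=; rewrite derive_sndv|].
apply: (@smooth_on_comp _ _ _ _ _ D) => //.
- move=> z pz; split; first by split=> //=; exact: chart_image_self.
  by rewrite /= /Q /= chartK ?mulg1; [exact: chart_inv_dom|exact: chart_domP].
- by apply: smooth_on_pair => //; [exact: smooth_on_id|exact: smooth_on_cst].
- exact: smooth_on_D.
Qed.

(** In a chart [c] solves the autonomous equation given by the smooth field [X p], so each order of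
    smoothness of [c] yields the next. *)
Lemma hom_plot : plot A setT c.
Proof.
move=> t _; pose p := c t; exists p, [set s | chart_dom A p (c s)].
have oT : open [set s | chart_dom A p (c s)].
  by rewrite openE => s /= /chart_at [].
have dT s : chart_dom A p (c s) -> differentiable (chart A p \o c) s.
  by move=> /chart_at [_ []].
split=> //; first exact: chart_domP.
apply/smooth_onP; elim=> [|k IH]; first by split.
split=> // v; apply: (@Ck_ext _ _ _ _ _ (fun s => v *: (X p \o (chart A p \o c)) s)) => //.
  move=> s ps; have [_ [ds Ds]] := chart_at ps.
  have ev : v = v *: (1 : R^o) by rewrite /GRing.scale /= mulr1.
  have eD := eq_trans (congr1 (fun w => 'D_w (chart A p \o c) s) ev) (deriveZv (v : R) (1 : R^o) ds).
  apply: esym; apply: (eq_trans eD); apply: (congr1 (fun w : g_ => v *: w)).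
  by apply: (eq_trans Ds); apply: eq_derive => x; rewrite /= chartK.
apply: CkZ => //; first exact: Ck_cst.
apply: (@Ck_comp _ _ _ _ _ _ (chart_image A p)) => //.
- exact: chart_image_open.
- by move=> s ps; exact: chart_imageP.
- exact: (smooth_onP _ _).1.
Qed.

Lemma hom_velocity : velocity A c 0 1 = xi.
Proof. by rewrite /velocity c0; have [_ <-] := dw. Qed.

End hom.

Lemma exp_curveP (xi : g_) :
  [/\ smooth_map (vmanifold R^o) A (exp_curve A xi),
      forall s t, exp_curve A xi (s + t) = (exp_curve A xi s * exp_curve A xi t)%g &
      tangent_map (vmanifold R^o) A (exp_curve A xi) 0 1 = xi].
Proof.
have [c [cM [K [e [K0 egt0 cE]]]]] := local_one_parameter xi.
apply: (@xgetPex _ (fun=> 1%g) [set c : R -> G |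
    [/\ smooth_map (vmanifold R^o) A c,
        forall s t, c (s + t) = (c s * c t)%g &
        tangent_map (vmanifold R^o) A c 0 1 = xi]]).
have pc := hom_plot cM K0 egt0 cE.
have sc : smooth_map (vmanifold R^o) A c.
  apply/smooth_mapP => p; rewrite -[_ \o _]/(c : R^o -> G).
  by apply: plot_sub pc => //; exact: chart_image_open.
exists c; split=> //.
by rewrite (tangent_mapE _ _ sc) -[RHS](hom_velocity cM K0 egt0 cE).
Qed.

Lemma ad_bracket (xi eta : g_) : ad A xi eta = bracket A xi eta.
Proof.
have [sc cM tc] := exp_curveP xi; rewrite (tangent_mapE _ _ sc) in tc.
set c := exp_curve A xi in sc cM tc.
have c0 : c 0 = 1%g by apply: (mulgI (c 0)); rewrite -cM addr0 mulg1.
have pc : plot A (chart_image (vmanifold R^o) 0) (c : R^o -> G) := smooth_map_plot (p := 0) sc.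
have i0 : chart_image (vmanifold R^o) 0 0 by exists 0.
have := derive_Ad hG (1 : R^o) eta findim_R pc i0; rewrite c0 (Ad1 hG) => e1.
apply: (eq_trans e1); congr (bracket A _ eta); rewrite -tc -velocity_at1 //.
Qed.

End exponential.

(** * The coadjoint action *)

Section pairing_theory.
Context {R : realType} {n : nat}.
Local Notation g_ := 'rV[R]_n.
Local Notation g_dual := 'cV[R]_n.

Lemma linD (E F : normedModType R) (f : E -> F) : linear f -> forall u v, f (u + v) = f u + f v.
Proof. by move=> /lin_pack [L ->] u v; exact: linearD. Qed.

Lemma lin0 (E F : normedModType R) (f : E -> F) : linear f -> f 0 = 0.
Proof. by move=> /lin_pack [L ->]; exact: linear0. Qed.

Lemma linN (E F : normedModType R) (f : E -> F) : linear f -> forall u, f (- u) = - f u.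
Proof. by move=> /lin_pack [L ->] u; exact: linearN. Qed.

Lemma pairing_linr (mu : g_dual) : linear (pairing mu : g_ -> R^o).
Proof. by move=> a u v; rewrite /pairing mulmxDl -scalemxAl !mxE. Qed.

Lemma pairing_linl (xi : g_) : linear (fun mu : g_dual => pairing mu xi : R^o).
Proof. by move=> a u v; rewrite /pairing mulmxDr -scalemxAr !mxE. Qed.

Lemma pairing_bilin : bilin (fun (mu : g_dual) (xi : g_) => pairing mu xi : R^o).
Proof. by apply: findim_bilin; [exact: pairing_linr|exact: pairing_linl]. Qed.

Lemma pairingDr (mu : g_dual) u v : pairing mu (u + v) = pairing mu u + pairing mu v.
Proof. exact: linD (pairing_linr mu) u v. Qed.
Lemma pairingNr (mu : g_dual) u : pairing mu (- u) = - pairing mu u.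
Proof. exact: linN (pairing_linr mu) u. Qed.
Lemma pairingDl (xi : g_) mu nu : pairing (mu + nu) xi = pairing mu xi + pairing nu xi.
Proof. exact: linD (pairing_linl xi) mu nu. Qed.
Lemma pairingNl (xi : g_) mu : pairing (- mu) xi = - pairing mu xi.
Proof. exact: linN (pairing_linl xi) mu. Qed.
Lemma pairing0r (mu : g_dual) : pairing mu 0 = 0.
Proof. exact: lin0 (pairing_linr mu). Qed.

Lemma pairing_ext (mu nu : g_dual) : (forall xi, pairing mu xi = pairing nu xi) -> mu = nu.
Proof.
move=> h; apply/colP => i; have := h (delta_mx 0 i).
by rewrite /pairing -!rowE !mxE.
Qed.

Lemma covectorE (l : g_ -> R^o) xi : linear l -> pairing (covector l) xi = l xi.
Proof. by move=> /lin_pack [L ->]; exact: pairing_covector. Qed.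

End pairing_theory.

(* The coadjoint algebra is developed from these identities alone: with the
   concrete operations, conversion would unfold distinct expressions down to
   limits of difference quotients. *)
Record adjoint_theory (R : realType) (n : nat) (G : groupType)
    (Ad : G -> 'rV[R]_n -> 'rV[R]_n) (ad : 'rV[R]_n -> 'rV[R]_n -> 'rV[R]_n)
    (Ad_star : G -> 'cV[R]_n -> 'cV[R]_n) (ad_star : 'rV[R]_n -> 'cV[R]_n -> 'cV[R]_n) : Prop :=
  AdjointTheory {
    Ad_linear_ : forall g, linear (Ad g);
    Ad1_ : forall v, Ad 1%g v = v;
    AdM_ : forall g h v, Ad (g * h)%g v = Ad g (Ad h v);
    ad_linl_ : forall eta, linear (ad^~ eta);
    ad_linr_ : forall xi, linear (ad xi);
    ad_C_ : forall u v, ad u v = - ad v u;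
    Ad_ad_ : forall g xi eta, Ad g (ad xi eta) = ad (Ad g xi) (Ad g eta);
    ad_jacobi_ : forall a xi eta, ad a (ad xi eta) = ad (ad a xi) eta + ad xi (ad a eta);
    pairing_Ad_star_ : forall g mu xi, pairing (Ad_star g mu) xi = pairing mu (Ad (g^-1)%g xi);
    pairing_ad_star_ : forall x mu xi, pairing (ad_star x mu) xi = - pairing mu (ad x xi) }.

Section adjoint_concrete.
Context {R : realType} {n : nat} {G : groupType} (A : manifold 'rV[R]_n G).
Context (hG : lie_group A).
Local Notation g_ := 'rV[R]_n.
Local Notation g_dual := 'cV[R]_n.
Local Notation ad := (ad A).
Local Notation Ad := (Ad A).
Local Notation ad_star := (ad_star A).
Local Notation Ad_star := (Ad_star A).

Lemma adE : ad = bracket A.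
Proof. by apply/funext => xi; apply/funext => eta; exact: ad_bracket. Qed.

Lemma ad_bilin : bilin ad.
Proof. by rewrite adE; exact: bracket_bilin. Qed.

Lemma ad_linl eta : linear (ad^~ eta).
Proof. by case: ad_bilin. Qed.

Lemma ad_linr xi : linear (ad xi).
Proof. by case: ad_bilin. Qed.

Lemma ad_C u v : ad u v = - ad v u.
Proof. by rewrite adE; exact: bracketC. Qed.

Lemma Ad_ad g xi eta : Ad g (ad xi eta) = ad (Ad g xi) (Ad g eta).
Proof. by rewrite adE; exact: Ad_bracket. Qed.

Lemma ad_jacobi a xi eta : ad a (ad xi eta) = ad (ad a xi) eta + ad xi (ad a eta).
Proof. by rewrite adE; exact: jacobi. Qed.

Lemma pairing_Ad_star g mu xi : pairing (Ad_star g mu) xi = pairing mu (Ad (g^-1)%g xi).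
Proof.
rewrite /Ad_star covectorE // => a u v.
by rewrite (Ad_linear A (g^-1)%g a u v) pairing_linr.
Qed.

Lemma pairing_ad_star x mu xi : pairing (ad_star x mu) xi = - pairing mu (ad x xi).
Proof.
rewrite /ad_star covectorE // => a u v.
by rewrite (ad_linr x a u v) pairing_linr opprD scalerN.
Qed.

Lemma lie_group_adjoint_theory : adjoint_theory Ad ad Ad_star ad_star.
Proof.
split.
- exact: Ad_linear.
- exact: Ad1.
- exact: AdM.
- exact: ad_linl.
- exact: ad_linr.
- exact: ad_C.
- exact: Ad_ad.
- exact: ad_jacobi.
- exact: pairing_Ad_star.
- exact: pairing_ad_star.
Qed.

End adjoint_concrete.

Section coadjoint_algebra.
Context {R : realType} {n : nat} {G : groupType}.
Local Notation g_ := 'rV[R]_n.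
Local Notation g_dual := 'cV[R]_n.
Context (Ad : G -> g_ -> g_) (ad : g_ -> g_ -> g_).
Context (Ad_star : G -> g_dual -> g_dual) (ad_star : g_ -> g_dual -> g_dual).
Context (T : adjoint_theory Ad ad Ad_star ad_star).

Let Ad_linear := Ad_linear_ T.
Let Ad1 := Ad1_ T.
Let AdM := AdM_ T.
Let ad_linl := ad_linl_ T.
Let ad_linr := ad_linr_ T.
Let ad_C := ad_C_ T.
Let Ad_ad := Ad_ad_ T.
Let ad_jacobi := ad_jacobi_ T.
Let pairing_Ad_star := pairing_Ad_star_ T.
Let pairing_ad_star := pairing_ad_star_ T.

Lemma adDr x u v : ad x (u + v) = ad x u + ad x v. Proof. exact: linD (ad_linr x) u v. Qed.
Lemma adDl x u v : ad (u + v) x = ad u x + ad v x. Proof. exact: linD (ad_linl x) u v. Qed.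
Lemma adNl x u : ad (- u) x = - ad u x. Proof. exact: linN (ad_linl x) u. Qed.

Lemma Ad_starM g h mu : Ad_star (g * h)%g mu = Ad_star g (Ad_star h mu).
Proof. by apply: pairing_ext => xi; rewrite !pairing_Ad_star invgM AdM. Qed.

Lemma Ad_star1 mu : Ad_star 1%g mu = mu.
Proof. by apply: pairing_ext => xi; rewrite !pairing_Ad_star invg1 Ad1. Qed.

Lemma Ad_star_lin g : linear (Ad_star g).
Proof.
move=> a u v; apply: pairing_ext => xi.
by rewrite pairing_linl !pairing_Ad_star pairing_linl.
Qed.

Lemma ad_star_linr x : linear (ad_star x).
Proof.
move=> a u v; apply: pairing_ext => xi.
by rewrite pairing_linl !pairing_ad_star pairing_linl opprD scalerN.
Qed.

Lemma ad_star_linl mu : linear (ad_star^~ mu).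
Proof.
move=> a u v; apply: pairing_ext => xi.
by rewrite pairing_linl !pairing_ad_star ad_linl pairing_linr opprD scalerN.
Qed.

Lemma ad_star_bilin : bilin ad_star.
Proof. by apply: findim_bilin; [exact: ad_star_linr|exact: ad_star_linl]. Qed.

Lemma ad_starDr x mu nu : ad_star x (mu + nu) = ad_star x mu + ad_star x nu.
Proof. exact: linD (ad_star_linr x) mu nu. Qed.
Lemma ad_starDl x y mu : ad_star (x + y) mu = ad_star x mu + ad_star y mu.
Proof. exact: linD (ad_star_linl mu) x y. Qed.

Lemma Ad_star_ad g x mu : Ad_star g (ad_star x mu) = ad_star (Ad g x) (Ad_star g mu).
Proof.
apply: pairing_ext => xi; rewrite pairing_Ad_star !pairing_ad_star pairing_Ad_star Ad_ad.
by rewrite -AdM mulVg Ad1.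
Qed.

Lemma ad_star_ad a b mu :
  ad_star (ad a b) mu = ad_star a (ad_star b mu) - ad_star b (ad_star a mu).
Proof.
apply: pairing_ext => xi; rewrite pairingDl pairingNl !pairing_ad_star !opprK.
by rewrite [ad a (ad b xi)]ad_jacobi pairingDr opprD addrC -addrA addNr addr0.
Qed.

(** Copies of the concrete definitions over the abstract operations, convertible to them once the
    operations are instantiated. *)
Let coad (k : G * g_) (m : g_dual * g_dual) : g_dual * g_dual :=
  (Ad_star k.1 m.1 + ad_star k.2 (Ad_star k.1 m.2), Ad_star k.1 m.2).
Let orbit_vector (m : g_dual * g_dual) (v : g_ * g_) : g_dual * g_dual :=
  (ad_star v.1 m.1 + ad_star v.2 m.2, ad_star v.1 m.2).
Let TG_mul (k l : G * g_) : G * g_ := ((k.1 * l.1)%g, k.2 + Ad k.1 l.2).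

Let TG_inv (k : G * g_) : G * g_ := ((k.1^-1)%g, - Ad (k.1^-1)%g k.2).

Lemma AdDr g u v : Ad g (u + v) = Ad g u + Ad g v.
Proof. exact: linD (Ad_linear g) u v. Qed.

Lemma AdNr g u : Ad g (- u) = - Ad g u.
Proof. exact: linN (Ad_linear g) u. Qed.

Lemma TG_mulA k l q : TG_mul k (TG_mul l q) = TG_mul (TG_mul k l) q.
Proof. by rewrite /TG_mul /= mulgA AdDr AdM addrA. Qed.

Lemma TG_mul1 k : TG_mul k (1%g, 0) = k.
Proof. by case: k => g x; rewrite /TG_mul /= mulg1 (lin0 (Ad_linear g)) addr0. Qed.

Lemma TG_1mul k : TG_mul (1%g, 0) k = k.
Proof. by case: k => g x; rewrite /TG_mul /= mul1g Ad1 add0r. Qed.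

Lemma TG_mulV k : TG_mul k (TG_inv k) = (1%g, 0).
Proof. by rewrite /TG_mul /TG_inv /= mulgV AdNr -AdM mulgV Ad1 subrr. Qed.

Lemma TG_Vmul k : TG_mul (TG_inv k) k = (1%g, 0).
Proof. by rewrite /TG_mul /TG_inv /= mulVg addNr. Qed.

Lemma coadM k l m : coad (TG_mul k l) m = coad k (coad l m).
Proof.
rewrite /coad /TG_mul /=; congr pair; last exact: Ad_starM.
rewrite (linD (Ad_star_lin k.1)) Ad_star_ad !Ad_starM ad_starDl -addrA; congr (_ + _).
by rewrite addrC.
Qed.

Lemma coad1 m : coad (1%g, 0) m = m.
Proof.
case: m => mu nu; rewrite /coad /= !Ad_star1 (lin0 (ad_star_linl nu)) addr0.
by [].
Qed.

Lemma coadK k m : coad (TG_inv k) (coad k m) = m.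
Proof. by rewrite -coadM TG_Vmul coad1. Qed.

Lemma coad_lin k : linear (coad k).
Proof.
move=> a u v; rewrite /coad; apply/pair_eqP; rewrite /pair_eq /=; apply/andP; split; apply/eqP.
  by rewrite !Ad_star_lin ad_star_linr scalerDr addrACA.
exact: Ad_star_lin.
Qed.

(** The pair on the right is the adjoint action of [k] on the Lie algebra of the semidirect
    product. *)
Lemma coad_orbit_vector k m v : coad k (orbit_vector m v) =
  orbit_vector (coad k m) (Ad k.1 v.1, Ad k.1 v.2 + ad k.2 (Ad k.1 v.1)).
Proof.
rewrite /coad /orbit_vector /=; congr pair; last exact: Ad_star_ad.
rewrite (linD (Ad_star_lin k.1)) !Ad_star_ad ad_starDr ad_starDl ad_star_ad.
have aux (a z x y : g_dual) : a + z + x = a + y + (z + (x - y)).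
  by apply/colP => i; rewrite !mxE; ring.
exact: aux.
Qed.

Lemma orbit_vector_lin m : linear (orbit_vector m).
Proof.
move=> a u v; apply/pair_eqP; rewrite /pair_eq /=; apply/andP; split; apply/eqP.
  by rewrite /orbit_vector /= !ad_star_linl scalerDr addrACA.
exact: ad_star_linl.
Qed.

Let orbit_form (m : g_dual * g_dual) (u v : g_ * g_) : R :=
  pairing m.1 (ad v.1 u.1) + pairing m.2 (ad v.1 u.2 - ad u.1 v.2).

(** The form therefore depends on [u] only through its tangent vector, and with antisymmetry on [v]
    likewise; nondegeneracy also rests on this. *)
Lemma orbit_form_pairing m u v :
  orbit_form m u v = pairing (orbit_vector m u).1 v.1 + pairing (orbit_vector m u).2 v.2.
Proof.
rewrite /orbit_form /orbit_vector /= !pairingDl !pairing_ad_star pairingDr pairingNr.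
by rewrite [ad v.1 u.1]ad_C [ad v.1 u.2]ad_C !pairingNr addrA.
Qed.

Lemma orbit_formC m u v : orbit_form m u v = - orbit_form m v u.
Proof.
rewrite /orbit_form !pairingDr !pairingNr [ad v.1 u.1]ad_C pairingNr.
by rewrite opprD opprB; congr (_ + _); rewrite addrC.
Qed.

Lemma ad_AdN g a b : ad (- Ad g a) (Ad g b) = - Ad g (ad a b).
Proof. by rewrite adNl Ad_ad. Qed.

(** The left side is what the Leibniz rule yields for [coad] along a curve in TG: [a] is the
    logarithmic derivative of its group part, [x'] the derivative of its Lie algebra part [x]. *)
Lemma coad_tangent (a x x' : g_) (mu nu : g_dual) :
  (ad_star a mu + (ad_star x (ad_star a nu) + ad_star x' nu), ad_star a nu) =
  orbit_vector (mu + ad_star x nu, nu) (a, x' + ad x a).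
Proof.
rewrite /orbit_vector /=; congr pair.
rewrite ad_starDr ad_starDl ad_star_ad.
have aux (m z s t : g_dual) : m + (s + z) = m + t + (z + (s - t)).
  by apply/colP => i; rewrite !mxE; ring.
exact: aux.
Qed.

End coadjoint_algebra.

(** * Derivatives of the coadjoint action along plots *)

Section coadjoint_plots.
Context {R : realType} {n : nat} {G : groupType} (A : manifold 'rV[R]_n G).
Context (hG : lie_group A).
Local Notation g_ := 'rV[R]_n.
Local Notation g_dual := 'cV[R]_n.
Let T := lie_group_adjoint_theory hG.

Lemma derive_diag (E F : normedModType R) (f : E * E -> F) y v :
  differentiable f (y, y) ->
  'D_v (fun z => f (z, z)) y = 'D_v (fun z => f (z, y)) y + 'D_v (fun z => f (y, z)) y.
Proof.
move=> df; have did : differentiable (id : E -> E) y.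
  by apply: (@linear_differentiable _ _ _ (idfun : {linear E -> E})) => ?; exact: cvg_id.
have dd : differentiable (fun z : E => (z, z)) y by exact: (differentiable_pair did did).
have Dd : 'D_v (fun z : E => (z, z)) y = (v, 0) + (0, v).
  rewrite deriveE // (diff_pair did did) /= -deriveE // derive_id.
  by apply/pair_eqP; rewrite /pair_eq /= add0r addr0 !eqxx.
have e := derive_comp v dd df; rewrite Dd in e; apply: (eq_trans e).
apply: (eq_trans (deriveDv (v, 0) (0, v) df)).
exact: (congr2 +%R (derive_fstv f y y v) (derive_sndv f y y v)).
Qed.

Section plot.
Context (E : normedModType R) {fE : findim E} (U : set E).

(** The quotient of [g * h] by its value at [y] is the restriction of [P] to the diagonal, and the
    derivative is the sum of the two partial ones. *)
Lemma logd_mul (g h : E -> G) y v : plot A U g -> plot A U h -> U y ->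
  logd A (fun z => (g z * h z)%g) y v = logd A g y v + Ad A (g y) (logd A h y v).
Proof.
move=> pg ph Uy; have oU := plot_open pg.
pose k z := (h z * (h y)^-1)%g.
have pk : plot A U k by apply: (plot_mul hG) => //; exact: plot_const.
have ky : k y = 1%g by rewrite /k mulgV.
pose P (x : E * E) := (g x.1 * k x.2 * (g y)^-1)%g.
have pP : plot A (U `*` U) P.
  apply: (plot_mul hG); first apply: (plot_mul hG).
  - exact: plot_fst.
  - exact: (plot_snd (g := k)).
  - by apply: plot_const; exact: openX_set.
have [oD sD] := plot_chart 1%g pP; set D := _ `&` _ in oD sD.
have Dy : D (y, y).
  by split=> //; rewrite /= /P /= ky mulg1 mulgV; exact: chart_domP.
have e := derive_diag v (smooth_on_differentiable sD Dy).
have e1 : 'D_v (fun z => (chart A 1%g \o P) (z, y)) y = logd A g y v.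
  by apply: eq_derive => z; rewrite /= /P /= ky mulg1.
have e2 : 'D_v (fun z => (chart A 1%g \o P) (y, z)) y = Ad A (g y) (logd A h y v).
  apply: (eq_trans (Ad_velocity hG (g y) v pk Uy ky)).
  by congr (Ad A (g y) _); exact: logd_mulr.
rewrite e1 e2 in e; apply: (eq_trans _ e).
by apply: eq_derive => z; rewrite /= /P /k /= invgM !mulgA.
Qed.

(** Differentiate the constant product of [g^-1] and [g]. *)
Lemma logd_inv (g : E -> G) y v : plot A U g -> U y ->
  logd A (fun z => (g z)^-1%g) y v = - Ad A (g y)^-1%g (logd A g y v).
Proof.
move=> pg Uy; have e := logd_mul v (plot_invg hG pg) pg Uy.
have e0 : logd A (fun z => ((g z)^-1 * g z)%g) y v = 0.
  apply: (eq_trans _ (derive_cst (chart A 1%g 1%g) y v)).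
  by apply: eq_derive => z; rewrite !mulVg invg1 mulg1.
by apply/eqP; rewrite -addr_eq0; apply/eqP; rewrite -e.
Qed.

Lemma logd_const (k : G) y v : logd A (fun _ : E => k) y v = 0.
Proof. exact: derive_cst. Qed.

Lemma derive_Ad_inv (g : E -> G) y v zeta : plot A U g -> U y ->
  'D_v (fun z => Ad A (g z)^-1%g zeta) y = - Ad A (g y)^-1%g (ad A (logd A g y v) zeta).
Proof.
move=> pg Uy; apply: (eq_trans (derive_Ad hG v zeta fE (plot_invg hG pg) Uy)).
rewrite -(adE hG) (logd_inv v pg Uy); exact: (ad_AdN T).
Qed.

Lemma Ad_inv_smooth (g : E -> G) zeta : plot A U g ->
  smooth_on U (fun z => Ad A (g z)^-1%g zeta).
Proof. by move=> pg; apply: (Ad_smooth hG zeta (plot_invg hG pg)). Qed.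

Lemma Ad_star_smooth (g : E -> G) mu : plot A U g ->
  smooth_on U (fun z => Ad_star A (g z) mu).
Proof.
move=> pg; have oU := plot_open pg.
apply/smooth_onP => k; apply: Ck_mx => // i j.
apply: (@Ck_ext _ _ _ _ _ (fun z => pairing mu (Ad A (g z)^-1%g (delta_mx 0 i)) : R^o)) => //.
  by move=> z _; rewrite /Ad_star /covector mxE.
have [L eL] := lin_pack (pairing_linr mu); rewrite eL.
apply: (@Ck_lin_comp _ _ _ _ _ _ L) => //; first exact: findim_lin_cont.
exact: (smooth_onP _ _).1 (Ad_inv_smooth _ pg) k.
Qed.

Lemma derive_Ad_star (g : E -> G) mu y v : plot A U g -> U y ->
  'D_v (fun z => Ad_star A (g z) mu) y = ad_star A (logd A g y v) (Ad_star A (g y) mu).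
Proof.
move=> pg Uy; apply: pairing_ext => zeta.
have [L eL] := lin_pack (pairing_linl (n := n) zeta).
have cL : continuous L by exact: findim_lin_cont.
have [L' eL'] := lin_pack (pairing_linr mu).
have cL' : continuous L' by exact: findim_lin_cont.
have d1 := smooth_on_differentiable (Ad_star_smooth mu pg) Uy.
have d2 := smooth_on_differentiable (Ad_inv_smooth zeta pg) Uy.
have e1 := derive_lin_comp v cL d1; rewrite -eL in e1.
have e2 := derive_lin_comp v cL' d2; rewrite -eL' (derive_Ad_inv v zeta pg Uy) pairingNr in e2.
apply: (eq_trans (esym e1)).
have -> : (fun z => pairing (Ad_star A (g z) mu) zeta : R^o) =
          (fun z => pairing mu (Ad A (g z)^-1%g zeta)).
  by apply/funext => z; exact: (pairing_Ad_star_ T).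
apply: (eq_trans e2); apply: esym.
apply: (eq_trans (pairing_ad_star_ T _ _ _)); congr (- _).
exact: (pairing_Ad_star_ T).
Qed.

Lemma plot_TG (k : E -> G * g_) : plot (TG A) U k <->
  plot A U (fun z => (k z).1) /\ smooth_on U (fun z => (k z).2).
Proof.
split=> [pk|[p1 s2]].
  split; first exact: (plot_comp (f := fst) (smooth_map_fst A (vmanifold g_)) pk).
  have p2 : plot (vmanifold g_) U (snd \o k) by apply: plot_comp pk; exact: smooth_map_snd.
  by have [_] := proj1 (plot_vmanifold _ _) p2.
have oU := plot_open p1.
have := plot_pair p1 (proj2 (plot_vmanifold _ _) (conj oU s2)).
by apply: plot_ext => z _; rewrite -surjective_pairing.
Qed.

(* The right logarithmic derivative of a plot of TG. *)
Definition TG_logd (k : E -> G * g_) (y v : E) : g_ * g_ :=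
  (logd A (fun z => (k z).1) y v,
   'D_v (fun z => (k z).2) y + ad A (k y).2 (logd A (fun z => (k z).1) y v)).

Lemma coad_smooth (k : E -> G * g_) m : plot (TG A) U k ->
  smooth_on U (fun z => coad A (k z) m).
Proof.
move=> /plot_TG [p1 s2]; have oU := plot_open p1.
apply: smooth_on_pair => //; last exact: Ad_star_smooth.
apply: smooth_on_add => //; first exact: Ad_star_smooth.
by apply: (smooth_on_bilin (ad_star_bilin T)) => //; exact: Ad_star_smooth.
Qed.

Lemma derive_coad (k : E -> G * g_) m y v : plot (TG A) U k -> U y ->
  'D_v (fun z => coad A (k z) m) y = orbit_vector A (coad A (k y) m) (TG_logd k y v).
Proof.
move=> /plot_TG [p1 s2] Uy; have oU := plot_open p1.
set g := fun z => (k z).1 in p1; set x := fun z => (k z).2 in s2.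
have d1 mu := smooth_on_differentiable (Ad_star_smooth mu p1) Uy.
have dx := smooth_on_differentiable s2 Uy.
have [db eb] := derive_bilin v (ad_star_bilin T) dx (d1 m.2).
have dsum := differentiableD (d1 m.1) db.
have esum := deriveD (diff_derivable (v := v) (d1 m.1)) (diff_derivable (v := v) db).
have ep : 'D_v (fun z => coad A (k z) m) y =
    ('D_v (fun z => Ad_star A (g z) m.1 + ad_star A (x z) (Ad_star A (g z) m.2)) y,
     'D_v (fun z => Ad_star A (g z) m.2) y).
  rewrite [LHS]deriveE; last exact: (differentiable_pair dsum (d1 m.2)).
  apply: (eq_trans (congr1 (fun f => f v) (diff_pair dsum (d1 m.2)))) => /=.
  by congr pair; rewrite -deriveE //; exact: d1.
apply: (eq_trans ep); rewrite (derive_Ad_star m.2 v p1 Uy).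
have -> : 'D_v (fun z => Ad_star A (g z) m.1 + ad_star A (x z) (Ad_star A (g z) m.2)) y =
  ad_star A (logd A g y v) (Ad_star A (g y) m.1) +
  (ad_star A (x y) (ad_star A (logd A g y v) (Ad_star A (g y) m.2)) +
   ad_star A ('D_v x y) (Ad_star A (g y) m.2)).
  apply: (eq_trans esum); congr (_ + _); first exact: derive_Ad_star.
  by apply: (eq_trans eb); congr (_ + _); congr (ad_star A _ _); exact: derive_Ad_star.
exact: (coad_tangent T).
Qed.

End plot.

End coadjoint_plots.

(** * The cotangent bundle of TG *)

Section momentum_algebra.
Context {R : realType} {n : nat} {G : groupType}.
Local Notation g_ := 'rV[R]_n.
Local Notation g_dual := 'cV[R]_n.
Context (Ad : G -> g_ -> g_) (ad : g_ -> g_ -> g_).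
Context (Ad_star : G -> g_dual -> g_dual) (ad_star : g_ -> g_dual -> g_dual).
Context (T : adjoint_theory Ad ad Ad_star ad_star).

Lemma pairing_AdV g mu xi : pairing mu (Ad g xi) = pairing (Ad_star g^-1%g mu) xi.
Proof. by rewrite (pairing_Ad_star_ T) invgK. Qed.

Lemma momentum_coad g xi mu nu (m : g_dual * g_dual) :
  (Ad_star g^-1%g (mu - ad_star xi nu), Ad_star g^-1%g nu) = m <->
  (mu, nu) = (Ad_star g m.1 + ad_star xi (Ad_star g m.2), Ad_star g m.2).
Proof.
have K x : Ad_star g (Ad_star g^-1%g x) = x by rewrite -(Ad_starM T) mulgV (Ad_star1 T).
have K' x : Ad_star g^-1%g (Ad_star g x) = x by rewrite -(Ad_starM T) mulVg (Ad_star1 T).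
split=> [<-|[-> ->]] /=; first by rewrite !K subrK.
by rewrite addrK !K' -surjective_pairing.
Qed.

(** The left side is the differential of the Liouville form at [(M, N)]: [au], [av] are the
    right-trivialized group components of two tangent vectors, [du], [dv] their Lie algebra
    components, and [Mu], [Mv], [Nu], [Nv] their fibre components. When the latter are orbit
    vectors, the terms in [xi] recombine by the Jacobi identity. *)
Lemma liouville_differential_orbit (M N : g_dual) (xi au av du dv : g_) Mu Mv Nu Nv :
  Mu = ad_star au M + ad_star (du + ad xi au) N -> Nu = ad_star au N ->
  Mv = ad_star av M + ad_star (dv + ad xi av) N -> Nv = ad_star av N ->
  pairing (Mu - ad_star du N - ad_star xi Nu) av - pairing (Mv - ad_star dv N - ad_star xi Nv) au
  + pairing (M - ad_star xi N) (ad au av) + pairing Nu dv - pairing Nv du =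
  pairing M (ad av au) + pairing N (ad av (du + ad xi au) - ad au (dv + ad xi av)).
Proof.
move=> -> -> -> ->; rewrite !(pairingDl, pairingNl, pairing_ad_star_ T).
rewrite !(adDr T) !(adDl T) !(pairingDr, pairingNr) (ad_jacobi_ T xi au av) !(pairingDr, pairingNr).
rewrite (ad_C_ T (ad xi av) au) (ad_C_ T av au) !(pairingDr, pairingNr).
ring.
Qed.

End momentum_algebra.

Section cotangent_bundle.
Context {R : realType} {n : nat} {G : groupType} (A : manifold 'rV[R]_n G).
Context (hG : lie_group A).
Local Notation g_ := 'rV[R]_n.
Local Notation g_dual := 'cV[R]_n.
Local Notation TTG_carrier := (G * g_ * (g_dual * g_dual))%type.
Local Notation TTG_model := (g_ * g_ * (g_dual * g_dual))%type.
Let T := lie_group_adjoint_theory hG.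

Lemma TR_linear g h : linear (TR A g h).
Proof. by move=> a u v; exact: linearP. Qed.

Lemma TRK g w : TR A g 1%g (TR A g^-1%g g w) = w.
Proof.
have e : _ = TR A g (g * g^-1)%g (TR A g^-1%g g w) :=
  tangent_map_comp g w (smooth_map_mulr hG g^-1%g) (smooth_map_mulr hG g).
have ei : (fun x => (x * g)%g) \o (fun x => (x * g^-1)%g) = id.
  by apply/funext => x /=; rewrite mulgVK.
rewrite ei tangent_map_id in e; rewrite mulgV in e; exact: (esym (e _ _ _)).
Qed.

Lemma TRV g w : TR A g^-1%g g (TR A g 1%g w) = w.
Proof.
have e : _ = TR A g^-1%g (1 * g)%g (TR A g 1%g w) :=
  tangent_map_comp 1%g w (smooth_map_mulr hG g) (smooth_map_mulr hG g^-1%g).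
have ei : (fun x => (x * g^-1)%g) \o (fun x => (x * g)%g) = id.
  by apply/funext => x /=; rewrite mulgK.
rewrite ei tangent_map_id in e; rewrite mul1g in e; exact: (esym (e _ _ _)).
Qed.

Lemma pairing_comp_linear (mu : g_dual) (f : g_ -> g_) : linear f -> linear (fun v => pairing mu (f v) : R^o).
Proof. by move=> lf a u v; rewrite (lf a u v) pairing_linr. Qed.

(** An explicit preimage, obtained by removing the [ad_star] term and translating back, rules out
    the default value of [cotriv_inv]. *)
Lemma cotriv_invP k m : cotriv A k (cotriv_inv A k m) = m.
Proof.
rewrite /cotriv_inv; case: xgetP => [_ -> //|] /(_ (covector (fun w =>
  pairing (m.1 - ad_star A k.2 m.2) (TR A k.1^-1%g k.1 w)), m.2)) [].
rewrite /cotriv /=; case: m => [mu nu] /=; congr pair.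
rewrite -[RHS](subrK (ad_star A k.2 nu)); congr (_ + _); apply: pairing_ext => xi.
rewrite covectorE; last by apply: pairing_comp_linear; exact: TR_linear.
rewrite covectorE; last by apply: pairing_comp_linear; exact: TR_linear.
by rewrite TRV.
Qed.

Lemma cotriv_inv2 k m : (cotriv_inv A k m).2 = m.2.
Proof. by rewrite -[in RHS](cotriv_invP k m). Qed.

(** Whatever preimage was chosen, its pairings are determined, so the choice is harmless. *)
Lemma cotriv_inv1 k m w : pairing (cotriv_inv A k m).1 w =
  pairing (m.1 - ad_star A k.2 m.2) (TR A k.1^-1%g k.1 w).
Proof.
have e := congr1 fst (cotriv_invP k m); rewrite /cotriv /= cotriv_inv2 in e.
rewrite -e addrK covectorE; first by rewrite TRK.
by apply: pairing_comp_linear; exact: TR_linear.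
Qed.

Lemma liouvilleE (p : TTG_carrier) (v : TTG_model) : liouville A p v =
  pairing (p.2.1 - ad_star A p.1.2 p.2.2) (TR A p.1.1^-1%g p.1.1 v.1.1) + pairing p.2.2 v.1.2.
Proof.
rewrite /liouville.
have -> : tangent_map (TTG A) (TG A) fst p v = v.1 by exact: tangent_map_fst.
by rewrite /TG_pairing cotriv_inv1 cotriv_inv2.
Qed.

Section plot.
Context (E : normedModType R) {fE : findim E} (U : set E).

Lemma velocity_TG (k : E -> G * g_) y v : plot (TG A) U k -> U y ->
  velocity (TG A) k y v = (velocity A (fun z => (k z).1) y v, 'D_v (fun z => (k z).2) y).
Proof.
move=> /plot_TG [p1 s2] Uy; have oU := plot_open p1.
have p2 := proj2 (plot_vmanifold _ _) (conj oU s2).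
have e : velocity (TG A) (fun z => ((k z).1, (k z).2)) y v =
    (velocity A (fun z => (k z).1) y v, velocity (vmanifold _) (fun z => (k z).2) y v).
  exact: velocity_pair p1 p2 Uy.
apply: (eq_trans _ e); congr (velocity (TG A) _ y v).
by apply/funext => z; rewrite -surjective_pairing.
Qed.

Lemma plot_TTG (P : E -> TTG_carrier) : plot (TTG A) U P <->
  plot (TG A) U (fun z => (P z).1) /\ smooth_on U (fun z => (P z).2).
Proof.
split=> [pP|[p1 s2]].
  split; first exact: (plot_comp (f := fst) (smooth_map_fst (TG A) (vmanifold _)) pP).
  have p2 : plot (vmanifold _) U (snd \o P) by apply: plot_comp pP; exact: smooth_map_snd.
  by have [_] := proj1 (plot_vmanifold _ _) p2.
have oU := plot_open p1.
have := plot_pair p1 (proj2 (plot_vmanifold _ _) (conj oU s2)).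
by apply: plot_ext => z _; rewrite -surjective_pairing.
Qed.

Lemma velocity_TTG (P : E -> TTG_carrier) y v : plot (TTG A) U P -> U y ->
  velocity (TTG A) P y v = ((velocity A (fun z => (P z).1.1) y v,
    'D_v (fun z => (P z).1.2) y), 'D_v (fun z => (P z).2) y).
Proof.
move=> /plot_TTG [p1 s3] Uy; have oU := plot_open p1.
have p3 := proj2 (plot_vmanifold _ _) (conj oU s3).
have e : velocity (TTG A) (fun z => ((P z).1, (P z).2)) y v =
    (velocity (TG A) (fun z => (P z).1) y v, velocity (vmanifold _) (fun z => (P z).2) y v).
  exact: velocity_pair p1 p3 Uy.
rewrite (velocity_TG v p1 Uy) in e; apply: (eq_trans _ e); congr (velocity (TTG A) _ y v).
by apply/funext => z; rewrite -surjective_pairing.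
Qed.

(** The Liouville form on the velocity of [P] in a fixed direction, right-trivialized so that no
    varying chart appears and it can be differentiated in [y]. *)
Definition liouville_plot (P : E -> TTG_carrier) (v y : E) : R^o :=
  pairing ((P y).2.1 - ad_star A (P y).1.2 (P y).2.2) (logd A (fun z => (P z).1.1) y v)
  + pairing (P y).2.2 ('D_v (fun z => (P z).1.2) y).

Lemma liouville_velocity (P : E -> TTG_carrier) y v : plot (TTG A) U P -> U y ->
  liouville A (P y) (velocity (TTG A) P y v) = liouville_plot P v y.
Proof.
move=> pP Uy; rewrite liouvilleE (velocity_TTG v pP Uy) /liouville_plot.
congr (pairing _ _ + _); apply: esym; apply: (logd_TR hG (U := U)) => //.
by move: pP => /plot_TTG [/plot_TG []].
Qed.

End plot.

Section generator.

Lemma plot_TG_mull (p : TTG_carrier) (E : normedModType R) (U : set E)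
  (k : E -> G * g_) : plot (TG A) U k -> plot (TTG A) U (TTG_act A p \o k).
Proof.
move=> /plot_TG [p1 s2]; have oU := plot_open p1.
apply/plot_TTG; split; last exact: smooth_on_cst.
apply/plot_TG; split; first by apply: (plot_mul hG) => //; exact: plot_const.
apply: smooth_on_add => //; first exact: smooth_on_cst.
apply: (smooth_on_comp (B := setT)) => //; first exact: openT.
by apply: smooth_on_lin => //; exact: Ad_linear.
Qed.

Lemma smooth_map_TTG_act p : smooth_map (TG A) (TTG A) (TTG_act A p).
Proof.
apply/smooth_mapP => k; apply: plot_TG_mull; exact: plot_chart_inv.
Qed.

(** The velocity at the identity of [k |-> p k] has the right-trivialized components [Ad g kappa.1]
    and [Ad g kappa.2], with [g] the group part of [p]; the pairing then moves [Ad g] to the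
    covectors. *)
Lemma liouville_generator (kappa : g_ * g_) (p : TTG_carrier) :
  liouville A p (TTG_generator A kappa p) =
  pairing (Ad_star A p.1.1^-1%g (p.2.1 - ad_star A p.1.2 p.2.2)) kappa.1 +
  pairing (Ad_star A p.1.1^-1%g p.2.2) kappa.2.
Proof.
pose c := chart_inv (TG A) (1%g, 0); pose y0 := chart (TG A) (1%g, 0) (1%g, 0).
have Uy : chart_image (TG A) (1%g, 0) y0 by exact: chart_image_self.
have pc : plot (TG A) (chart_image (TG A) (1%g, 0)) c by exact: plot_chart_inv.
have cy : c y0 = (1%g, 0) by apply: chartK; exact: chart_domP.
have pP : plot (TTG A) (chart_image (TG A) (1%g, 0)) (TTG_act A p \o c) by apply: plot_TG_mull; exact: pc.
have e : TTG_generator A kappa p = velocity (TTG A) (TTG_act A p \o c) y0 kappa.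
  exact: (tangent_mapE _ _ (smooth_map_TTG_act p)).
have py : (TTG_act A p \o c) y0 = p.
  case: p {pP e} => [[g xi] m]; rewrite /= cy /TTG_act /TG_mul /= mulg1.
  by rewrite (lin0 (Ad_linear A g)) addr0.
have pc1 : plot A (chart_image (TG A) (1%g, 0)) (fun z => (c z).1).
  by have [] := proj1 (plot_TG A _ c) pc.
have e0 : logd A (fun z => (c z).1) y0 kappa = kappa.1.
  have e0 := velocity_TG kappa pc Uy; rewrite velocity_chart_inv in e0.
  rewrite [in RHS]e0; exact/esym/velocity_at1/(congr1 fst cy).
have e1 : logd A (fun z => (p.1.1 * (c z).1)%g) y0 kappa = Ad A p.1.1 kappa.1.
  have pg : plot A (chart_image (TG A) (1%g, 0)) (fun=> p.1.1) by apply: plot_const; exact: plot_open pc.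
  apply: (eq_trans (logd_mul hG _ pg pc1 Uy)).
  by rewrite logd_const add0r e0.
have e2 : 'D_kappa (fun z => p.1.2 + Ad A p.1.1 (c z).2) y0 = Ad A p.1.1 kappa.2.
  have [L eL] : exists L : {linear (g_ * g_)%type -> g_}, (fun z => Ad A p.1.1 z.2) = L.
    by apply: lin_pack => a u v; exact: Ad_linear.
  have cL : continuous L by exact: findim_lin_cont.
  have dL : differentiable L y0 by exact: linear_differentiable.
  have e2 := deriveD (diff_derivable (v := kappa) (differentiable_cst p.1.2 y0))
    (diff_derivable (v := kappa) dL).
  apply: (eq_trans _ (eq_trans e2 _)); first by rewrite -eL.
  by rewrite derive_cst add0r derive_lin // -eL.
have := liouville_velocity kappa pP Uy; rewrite py -e => ->.
rewrite /liouville_plot py.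
rewrite -(pairing_AdV T p.1.1) -(pairing_AdV T p.1.1 p.2.2) -e1 -e2.
by [].
Qed.

End generator.

End cotangent_bundle.

(** * The level sets and the canonical symplectic form *)

Section momentum_and_form.
Context {R : realType} {n : nat} {G : groupType} (A : manifold 'rV[R]_n G).
Context (hG : lie_group A).
Local Notation g_ := 'rV[R]_n.
Local Notation g_dual := 'cV[R]_n.
Local Notation TTG_carrier := (G * g_ * (g_dual * g_dual))%type.
Local Notation TTG_model := (g_ * g_ * (g_dual * g_dual))%type.
Let T := lie_group_adjoint_theory hG.

(** Bookkeeping for [ext_deriv_liouville_plot]: [s = s'] will be the symmetry of second derivatives
    of the Lie algebra component, [p - q = b] the Maurer-Cartan equation. *)
Lemma pairing_antisym (a c d N1 a' c' d' N1' K N : g_dual) (l p s w l' q s' w' b : g_) :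
  s = s' -> p - q = b ->
  pairing (a - (c + d)) l + pairing K p + (pairing N s + pairing N1 w) -
  (pairing (a' - (c' + d')) l' + pairing K q + (pairing N s' + pairing N1' w')) =
  pairing (a - d - c) l - pairing (a' - d' - c') l' + pairing K b + pairing N1 w - pairing N1' w'.
Proof. move=> -> <-; rewrite !(pairingDl, pairingNl, pairingDr, pairingNr); ring. Qed.

Lemma covector_pairing (mu : g_dual) : covector (pairing mu) = mu.
Proof. by apply: pairing_ext => xi; rewrite covectorE //; exact: pairing_linr. Qed.

Lemma momentumE (p : TTG_carrier) : momentum A p =
  (Ad_star A p.1.1^-1%g (p.2.1 - ad_star A p.1.2 p.2.2), Ad_star A p.1.1^-1%g p.2.2).
Proof.
rewrite /momentum; congr pair; rewrite -[RHS]covector_pairing; congr covector; apply/funext => xi.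
- by apply: (eq_trans (liouville_generator hG _ _)); rewrite pairing0r addr0.
- by apply: (eq_trans (liouville_generator hG _ _)); rewrite pairing0r add0r.
Qed.

Lemma level_setP (p : TTG_carrier) m : level_set (momentum A) m p <-> p.2 = coad A p.1 m.
Proof.
rewrite /level_set /= momentumE; case: p => [[g xi] [mu nu]] /=.
exact: (momentum_coad T).
Qed.

(* Right trivialization of the tangent space of TG at k. *)
Definition TG_triv (k : G * g_) (w : g_ * g_) : g_ * g_ :=
  (TR A k.1^-1%g k.1 w.1, w.2 + ad A k.2 (TR A k.1^-1%g k.1 w.1)).

Lemma TG_logdE (E : normedModType R) {fE : findim E} (U : set E) (k : E -> G * g_) y v :
  plot (TG A) U k -> U y -> TG_logd A k y v = TG_triv (k y) (velocity (TG A) k y v).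
Proof.
move=> pk Uy; rewrite (velocity_TG v pk Uy) /TG_triv /TG_logd.
move: pk => /plot_TG [p1 _].
by rewrite -(logd_TR hG v p1 Uy).
Qed.

Section plot.
Context (E : normedModType R) {fE : findim E} (U : set E) (P : E -> TTG_carrier).
Context (pP : plot (TTG A) U P).
Let g z := (P z).1.1.
Let xi z := (P z).1.2.
Let M z := (P z).2.1.
Let N z := (P z).2.2.

Let pg : plot A U g. Proof. by move: pP => /plot_TTG [/plot_TG []]. Qed.
Let sxi : smooth_on U xi. Proof. by move: pP => /plot_TTG [/plot_TG []]. Qed.
Let s3 : smooth_on U (fun z => (P z).2). Proof. by move: pP => /plot_TTG []. Qed.
Let oU : open U. Proof. exact: plot_open pP. Qed.
Let sM : smooth_on U M.
Proof.
apply: (smooth_on_comp (f := fun z => (P z).2) (g := fst) (B := setT)) => //; first exact: openT.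
exact: smooth_on_fst.
Qed.
Let sN : smooth_on U N.
Proof.
apply: (smooth_on_comp (f := fun z => (P z).2) (g := snd) (B := setT)) => //; first exact: openT.
exact: smooth_on_snd.
Qed.

Lemma derive_liouville_plot y u v : U y ->
  'D_u (liouville_plot A P v) y =
  pairing ('D_u M y - (ad_star A (xi y) ('D_u N y) + ad_star A ('D_u xi y) (N y)))
    (logd A g y v) +
  pairing (M y - ad_star A (xi y) (N y)) ('D_u (fun z => logd A g z v) y) +
  (pairing (N y) ('D_u ('D_v xi) y) + pairing ('D_u N y) ('D_v xi y)).
Proof.
move=> Uy.
have dM := smooth_on_differentiable sM Uy.
have dN := smooth_on_differentiable sN Uy.
have dxi := smooth_on_differentiable sxi Uy.
have dDxi := smooth_on_differentiable (smooth_on_D v sxi) Uy.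
have dl : differentiable (fun z => logd A g z v) y.
  exact: smooth_on_differentiable (logd_smooth hG pg v) Uy.
have [da ea] := derive_bilin u (ad_star_bilin T) dxi dN.
have dM' := differentiableB dM da.
have eM' := deriveB (diff_derivable (v := u) dM) (diff_derivable (v := u) da).
have [d1 e1] := derive_bilin u pairing_bilin dM' dl.
have [d2 e2] := derive_bilin u pairing_bilin dN dDxi.
have e := deriveD (diff_derivable (v := u) d1) (diff_derivable (v := u) d2).
apply: (eq_trans e); apply: (eq_trans (congr2 +%R e1 e2)).
congr (_ + _); apply: (eq_trans (addrC _ _)); congr (_ + _).
congr (pairing _ _); apply: (eq_trans eM').
by congr (_ - _).
Qed.

Lemma ext_deriv_liouville_plot y u v : U y ->
  'D_u (liouville_plot A P v) y - 'D_v (liouville_plot A P u) y =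
  pairing ('D_u M y - ad_star A ('D_u xi y) (N y) - ad_star A (xi y) ('D_u N y)) (logd A g y v)
  - pairing ('D_v M y - ad_star A ('D_v xi y) (N y) - ad_star A (xi y) ('D_v N y)) (logd A g y u)
  + pairing (M y - ad_star A (xi y) (N y)) (ad A (logd A g y u) (logd A g y v))
  + pairing ('D_u N y) ('D_v xi y) - pairing ('D_v N y) ('D_u xi y).
Proof.
move=> Uy.
have mc : 'D_u (fun z => logd A g z v) y - 'D_v (fun z => logd A g z u) y =
    ad A (logd A g y u) (logd A g y v) by rewrite (adE hG); exact: maurer_cartan pg y u v Uy.
have sw : 'D_u ('D_v xi) y = 'D_v ('D_u xi) y.
  exact: (schwarz u v _ oU Uy ((smooth_onP U xi).1 sxi 2%N)).
apply: (eq_trans (congr2 (fun a b : R => a - b) (derive_liouville_plot u v Uy)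
  (derive_liouville_plot v u Uy))).
exact: pairing_antisym sw mc.
Qed.

Lemma velocity_TTG_components w y : U y -> let w' := velocity (TTG A) P y w in
  [/\ logd A g y w = TR A (g y)^-1%g (g y) w'.1.1, 'D_w xi y = w'.1.2,
      'D_w M y = w'.2.1 & 'D_w N y = w'.2.2].
Proof.
move=> Uy; rewrite (velocity_TTG w pP Uy).
have d3 := smooth_on_differentiable s3 Uy.
have proj (L : g_dual * g_dual -> g_dual) : linear L ->
    'D_w (fun z => L (P z).2) y = L ('D_w (fun z => (P z).2) y).
  move=> /lin_pack [L' ->]; have cL : continuous L' by exact: findim_lin_cont.
  exact: derive_lin_comp w cL d3.
split=> //; [exact: logd_TR pg Uy|exact: (proj fst)|exact: (proj snd)].
Qed.

End plot.

(** The two hypotheses say that [u] and [v] are tangent to the graph of an orbit map through [p], as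
    all vectors tangent to a level set are. *)
Lemma Omega_TTG_orbit (p : TTG_carrier) (u v : TTG_model) :
  let ku := TG_triv p.1 u.1 in let kv := TG_triv p.1 v.1 in
  u.2 = orbit_vector A p.2 ku -> v.2 = orbit_vector A p.2 kv ->
  Omega_TTG A p u v = pairing p.2.1 (ad A kv.1 ku.1) +
    pairing p.2.2 (ad A kv.1 ku.2 - ad A ku.1 kv.2).
Proof.
move=> ku kv eu ev; subst ku kv.
pose P := chart_inv (TTG A) p; pose y := chart (TTG A) p p.
have pP : plot (TTG A) (chart_image (TTG A) p) P by exact: plot_chart_inv.
have Uy : chart_image (TTG A) p y by exact: chart_image_self.
have Py : P y = p by apply: chartK; exact: chart_domP.
(* Near [y] and not only at [y], since the form is differentiated in the chart. *)
have near_l w : \forall z \near y, local1 (TTG A) (liouville A) p w z = liouville_plot A P w z.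
  have := near_open (chart_image_open (TTG A) p) Uy; apply: filterS => z Uz.
  by rewrite /local1 chart_vectorE //; exact: (liouville_velocity hG w pP Uz).
have eO : Omega_TTG A p u v = 'D_u (liouville_plot A P v) y - 'D_v (liouville_plot A P u) y.
  by rewrite /Omega_TTG /ext_deriv1; congr (_ - _); apply: near_eq_derive; exact: near_l.
rewrite eO (ext_deriv_liouville_plot pP u v Uy).
have d w : [/\ logd A (fun z => (P z).1.1) y w = TR A p.1.1^-1%g p.1.1 w.1.1,
    'D_w (fun z => (P z).1.2) y = w.1.2, 'D_w (fun z => (P z).2.1) y = w.2.1 &
    'D_w (fun z => (P z).2.2) y = w.2.2].
  have := velocity_TTG_components pP w Uy; cbv zeta.
  by rewrite velocity_chart_inv Py.
have [u1 u2 u3 u4] := d u; have [v1 v2 v3 v4] := d v.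
move: eu ev; rewrite u1 u2 u3 u4 v1 v2 v3 v4 /orbit_vector /TG_triv Py.
move: (TR _ _ _ _) (TR _ _ _ _) => au av.
case: u {eO u1 u2 u3 u4} => [[u1 du] [Mu Nu]]; case: v {v1 v2 v3 v4} => [[v1 dv] [Mv Nv]] /=.
move=> [e1 e2] [e3 e4]; exact: (liouville_differential_orbit T e1 e2 e3 e4).
Qed.

End momentum_and_form.

(** * Images of maps of constant rank *)

Section linear_isomorphisms.
Context {R : realType}.
Implicit Types E F H : normedModType R.

Definition linear_iso E F (f : E -> F) :=
  linear f /\ exists g : F -> E, [/\ linear g, cancel f g & cancel g f].

Lemma linear_iso_comp E F H (f : E -> F) (g : F -> H) :
  linear_iso f -> linear_iso g -> linear_iso (g \o f).
Proof.
move=> [lf [f' [lf' fK f'K]]] [lg [g' [lg' gK g'K]]]; split.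
  by move=> a u v /=; rewrite lf lg.
exists (f' \o g'); split; first by move=> a u v /=; rewrite lg' lf'.
- by move=> x /=; rewrite gK fK.
- by move=> x /=; rewrite f'K g'K.
Qed.

Lemma linear_iso_mx n (f : 'rV[R]_n -> 'rV[R]_n) : linear_iso f ->
  exists2 P : 'M[R]_n, P \in unitmx & forall u, f u = u *m P.
Proof.
move=> [/lin_pack [L ->] [g [/lin_pack [L' ->] fK gK]]].
exists (lin1_mx L); last by move=> u; rewrite mul_rV_lin1.
have e : lin1_mx L *m lin1_mx L' = 1%:M.
  by apply/row_matrixP => i; rewrite !rowE mulmxA !mul_rV_lin1 /= fK mulmx1.
by have [] := mulmx1_unit e.
Qed.

Lemma linear_iso_rank N M (J J0 : 'M[R]_(N, M)) (a : 'rV[R]_N -> 'rV[R]_N) (b : 'rV[R]_M -> 'rV[R]_M) :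
  linear_iso a -> linear_iso b -> (forall u, u *m J = b (a u *m J0)) -> \rank J = \rank J0.
Proof.
move=> /linear_iso_mx [P uP aE] /linear_iso_mx [Q uQ bE] h.
have -> : J = P *m J0 *m Q.
  by apply/row_matrixP => i; rewrite !rowE h bE aE mulmxA mulmxA.
rewrite mxrankMfree ?row_free_unit // eqmxMfull // row_full_unit //.
Qed.

End linear_isomorphisms.

Section manifold_charts.
Context {R : realType} (F : normedModType R) (M : Type) (A : manifold F M).
Context {fF : findim F}.

Lemma mopen_locally (W : set M) :
  (forall x, W x -> exists W', [/\ mopen A W', W' x & W' `<=` W]) -> mopen A W.
Proof.
move=> h p; apply: open_locally => y [x [px Wx] <-].
have [W' [oW' W'x sW]] := h x Wx.
exists (chart A p @` (chart_dom A p `&` W')); split=> //; first by exists x.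
by move=> _ [z [pz Wz] <-]; exists z => //; split=> //; exact: sW.
Qed.

Lemma mopen_chart_preimage p (W : set F) : open W ->
  mopen A (chart_dom A p `&` chart A p @^-1` W).
Proof.
move=> oW q; rewrite setIA.
have -> : chart A q @` ((chart_dom A q `&` chart_dom A p) `&` chart A p @^-1` W) =
    (chart A q @` (chart_dom A q `&` chart_dom A p)) `&` (chart A p \o chart_inv A q) @^-1` W.
  apply/seteqP; split=> [_ [x [[qx px] Wx] <-]|_ [[x [qx px] <-] /=]].
    by split; [exists x|rewrite /= chartK].
  by rewrite chartK // => Wx; exists x.
apply: continuous_open_at => //; first exact: chart_open.
by move=> x; apply: smooth_cont; exact: chart_smooth.
Qed.

(** The two transition maps between the charts at [p] and at the point itself are mutually inverse
    near that point, hence so are their differentials. *)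
Lemma velocity_chart_inv_iso p x : chart_image A p x -> linear_iso (velocity A (chart_inv A p) x).
Proof.
move=> px; set q := chart_inv A p x.
have pq : plot A (chart_image A p) (chart_inv A p) by exact: plot_chart_inv.
have qp : plot A (chart_image A q) (chart_inv A q) by exact: plot_chart_inv.
have pdq : chart_dom A p q by exact: chart_inv_dom.
have d1 : differentiable (chart A q \o chart_inv A p) x.
  by apply: (plot_differentiable pq px); exact: chart_domP.
have y0 : chart_image A q (chart A q q) by exact: chart_image_self.
have qq : chart_inv A q (chart A q q) = q by apply: chartK; exact: chart_domP.
have d2 : differentiable (chart A p \o chart_inv A q) (chart A q q).
  by apply: (plot_differentiable qp y0); rewrite qq.
have e1 : forall v, velocity A (chart_inv A p) x v = 'd (chart A q \o chart_inv A p) x v.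
  by move=> v; rewrite (velocityE _ pq px).
have c1 : \forall z \near x, (chart A p \o chart_inv A q) ((chart A q \o chart_inv A p) z) = z.
  apply: filterS (plot_near pq px) => z [pz qz] /=.
  by rewrite chartK // chart_invK.
have c2 : \forall z \near chart A q q, (chart A q \o chart_inv A p) ((chart A p \o chart_inv A q) z) = z.
  have /open_nbhs_nbhs : open_nbhs (chart A q q) (chart A q @` (chart_dom A q `&` chart_dom A p)).
    by split; [exact: chart_open|exists q => //; split=> //; exact: chart_domP].
  by apply: filterS => _ [z [qz pz] <-] /=; rewrite (chartK qz) chartK.
have fx : (chart A q \o chart_inv A p) x = chart A q q by [].
have gy : (chart A p \o chart_inv A q) (chart A q q) = x by rewrite /= qq chart_invK.
have D (f : F -> F) z w : (\forall t \near z, f t = t) -> 'D_w f z = w.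
  by move=> h; rewrite (near_eq_derive _ h) derive_id.
split; first by move=> a u v; rewrite !e1 linearP.
exists ('d (chart A p \o chart_inv A q) (chart A q q)); split.
- by move=> a u v; exact: linearP.
- move=> v; rewrite e1 -deriveE // -deriveE // -fx -derive_comp ?fx //; exact: D.
- move=> v; rewrite e1 -deriveE // -deriveE // -[X in 'D__ _ X]gy -derive_comp ?gy //; exact: D.
Qed.

End manifold_charts.

(** * Manifold structure on the image of a map of constant rank *)

Section lindelof.
Context {R : realType} (N : nat) (F : normedModType R) (K : Type) (A : manifold F K).
Context {fF : findim F} (iK : 'rV[R]_N -> F) (iso : linear_iso iK).

Lemma rV_rational_ball (Z : set 'rV[R]_N) z : open Z -> Z z ->
  exists (q : 'rV[rat]_N) (m : nat), ball (map_mx ratr q : 'rV[R]_N) m.+1%:R^-1 z /\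
    ball (map_mx ratr q : 'rV[R]_N) m.+1%:R^-1 `<=` Z.
Proof.
move=> oZ Zz; have /nbhs_ballP [e /= e0 eZ] : nbhs z Z by exact: open_nbhs_nbhs.
have [m _ hm] := near_infty_natSinv_lt (PosNum (divr_gt0 e0 (ltr0Sn R 1))).
have {}hm := hm m (leqnn m); rewrite /= in hm.
have m0 : 0 < m.+1%:R^-1 :> R by rewrite invr_gt0 ltr0Sn.
have qP i : exists q : rat, `|ratr q - z 0 i| < m.+1%:R^-1.
  have [|q] := @rat_in_itvoo R (z 0 i - m.+1%:R^-1) (z 0 i + m.+1%:R^-1).
    by rewrite ltrBlDr -addrA ltrDl addr_gt0.
  rewrite in_itv /= => /andP[q1 q2]; exists q.
  move: q1 q2. move: (m.+1%:R^-1 : R) (z 0 i) (ratr q : R) => d x y.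
  by rewrite ltr_norml => q1 q2; apply/andP; split; lra.
pose q : 'rV[rat]_N := \row_i sval (cid (qP i)).
have bq : ball (map_mx ratr q : 'rV[R]_N) m.+1%:R^-1 z.
  split=> // i j; rewrite ord1 !mxE; exact: svalP (cid (qP j)).
exists q, m; split=> // y qy; apply: eZ.
have := ball_triangle (ball_sym bq) qy; apply: le_ball.
by apply: ltW; rewrite [ltRHS]splitr ltrD.
Qed.

Lemma lindelof (I : choiceType) (i0 : I) (W : I -> set K) :
  (forall i, mopen A (W i)) -> (forall k, exists i, W i k) ->
  exists D : set I, countable D /\ forall k, exists2 i, D i & W i k.
Proof.
move=> oW cW; have [C [cC hC]] := mfd_countable A.
have [liK [jK [ljK iKK jKK]]] := iso.
pose sub (t : K * ('rV[rat]_N * nat)) i := forall z,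
  ball (map_mx ratr t.2.1 : 'rV[R]_N) t.2.2.+1%:R^-1 z ->
  chart_image A t.1 (iK z) /\ W i (chart_inv A t.1 (iK z)).
(* One index for each rational coordinate ball contained in some [W i]; balls contained in none get
   the default [i0]. *)
pose f t := xget i0 [set i | sub t i].
exists (f @` (C `*` setT)); split.
  by apply: sub_countable (card_image_le _ _) _; exact: countableX.
move=> k; have [p Cp pk] := hC k; have [i Wi] := cW k.
pose z0 := jK (chart A p k).
pose Z := iK @^-1` (chart_image A p `&` chart_inv A p @^-1` W i).
have oZ : open Z.
  have pc : plot A (chart_image A p) (chart_inv A p) by exact: plot_chart_inv.
  apply: open_comp; last exact: plot_preimage pc (oW i).
  move=> x _; have [L eL] := lin_pack liK; rewrite eL; exact: findim_lin_cont.
have Zz0 : Z z0 by rewrite /Z /z0 /= jKK chartK //; split=> //; exact: chart_imageP.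
have [q [m [bz bZ]]] := rV_rational_ball oZ Zz0.
have /xgetPex h : exists i, sub (p, (q, m)) i by exists i => z /bZ [].
exists (f (p, (q, m))); first by exists (p, (q, m)).
by have [_] := h i0 z0 bz; rewrite /= /z0 jKK chartK.
Qed.

End lindelof.

Section image_manifold.
Context {R : realType} (N M : nat) (EK V : normedModType R) {fE : findim EK} {fV : findim V}.
Context (K : Type) (C : manifold EK K) (phi : K -> V).
Context (iK : 'rV[R]_N -> EK) (isoK : linear_iso iK) (iV : V -> 'rV[R]_M) (isoV : linear_iso iV).
Context (L0 : EK -> V) (linL0 : linear L0).
Context (sphi : smooth_map C (vmanifold V) phi).
(** [equi] forces the differential of [phi] to have the rank of [L0] everywhere. [homog] says that
    two points of one fibre are exchanged by a smooth map preserving [phi], so what is known near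
    one point of a fibre holds near all. *)
Context (equi : forall k, exists a b, [/\ linear_iso a, linear_iso b &
  forall w, tangent_map C (vmanifold V) phi k w = b (L0 (a w))]).
Context (homog : forall k k', phi k = phi k' -> exists tau,
  [/\ smooth_map C C tau, tau k = k' & forall x, phi (tau x) = phi x]).

Let J0 : 'M[R]_(N, M) := lin1_mx (iV \o L0 \o iK).
Let r : nat := \rank J0.

Let J0E u : u *m J0 = iV (L0 (iK u)).
Proof.
have lin : linear (iV \o L0 \o iK).
  by case: isoK isoV => lK _ [lV _] a v w /=; rewrite lK linL0 lV.
have [L eL] := lin_pack lin; rewrite /J0 eL mul_rV_lin1 -eL //.
Qed.

(** The constant rank theorem in coordinates. The map [p] is linear on the whole target, so that it
    can serve as a chart of the image with no choice of preimages. *)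
Lemma slice k0 : exists (B : set K) (V0 : set 'rV[R]_r) (s : 'rV[R]_r -> K) (p : V -> 'rV[R]_r),
  [/\ mopen C B, B k0, linear p & plot C V0 s] /\
  (forall k, B k -> V0 (p (phi k)) /\ phi (s (p (phi k))) = phi k) /\
  (forall y, V0 y -> B (s y) /\ p (phi (s y)) = y).
Proof.
have [lK [jK [ljK iKK jKK]]] := isoK; have [lV [jV [ljV iVK jVK]]] := isoV.
have [LK eK] := lin_pack lK; have [LV eV] := lin_pack lV.
have cK : continuous LK by exact: findim_lin_cont.
have cV : continuous LV by exact: findim_lin_cont.
pose c := chart_inv C k0.
have pc : plot C (chart_image C k0) c by exact: plot_chart_inv.
have oI := plot_open pc.
pose D := iK @^-1` chart_image C k0.
have oD : open D by rewrite /D eK; apply: open_comp => // x _; exact: cK.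
have pD : plot C D (c \o iK).
  by apply: (plot_comp_smooth _ oD _ _ pc) => //; exact: smooth_on_lin.
have sD : smooth_on D (phi \o c \o iK).
  have pp : plot (vmanifold V) D (phi \o (c \o iK)) by exact: plot_comp sphi pD.
  by have [] := proj1 (plot_vmanifold _ _) pp.
pose f := iV \o (phi \o c \o iK).
have sf : smooth_on D f.
  by apply: (smooth_on_comp (B := setT)) => //; [exact: openT|exact: smooth_on_lin].
have rk x : D x -> \rank ('J f x) = r.
  move=> Dx; have [a [b [ia ib tE]]] := equi (c (iK x)).
  have iv : linear_iso (velocity C c (iK x)) by exact: velocity_chart_inv_iso.
  have iK' : linear_iso jK by split=> //; exists iK.
  have iV' : linear_iso jV by split=> //; exists iV.
  apply: (linear_iso_rank (a := jK \o (a \o (velocity C c (iK x) \o iK))) (b := iV \o (b \o jV))).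
  - by apply: linear_iso_comp => //; apply: linear_iso_comp => //; exact: linear_iso_comp.
  - by apply: linear_iso_comp => //; exact: linear_iso_comp.
  move=> u; have df : differentiable f x by exact: smooth_on_differentiable sf Dx.
  rewrite J0E /= iVK jKK -tE -deriveEjacobian //.
  have dD := smooth_on_differentiable sD Dx.
  have e1 := derive_lin_comp u cV dD; rewrite -eV in e1; apply: (eq_trans e1); congr iV.
  have e2 : velocity (vmanifold V) (phi \o (c \o iK)) x u =
    tangent_map C (vmanifold V) phi (c (iK x)) (velocity C (c \o iK) x u).
    exact: velocity_smooth_map u sphi pD Dx.
  apply: (eq_trans e2); congr tangent_map.
  have dK : differentiable iK x by rewrite eK; exact: linear_differentiable.
  rewrite (velocity_comp u pc Dx dK); congr (velocity _ _ _ _).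
  by rewrite [in LHS]eK derive_lin // eK.
pose x0 := jK (chart C k0 k0).
have Dx0 : D x0 by rewrite /D /x0 /= jKK; exact: chart_image_self.
have [B [V0 [s [P [[oB Bx0 BD oV0 sV0] [h1 h2]]]]]] := constant_rank oD Dx0 sf rk.
pose p (v : V) := iV v *m P.
exists (chart_dom C k0 `&` chart C k0 @^-1` (jK @^-1` B)), V0, (c \o iK \o s), p; split; last split.
- split.
  + apply: mopen_chart_preimage.
    have [LJ eJ] := lin_pack ljK; rewrite eJ; apply: open_comp => // x _; exact: findim_lin_cont.
  + by split=> //; exact: chart_domP.
  + by move=> a u v; rewrite /p lV mulmxDl -scalemxAl.
  + by apply: (plot_comp_smooth _ oV0 _ sV0 pD) => y /h2 [/BD].
- move=> k [dk Bk]; have [V0k fk] := h1 _ Bk.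
  have fE' : f (jK (chart C k0 k)) = iV (phi k) by rewrite /f /= jKK /c chartK.
  by rewrite fE' in V0k fk; split=> //; apply: (can_inj iVK); rewrite -[RHS]fk.
- move=> y Vy; have [By fy] := h2 _ Vy; split=> //.
  have Ds := BD _ By; split; first exact: chart_inv_dom.
  by rewrite /= /c chart_invK // iKK.
Qed.

Let is_slice k (t : set K * set 'rV[R]_r * ('rV[R]_r -> K) * (V -> 'rV[R]_r)) :=
  [/\ mopen C t.1.1.1, t.1.1.1 k, linear t.2 & plot C t.1.1.2 t.1.2] /\
  (forall k, t.1.1.1 k -> t.1.1.2 (t.2 (phi k)) /\ phi (t.1.2 (t.2 (phi k))) = phi k) /\
  (forall y, t.1.1.2 y -> t.1.1.1 (t.1.2 y) /\ t.2 (phi (t.1.2 y)) = y).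

Let slice_ex k : exists t, is_slice k t.
Proof. by have [B [V0 [s [p h]]]] := slice k; exists (B, V0, s, p). Qed.

Local Notation X := (range phi).

Definition image_map (k : K) : X := SigSub (mem_set (imageP phi (I : setT k))).

Let pt_ex (x : X) : exists k, phi k = set_val x.
Proof. by have [k _ h] := set_valP x; exists k. Qed.
Let pt x : K := sval (cid (pt_ex x)).
Let ptE x : phi (pt x) = set_val x. Proof. exact: svalP (cid (pt_ex x)). Qed.

Let sl x := sval (cid (slice_ex (pt x))).
Let Bs x : set K := (sl x).1.1.1.
Let Vs x : set 'rV[R]_r := (sl x).1.1.2.
Let ss x : 'rV[R]_r -> K := (sl x).1.2.
Let ps x : V -> 'rV[R]_r := (sl x).2.
Let slP x : is_slice (pt x) (sl x). Proof. exact: svalP (cid (slice_ex (pt x))). Qed.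
Let oB x : mopen C (Bs x). Proof. by have [[]] := slP x. Qed.
Let Bpt x : Bs x (pt x). Proof. by have [[]] := slP x. Qed.
Let lp x : linear (ps x). Proof. by have [[]] := slP x. Qed.
Let pss x : plot C (Vs x) (ss x). Proof. by have [[]] := slP x. Qed.
Let sK1 x k : Bs x k -> Vs x (ps x (phi k)) /\ phi (ss x (ps x (phi k))) = phi k.
Proof. by have [_ [h _]] := slP x; exact: h. Qed.
Let sK2 x y : Vs x y -> Bs x (ss x y) /\ ps x (phi (ss x y)) = y.
Proof. by have [_ [_ h]] := slP x; exact: h. Qed.
Let oVs x : open (Vs x). Proof. exact: plot_open (@pss x). Qed.

Let X_inj (x y : X) : set_val x = set_val y -> x = y. Proof. exact: val_inj. Qed.

(* The chart at x is the linear map of a slice through a chosen preimage of x. *)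
Let dom (x : X) : set X :=
  [set z | Vs x (ps x (set_val z)) /\ phi (ss x (ps x (set_val z))) = set_val z].
Let ch (x z : X) : 'rV[R]_r := ps x (set_val z).
Let inv (x : X) (y : 'rV[R]_r) : X := image_map (ss x y).

Let domP x : dom x x.
Proof. by rewrite /dom /= -ptE; exact: sK1 (Bpt x). Qed.

Let chK x z : dom x z -> inv x (ch x z) = z.
Proof. by move=> [_ h]; exact: X_inj. Qed.

Let inv_dom x y : Vs x y -> dom x (inv x y).
Proof. by move=> Vy; have [_ e] := sK2 Vy; rewrite /dom /inv /= e. Qed.

Let ch_image x (Q : set X) : ch x @` (dom x `&` Q) = Vs x `&` ss x @^-1` (image_map @^-1` Q).
Proof.
apply/seteqP; split=> [_ [z [dz Qz] <-]|y [Vy Qy]].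
  by split; [case: dz|rewrite /preimage /= -/(inv x (ch x z)) chK].
by exists (inv x y); [split=> //; exact: inv_dom|exact: (sK2 Vy).2].
Qed.

(** The slice lives near one preimage only. At another point of the fibre, [homog] moves that point
    into [Bs x] without changing [phi], and the inverse image of [Bs x] is the neighbourhood
    required. *)
Let sat_open x : mopen C (image_map @^-1` dom x).
Proof.
apply: mopen_locally => k [Vk ek].
have [tau [st tk tphi]] := homog (esym ek).
exists (tau @^-1` Bs x); split; first exact: smooth_map_open st (oB x).
  by rewrite /preimage /= tk; exact: (sK2 Vk).1.
by move=> k' /sK1; rewrite !tphi.
Qed.

Let smooth_phi (E : normedModType R) (U : set E) (g : E -> K) : plot C U g -> smooth_on U (phi \o g).
Proof.
move=> pg; have pp : plot (vmanifold V) U (phi \o g) by exact: plot_comp sphi pg.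
by have [] := proj1 (plot_vmanifold _ _) pp.
Qed.

Let smooth_ps (E : normedModType R) (U : set E) (g : E -> K) x :
  plot C U g -> smooth_on U (fun y => ps x (phi (g y))).
Proof.
move=> pg; apply: (smooth_on_comp (f := phi \o g) (B := setT)) => //; [|exact: openT| |].
- exact: plot_open pg.
- exact: smooth_phi.
- exact: smooth_on_lin.
Qed.

Let ch_open p q : open (ch p @` (dom p `&` dom q)).
Proof. by rewrite ch_image; exact: plot_preimage (@pss p) (sat_open q). Qed.

Let ch_smooth p q : smooth_on (ch p @` (dom p `&` dom q)) (ch q \o inv p).
Proof.
rewrite ch_image; apply: (smooth_on_sub (A := Vs p)); first by move=> y [].
exact: smooth_ps (@pss p).
Qed.

Let OA : atlas 'rV[R]_r X := Atlas domP chK ch_open ch_smooth.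

Let val_open (W : set V) : open W -> mopen OA (set_val @^-1` W).
Proof.
move=> oW p; rewrite /= ch_image.
apply: (@continuous_open_at _ _ (phi \o ss p)) => // y Vy; apply: (smooth_cont (A := Vs p)) => //.
exact: smooth_phi (@pss p).
Qed.

Let hausdorff (x y : X) : x <> y -> exists U W : set X,
  [/\ mopen OA U, mopen OA W, U x, W y & U `&` W = set0].
Proof.
move=> xy; have vxy : set_val x <> set_val y :> V by move=> /X_inj.
have [U [W [/mopen_vatlas oU /mopen_vatlas oW Ux Wy UW]]] := mfd_hausdorff (vmanifold V) vxy.
exists (set_val @^-1` U), (set_val @^-1` W); split=> //; [exact: val_open|exact: val_open|].
by apply/seteqP; split=> // z [Uz Wz]; have : (U `&` W) (set_val z) by []; rewrite UW.
Qed.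

Let countable_cover : exists D : set X, countable D /\ forall q, exists2 p, D p & dom p q.
Proof.
(* A nonempty image provides the default index asked by [lindelof], which extracts a countable cover
   upstairs. *)
have [[x0]|X0] := pselect (inhabited X); last first.
  by exists set0; split=> // q; case: X0.
have [|D [cD hD]] := lindelof isoK x0 (fun x => sat_open x).
  by move=> k; exists (image_map k); exact: domP.
exists D; split=> // q; have [p Dp pq] := hD (pt q); exists p => //.
by have <- : image_map (pt q) = q by apply: X_inj; exact: ptE.
Qed.

Let O : manifold 'rV[R]_r X := Manifold hausdorff countable_cover.

Let O_image x : chart_image O x = Vs x.
Proof. by rewrite /chart_image /= -[dom x]setIT ch_image preimage_setT setIT. Qed.

Let smooth_image_map : smooth_map C O image_map.
Proof.
apply/smooth_mapP => k y ky; pose z := image_map (chart_inv C k y).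
have pc : plot C (chart_image C k) (chart_inv C k) by exact: plot_chart_inv.
exists z, (chart_image C k `&` chart_inv C k @^-1` (image_map @^-1` dom z)); split.
- exact: plot_preimage pc (sat_open z).
- by split=> //; exact: domP.
- by [].
- by apply: (smooth_on_sub (A := chart_image C k)); [move=> w []|exact: smooth_ps pc].
Qed.

Let smooth_val : smooth_map O (vmanifold V) set_val.
Proof.
apply/smooth_mapP => x; rewrite O_image; apply/plot_vmanifold; split=> //.
exact: smooth_phi (@pss x).
Qed.

(** The third clause, that inverse charts lift to plots of the source, is what later gives local
    potentials of the orbit form. *)
Theorem image_manifold : exists O : manifold 'rV[R]_r X,
  [/\ immersion O (vmanifold V) set_val, submersion C O image_map &
    forall x, exists s, plot C (chart_image O x) s /\
      forall y, chart_image O x y -> chart_inv O x y = image_map (s y)].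
Proof.
exists O; split.
- split=> // x u v e.
  (* In its chart the inclusion is [phi \o ss x], of which the linear map [ps x] is a left inverse;
     this passes to differentials. *)
  have h w : ps x (tangent_map O (vmanifold V) set_val x w) = w.
    have Vx : Vs x (ch x x) by have [] := domP x.
    have sV := smooth_phi (@pss x).
    have [L eL] := lin_pack (lp x); have cL : continuous L by exact: findim_lin_cont.
    have d := smooth_on_differentiable sV Vx.
    apply: (eq_trans (congr1 (ps x) (tangent_mapE x w smooth_val))).
    have e1 := derive_lin_comp w cL d; rewrite -eL in e1; apply: (eq_trans (esym e1)).
    rewrite -[RHS](derive_id (ch x x) w); apply: near_eq_derive.
    by apply: filterS (near_open (@oVs x) Vx) => y /sK2 [].
  by rewrite -(h u) -(h v) e.
- split=> // k w; set x := image_map k.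
  have [Vx ex] := domP x.
  (* [tau] moves the slice so that it passes through the given [k] rather than through the chosen
     preimage of [x]; it is then a local section at [k]. *)
  have [tau [st tk tphi]] := homog ex.
  have pg : plot C (Vs x) (tau \o ss x) by exact: plot_comp st (@pss x).
  exists (velocity C (tau \o ss x) (ch x x) w).
  have e : velocity O (image_map \o (tau \o ss x)) (ch x x) w =
      tangent_map C O image_map k (velocity C (tau \o ss x) (ch x x) w).
    by rewrite -[in RHS]tk; exact: velocity_smooth_map smooth_image_map pg Vx.
  apply: (eq_trans (esym e)).
  have ep : image_map \o (tau \o ss x) = inv x.
    by apply/funext => y; apply: X_inj; exact: tphi.
  by rewrite ep; exact: (velocity_chart_inv O x w).
- by move=> x; exists (ss x); rewrite O_image; split.
Qed.

End image_manifold.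

(** * Coadjoint orbits *)

Section coadjoint_orbit.
Context {R : realType} {n : nat} {G : groupType} (A : manifold 'rV[R]_n G).
Context (hG : lie_group A).
Local Notation g_ := 'rV[R]_n.
Local Notation g_dual := 'cV[R]_n.
Let T := lie_group_adjoint_theory hG.

Definition TG_inv (k : G * g_) : G * g_ := ((k.1^-1)%g, - Ad A (k.1^-1)%g k.2).

Lemma coad_mul k l m : coad A (TG_mul A k l) m = coad A k (coad A l m).
Proof. exact: (coadM T). Qed.
Lemma coad_one m : coad A (1%g, 0) m = m.
Proof. exact: (coad1 T). Qed.
Lemma coad_invK k m : coad A (TG_inv k) (coad A k m) = m.
Proof. exact: (coadK T). Qed.
Lemma TG_mul_assoc k l q : TG_mul A k (TG_mul A l q) = TG_mul A (TG_mul A k l) q.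
Proof. exact: (TG_mulA T). Qed.
Lemma TG_mul_inv k : TG_mul A k (TG_inv k) = (1%g, 0).
Proof. exact: (TG_mulV T). Qed.
Lemma TG_mul_1l k : TG_mul A (1%g, 0) k = k.
Proof. exact: (TG_1mul T). Qed.
Lemma TG_mul_1r k : TG_mul A k (1%g, 0) = k.
Proof. exact: (TG_mul1 T). Qed.
Lemma coadK_inv k m : coad A k (coad A (TG_inv k) m) = m.
Proof. by rewrite -coad_mul TG_mul_inv coad_one. Qed.

Lemma coad_iso k : linear_iso (coad A k).
Proof.
split; first exact: (coad_lin T k).
exists (coad A (TG_inv k)); split; [exact: (coad_lin T (TG_inv k))|exact: coad_invK|exact: coadK_inv].
Qed.

Lemma Ad_invK g v : Ad A g^-1%g (Ad A g v) = v.
Proof. by rewrite -(AdM_ T) mulVg (Ad1_ T). Qed.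

Lemma AdK_inv g v : Ad A g (Ad A g^-1%g v) = v.
Proof. by rewrite -(AdM_ T) mulgV (Ad1_ T). Qed.

Lemma ad_lin_comp (x : g_) (f : g_ * g_ -> g_) : linear f -> linear (fun w => ad A x (f w)).
Proof. by move=> lf a u v; rewrite (lf a u v); exact: (ad_linr_ T). Qed.

Lemma Ad_lin_comp g (f : g_ * g_ -> g_) : linear f -> linear (fun w => Ad A g (f w)).
Proof. by move=> lf a u v; rewrite (lf a u v); exact: Ad_linear. Qed.

Lemma pair_linear (f h : g_ * g_ -> g_) : linear f -> linear h -> linear (fun w => (f w, h w)).
Proof. by move=> lf lh a u v; rewrite lf lh. Qed.

Lemma add_linear (f h : g_ * g_ -> g_) : linear f -> linear h -> linear (fun w => f w + h w).
Proof. by move=> lf lh a u v; rewrite lf lh scalerDr addrACA. Qed.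

Lemma opp_linear (f : g_ * g_ -> g_) : linear f -> linear (fun w => - f w).
Proof. by move=> lf a u v; rewrite lf opprD scalerN. Qed.

Lemma TR_lin_comp g h (f : g_ * g_ -> g_) : linear f -> linear (fun w => TR A g h (f w)).
Proof. by move=> lf a u v; rewrite (lf a u v); exact: TR_linear. Qed.

Let lin1 : linear (fst : g_ * g_ -> g_). Proof. by []. Qed.
Let lin2 : linear (snd : g_ * g_ -> g_). Proof. by []. Qed.

Lemma TG_triv_iso k : linear_iso (TG_triv A k).
Proof.
have l1 := TR_lin_comp k.1^-1%g k.1 lin1; split.
  apply: pair_linear => //; apply: add_linear => //; exact: ad_lin_comp.
exists (fun z => (TR A k.1 1%g z.1, z.2 - ad A k.2 z.1)); split.
- apply: pair_linear; first exact: TR_lin_comp.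
  by apply: add_linear => //; apply: opp_linear; exact: ad_lin_comp.
- by move=> [w1 w2]; rewrite /TG_triv /= (TRK hG) addrK.
- by move=> [w1 w2]; rewrite /TG_triv /= (TRV hG) subrK.
Qed.

(** The adjoint action of the inverse of [k] on the Lie algebra of the semidirect product; it brings
    orbit vectors at [coad k m] back to [m]. *)
Definition TG_Ad_inv (k : G * g_) (w : g_ * g_) : g_ * g_ :=
  (Ad A k.1^-1%g w.1, Ad A k.1^-1%g (w.2 - ad A k.2 w.1)).

Lemma TG_Ad_inv_iso k : linear_iso (TG_Ad_inv k).
Proof.
split.
  apply: pair_linear; apply: Ad_lin_comp => //.
  by apply: add_linear => //; apply: opp_linear; exact: ad_lin_comp.
exists (fun v => (Ad A k.1 v.1, Ad A k.1 v.2 + ad A k.2 (Ad A k.1 v.1))); split.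
- apply: pair_linear; first exact: Ad_lin_comp.
  by apply: add_linear; [exact: Ad_lin_comp|apply: ad_lin_comp; exact: Ad_lin_comp].
- by move=> [w1 w2]; rewrite /TG_Ad_inv /= !AdK_inv subrK.
- by move=> [w1 w2]; rewrite /TG_Ad_inv /= addrK !Ad_invK.
Qed.

Lemma orbit_vector_coad k m w :
  orbit_vector A (coad A k m) w = coad A k (orbit_vector A m (TG_Ad_inv k w)).
Proof.
apply: esym; apply: (eq_trans (coad_orbit_vector T k m (TG_Ad_inv k w))).
by rewrite /TG_Ad_inv /= !AdK_inv subrK.
Qed.

Section orbit.
Context (m : g_dual * g_dual).
Let phi := coad A ^~ m.

Lemma smooth_map_coad : smooth_map (TG A) (vmanifold (g_dual * g_dual)%type) phi.
Proof.
apply/smooth_mapP => k; have pc : plot (TG A) (chart_image (TG A) k) (chart_inv (TG A) k).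
  exact: plot_chart_inv.
apply/plot_vmanifold; split; first exact: plot_open pc.
exact: (coad_smooth hG m pc).
Qed.

Lemma tangent_map_coad k w : tangent_map (TG A) (vmanifold (g_dual * g_dual)%type) phi k w =
  orbit_vector A (coad A k m) (TG_triv A k w).
Proof.
have pc : plot (TG A) (chart_image (TG A) k) (chart_inv (TG A) k) by exact: plot_chart_inv.
have Uy := chart_image_self (TG A) k.
have cy : chart_inv (TG A) k (chart (TG A) k k) = k by apply: chartK; exact: chart_domP.
apply: (eq_trans (tangent_mapE k w smooth_map_coad)).
apply: (eq_trans (derive_coad hG m w pc Uy)).
rewrite (TG_logdE hG w pc Uy) velocity_chart_inv cy //.
Qed.

Lemma smooth_map_TG_mulr l : smooth_map (TG A) (TG A) (fun k => TG_mul A k l).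
Proof.
apply/smooth_mapP => k; have pc : plot (TG A) (chart_image (TG A) k) (chart_inv (TG A) k).
  exact: plot_chart_inv.
have oU := plot_open pc; move: pc => /plot_TG [p1 s2].
apply/plot_TG; split; first by apply: (plot_mul hG) => //; exact: plot_const.
apply: smooth_on_add => //; exact: (Ad_smooth hG).
Qed.

(** By equivariance the differential of the orbit map at [k] is [orbit_vector A m] between two
    isomorphisms. If [k] and [k'] have the same image, right translation by [k^-1 k'] is the
    required exchange, because this element fixes [m]. *)
Lemma coadjoint_orbit_manifold : exists r (O : manifold 'rV[R]_r (coad_orbit A m)),
  orbit_manifold O /\
  forall x, exists s, plot (TG A) (chart_image O x) s /\
    forall y, chart_image O x y -> chart_inv O x y = orbit_map A m (s y).
Proof.
pose iK (u : 'rV[R]_(n + n)) : (g_ * g_)%type := (lsubmx u, rsubmx u).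
have isoK : linear_iso iK.
  split; first by move=> a u v; rewrite /iK !linearP.
  exists (fun w => row_mx w.1 w.2); split.
  - by move=> a u v; rewrite /= scale_row_mx add_row_mx.
  - by move=> u; rewrite /iK /= hsubmxK.
  - by move=> [w1 w2]; rewrite /iK /= row_mxKl row_mxKr.
pose iV (w : g_dual * g_dual) : 'rV[R]_(n + n) := row_mx w.1^T w.2^T.
have isoV : linear_iso iV.
  split; first by move=> a u v; rewrite /iV !linearP /= scale_row_mx add_row_mx.
  exists (fun u => ((lsubmx u)^T, (rsubmx u)^T)); split.
  - by move=> a u v; rewrite !linearP.
  - by move=> [w1 w2]; rewrite /iV /= row_mxKl row_mxKr !trmxK.
  - by move=> u; rewrite /iV /= !trmxK hsubmxK.
have equi k : exists a b, [/\ linear_iso a, linear_iso b & forall w,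
    tangent_map (TG A) (vmanifold (g_dual * g_dual)%type) phi k w = b (orbit_vector A m (a w))].
  exists (TG_Ad_inv k \o TG_triv A k), (coad A k); split.
  - by apply: linear_iso_comp; [exact: TG_triv_iso|exact: TG_Ad_inv_iso].
  - exact: coad_iso.
  - by move=> w; rewrite tangent_map_coad orbit_vector_coad.
have homog k k' : phi k = phi k' -> exists tau,
    [/\ smooth_map (TG A) (TG A) tau, tau k = k' & forall x, phi (tau x) = phi x].
  move=> e; exists (fun x => TG_mul A x (TG_mul A (TG_inv k) k')); split.
  - exact: smooth_map_TG_mulr.
  - by rewrite TG_mul_assoc TG_mul_inv TG_mul_1l.
  - move=> x; apply: (eq_trans (coad_mul _ _ _)); congr (coad A x _).
    apply: (eq_trans (coad_mul _ _ _)).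
    exact: (eq_trans (congr1 (coad A (TG_inv k)) (esym e)) (coad_invK k m)).
have [Q [h1 h2 h3]] := image_manifold isoK isoV (orbit_vector_lin T m) smooth_map_coad equi homog.
by exists _, Q; split.
Qed.

End orbit.

End coadjoint_orbit.

(** * The symplectic form of the orbit *)

Section orbit_symplectic_form.
Context {R : realType} {n : nat} {G : groupType} (A : manifold 'rV[R]_n G).
Context (hG : lie_group A).
Local Notation g_ := 'rV[R]_n.
Local Notation g_dual := 'cV[R]_n.
Let T := lie_group_adjoint_theory hG.
Local Notation dual2 := (vmanifold (g_dual * g_dual)%type).

Definition orbit_form (x : g_dual * g_dual) (u v : g_ * g_) : R :=
  pairing x.1 (ad A v.1 u.1) + pairing x.2 (ad A v.1 u.2 - ad A u.1 v.2).

Lemma orbit_formE x u v : orbit_form x u v =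
  pairing (orbit_vector A x u).1 v.1 + pairing (orbit_vector A x u).2 v.2.
Proof. exact: (orbit_form_pairing T). Qed.

Lemma orbit_form_anti x u v : orbit_form x u v = - orbit_form x v u.
Proof. exact: (orbit_formC T). Qed.

Lemma orbit_form_wd x u v u' v' : orbit_vector A x u = orbit_vector A x u' ->
  orbit_vector A x v = orbit_vector A x v' -> orbit_form x u v = orbit_form x u' v'.
Proof.
by move=> eu ev; rewrite orbit_formE eu -orbit_formE orbit_form_anti orbit_formE ev -orbit_formE -orbit_form_anti.
Qed.

Lemma derive_fst_comp (E F F' : normedModType R) {fF : findim F} {fF' : findim F'} (f : E -> F * F') y v :
  differentiable f y -> 'D_v (fun z => (f z).1) y = ('D_v f y).1.
Proof.
move=> df; have [L eL] : exists L : {linear (F * F')%type -> F}, fst = L by exact: lin_pack.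
have cL : continuous L by exact: findim_lin_cont.
by have := derive_lin_comp v cL df; rewrite -eL.
Qed.

Lemma derive_snd_comp (E F F' : normedModType R) {fF : findim F} {fF' : findim F'} (f : E -> F * F') y v :
  differentiable f y -> 'D_v (fun z => (f z).2) y = ('D_v f y).2.
Proof.
move=> df; have [L eL] : exists L : {linear (F * F')%type -> F'}, snd = L by exact: lin_pack.
have cL : continuous L by exact: findim_lin_cont.
by have := derive_lin_comp v cL df; rewrite -eL.
Qed.

Section potential.
Context (m : g_dual * g_dual) (E : normedModType R) {fE : findim E} (U : set E).
Context (k : E -> G * g_) (pk : plot (TG A) U k).
Let P z : G * g_ * (g_dual * g_dual) := (k z, coad A (k z) m).

Let pP : plot (TTG A) U P.
Proof. by apply/plot_TTG; split=> //; exact: (coad_smooth hG m pk). Qed.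

(* The pullback of the Liouville form to the graph of the orbit map, a
   potential for the pullback of the orbit form. *)
Definition orbit_potential (v y : E) : R^o := liouville_plot A P v y.

Lemma orbit_form_potential y u v : U y ->
  orbit_form (coad A (k y) m) (TG_logd A k y u) (TG_logd A k y v) =
  'D_u (orbit_potential v) y - 'D_v (orbit_potential u) y.
Proof.
move=> Uy; apply: esym; apply: (eq_trans (ext_deriv_liouville_plot hG pP u v Uy)).
have dc : differentiable (fun z => coad A (k z) m) y.
  exact: smooth_on_differentiable (coad_smooth hG m pk) Uy.
have e w : 'D_w (fun z => coad A (k z) m) y = orbit_vector A (coad A (k y) m) (TG_logd A k y w).
  exact: (derive_coad hG m w pk Uy).
set c := coad A (k y) m in e *; pose a w := logd A (fun z => (k z).1) y w.
pose dx w := 'D_w (fun z => (k z).2) y.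
have e1 w : 'D_w (fun z => (coad A (k z) m).1) y =
    ad_star A (a w) c.1 + ad_star A (dx w + ad A (k y).2 (a w)) c.2.
  exact: eq_trans (derive_fst_comp w dc) (congr1 fst (e w)).
have e2 w : 'D_w (fun z => (coad A (k z) m).2) y = ad_star A (a w) c.2.
  exact: eq_trans (derive_snd_comp w dc) (congr1 snd (e w)).
exact: (liouville_differential_orbit T (e1 u) (e2 u) (e1 v) (e2 v)).
Qed.

Lemma orbit_potential_smooth v : smooth_on U (orbit_potential v).
Proof.
have oU := plot_open pk; have /plot_TG [p1 s2] := pk.
have sc : smooth_on U (fun z => coad A (k z) m) by exact: (coad_smooth hG m pk).
have s31 : smooth_on U (fun z => (coad A (k z) m).1).
  apply: (smooth_on_comp (f := fun z => coad A (k z) m) (g := fst) (B := setT)) => //; first exact: openT.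
  exact: smooth_on_fst.
have s32 : smooth_on U (fun z => (coad A (k z) m).2).
  apply: (smooth_on_comp (f := fun z => coad A (k z) m) (g := snd) (B := setT)) => //; first exact: openT.
  exact: smooth_on_snd.
have sa : smooth_on U (fun z => - ad_star A (k z).2 (coad A (k z) m).2).
  apply: (smooth_on_comp (f := fun z => ad_star A (k z).2 (coad A (k z) m).2) (g := -%R) (B := setT)) => //.
  - exact: openT.
  - exact: (smooth_on_bilin (ad_star_bilin T)).
  - by apply: smooth_on_lin => // a x y; rewrite opprD scalerN.
apply: smooth_on_add => //; apply: (smooth_on_bilin pairing_bilin) => //.
- exact: smooth_on_add.
- exact: (logd_smooth hG p1).
- exact: smooth_on_D.
Qed.

End potential.

Section form.
Context (m : g_dual * g_dual) (r : nat) (O : manifold 'rV[R]_r (coad_orbit A m)).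
Context (hO : orbit_manifold O).
Context (sec : forall x, exists s, plot (TG A) (chart_image O x) s /\
  forall y, chart_image O x y -> chart_inv O x y = orbit_map A m (s y)).
Local Notation incl := (set_val : coad_orbit A m -> g_dual * g_dual).

Let sincl : smooth_map O dual2 incl. Proof. by case: hO => [[]]. Qed.
Let sorb : smooth_map (TG A) O (orbit_map A m). Proof. by case: hO => [_ []]. Qed.

Lemma orbit_mapP (x : coad_orbit A m) : exists k, x = orbit_map A m k.
Proof. have [k _ e] := set_valP x; exists k.
have : incl x = incl (orbit_map A m k) by exact: esym e.
exact: val_inj.
Qed.

Lemma tangent_incl_orbit_map k w : tangent_map O dual2 incl (orbit_map A m k)
    (tangent_map (TG A) O (orbit_map A m) k w) = orbit_vector A (coad A k m) (TG_triv A k w).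
Proof.
apply: (eq_trans _ (tangent_map_coad hG m k w)).
exact/esym/(tangent_map_comp k w sorb sincl).
Qed.

Lemma tangent_incl_linear x : linear (tangent_map O dual2 incl x).
Proof. by move=> a u v; exact: linearP. Qed.

(** The orbit map is a submersion and [TG_triv] is onto, so the images of tangent vectors of TG
    exhaust both sides. *)
Lemma range_tangent_incl (x : coad_orbit A m) :
  range (tangent_map O dual2 incl x) = range (orbit_vector A (incl x)).
Proof.
have [k ->] := orbit_mapP x; have [_ [_ surj]] := hO.
apply/seteqP; split=> [_ [u _ <-]|_ [v _ <-]].
  have [w <-] := surj k u; exists (TG_triv A k w) => //.
  exact/esym/tangent_incl_orbit_map.
have [_ [h [_ _ hK]]] := TG_triv_iso hG k.
exists (tangent_map (TG A) O (orbit_map A m) k (h v)) => //.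
by apply: (eq_trans (tangent_incl_orbit_map k (h v))); rewrite hK.
Qed.

(** Some pair denoting the tangent vector [u]; by [orbit_form_wd] the form does not depend on
    which. *)
Let kap (x : coad_orbit A m) u : g_ * g_ :=
  xget 0 [set v | orbit_vector A (incl x) v = tangent_map O dual2 incl x u].

Let kapE x u : orbit_vector A (incl x) (kap x u) = tangent_map O dual2 incl x u.
Proof.
have : range (orbit_vector A (incl x)) (tangent_map O dual2 incl x u).
  by rewrite -range_tangent_incl; exists u.
move=> [v _ e].
by have /(xgetPex 0) : exists v, [set v | orbit_vector A (incl x) v = tangent_map O dual2 incl x u] v by exists v.
Qed.

Definition Omega_orbit : form2 'rV[R]_r (coad_orbit A m) := fun x u v =>
  orbit_form (incl x) (kap x u) (kap x v).

Lemma Omega_orbitE x u u' v v' :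
  tangent_map O dual2 incl x u = orbit_vector A (incl x) v ->
  tangent_map O dual2 incl x u' = orbit_vector A (incl x) v' ->
  Omega_orbit x u u' = orbit_form (incl x) v v'.
Proof. by move=> e e'; exact: (orbit_form_wd (eq_trans (kapE x u) e) (eq_trans (kapE x u') e')). Qed.

Let Omega_orbit_pairing x u v : Omega_orbit x u v =
  pairing (tangent_map O dual2 incl x u).1 (kap x v).1 +
  pairing (tangent_map O dual2 incl x u).2 (kap x v).2.
Proof.
apply: (eq_trans (orbit_formE (incl x) (kap x u) (kap x v))).
by move: (kapE x u); move: (orbit_vector _ _ _) (tangent_map _ _ _ _ _) => a b ->.
Qed.

(** In a chart the form is the differential of the potential built on a lift [s] of the inverse
    chart; smoothness and closedness follow from this expression. *)
Let local_form p s : plot (TG A) (chart_image O p) s ->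
  (forall y, chart_image O p y -> chart_inv O p y = orbit_map A m (s y)) ->
  forall u v y, chart_image O p y -> local2 O Omega_orbit p u v y =
    'D_u (orbit_potential m s v) y - 'D_v (orbit_potential m s u) y.
Proof.
move=> ps es u v y Uy; apply: (eq_trans _ (orbit_form_potential m ps u v Uy)).
rewrite /local2 (es y Uy).
have e w : tangent_map O dual2 incl (orbit_map A m (s y)) (chart_vector O p y w) =
    orbit_vector A (coad A (s y) m) (TG_logd A s y w).
  have pc : plot O (chart_image O p) (chart_inv O p) by exact: plot_chart_inv.
  rewrite chart_vectorE // -es //.
  apply: (eq_trans (esym (velocity_smooth_map w sincl pc Uy))).
  apply: (eq_trans _ (derive_coad hG m w ps Uy)).
  apply: near_eq_derive; apply: filterS (near_open (@chart_image_open _ _ _ O p) Uy) => z Uz.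
  have h : incl (chart_inv O p z) = coad A (s z) m by rewrite (es z Uz).
  exact: h.
exact: Omega_orbitE (e u) (e v).
Qed.

Let dual_eq0 (t : g_dual * g_dual) :
  (forall v : g_ * g_, pairing t.1 v.1 + pairing t.2 v.2 = 0) -> t = 0.
Proof.
case: t => [t1 t2] h; congr pair; apply: pairing_ext => xi; rewrite (lin0 (pairing_linl xi)).
- by have := h (xi, 0); rewrite /= pairing0r addr0.
- by have := h (0, xi); rewrite /= pairing0r add0r.
Qed.

Lemma Omega_orbit_symplectic : symplectic_form O Omega_orbit.
Proof.
split.
- move=> x a u v z; apply: (eq_trans (Omega_orbit_pairing _ _ _)).
  pose f (p : g_dual * g_dual) := pairing p.1 (kap x z).1 + pairing p.2 (kap x z).2.
  have fl p q : f (a *: p + q) = a * f p + f q.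
    have L1 := pairing_linl (kap x z).1 a p.1 q.1; have L2 := pairing_linl (kap x z).2 a p.2 q.2.
    apply: (eq_trans (congr2 +%R L1 L2)); rewrite /f /=.
    move: (pairing _ _) (pairing _ _) (pairing _ _) (pairing _ _) => b c d e.
    rewrite /GRing.scale /=; ring.
  apply: (eq_trans (congr1 f (tangent_incl_linear x a u v))); apply: (eq_trans (fl _ _)).
  exact: esym (congr2 (fun s t => a * s + t) (Omega_orbit_pairing x u z) (Omega_orbit_pairing x v z)).
- move=> x v; rewrite /Omega_orbit.
  by have /eqP := orbit_form_anti (incl x) (kap x v) (kap x v); rewrite -addr_eq0 -mulr2n mulrn_eq0 => /eqP.
- move=> p u v; have [s [ps es]] := sec p.
  have oU := @chart_image_open _ _ _ O p.
  have sb w w' : smooth_on (chart_image O p) ('D_w (orbit_potential m s w')).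
    by apply: smooth_on_D; exact: orbit_potential_smooth ps w'.
  apply: (smooth_on_ext (f := fun y => 'D_u (orbit_potential m s v) y - 'D_v (orbit_potential m s u) y)) => //.
    by move=> y Uy; apply: esym; exact: local_form.
  apply: smooth_on_add => //.
  apply: (smooth_on_comp (g := -%R) (B := setT)) => //; [exact: openT|].
  by apply: smooth_on_lin => // a x y; rewrite opprD scalerN.
- move=> p u v z; have [s [ps es]] := sec p.
  have oU := @chart_image_open _ _ _ O p.
  pose y := chart O p p; have Uy : chart_image O p y by exact: chart_image_self.
  pose b w := orbit_potential m s w.
  have sb w : smooth_on (chart_image O p) (b w) by exact: orbit_potential_smooth ps w.
  have db w w' : differentiable ('D_w (b w')) y.
    exact: smooth_on_differentiable (smooth_on_D w (sb w')) Uy.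
  (* Closedness is now the vanishing of six second derivatives of the potential, which cancel in
     pairs by symmetry. *)
  have D w1 w2 w3 : 'D_w1 (local2 O Omega_orbit p w2 w3) y =
      'D_w1 ('D_w2 (b w3)) y - 'D_w1 ('D_w3 (b w2)) y.
    apply: (eq_trans _ (deriveB (diff_derivable (v := w1) (db w2 w3)) (diff_derivable (v := w1) (db w3 w2)))).
    by apply: near_eq_derive; apply: filterS (near_open oU Uy) => x Ux; exact: local_form ps es w2 w3 x Ux.
  have S w1 w2 w3 : 'D_w1 ('D_w2 (b w3)) y = 'D_w2 ('D_w1 (b w3)) y.
    exact: (schwarz w1 w2 _ oU Uy ((smooth_onP _ _).1 (sb w3) 2%N)).
  apply: (eq_trans (congr2 +%R (congr2 (fun s t => s - t) (D u v z) (D v u z)) (D z u v))).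
  have alg (a c d a' c' d' : R) : a = a' -> c = c' -> d = d' -> a - c - (a' - d) + (c' - d') = 0.
    by move=> -> -> ->; ring.
  exact: alg (S u v z) (S u z v) (S v z u).
- move=> x u h; have [[_ inj] _] := hO; apply: (inj x).
  apply: (eq_trans _ (esym (lin0 (tangent_incl_linear x)))); apply: dual_eq0 => w.
  (* The orbit vector of any [w] is tangent, so [u] is orthogonal to it; this says that the image of
     [u] in the dual pairs to zero with [w]. *)
  have : range (tangent_map O dual2 incl x) (orbit_vector A (incl x) w).
    by rewrite range_tangent_incl; exists w.
  move=> [v _ ev]; rewrite -(h v).
  apply: esym; apply: (eq_trans (Omega_orbitE (esym (kapE x u)) ev)).
  apply: (eq_trans (orbit_formE _ _ _)).
  by move: (kapE x u); move: (orbit_vector _ _ _) (tangent_map _ _ _ _ _) => a b ->.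
Qed.

End form.

End orbit_symplectic_form.

(** * The reduced space *)

Section transport.
Context {R : realType} (E E' : normedModType R) {fE : findim E} {fE' : findim E'}.
Context (M Y : Type) (A : manifold E M) (L : E -> E') (L' : E' -> E).
Context (lL : linear L) (lL' : linear L') (LK : cancel L L') (L'K : cancel L' L).
Context (F : Y -> M) (F' : M -> Y) (FK : cancel F F') (F'K : cancel F' F).

Let dom p : set Y := F @^-1` chart_dom A (F p).
Let ch p q : E' := L (chart A (F p) (F q)).
Let inv p (x : E') : Y := F' (chart_inv A (F p) (L' x)).

Let domP p : dom p p. Proof. exact: chart_domP. Qed.

Let chK p q : dom p q -> inv p (ch p q) = q.
Proof. by move=> pq; rewrite /inv /ch LK chartK. Qed.

Let contL' x : {for x, continuous L'}.
Proof. by have [l ->] := lin_pack lL'; exact: findim_lin_cont. Qed.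

Let ch_image p (W : set Y) :
  ch p @` (dom p `&` W) = L' @^-1` (chart A (F p) @` (chart_dom A (F p) `&` F' @^-1` W)).
Proof.
apply/seteqP; split=> [_ [y [py Wy] <-]|x [z [pz Wz] e]].
  by exists (F y); [split=> //; rewrite /preimage /= FK|rewrite /ch LK].
by exists (F' z); [split=> //; rewrite /dom /preimage /= F'K|rewrite /ch F'K e L'K].
Qed.

Let mopenF' p (W : set Y) : open (chart A (F p) @` (chart_dom A (F p) `&` F' @^-1` W)) ->
  open (ch p @` (dom p `&` W)).
Proof. by rewrite ch_image => oW; apply: open_comp => // x _; exact: contL'. Qed.

Let F'dom q : F' @^-1` dom q = chart_dom A (F q).
Proof. by apply/seteqP; split=> z; rewrite /dom /preimage /= F'K. Qed.

Let ch_open p q : open (ch p @` (dom p `&` dom q)).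
Proof. by apply: mopenF'; rewrite F'dom; exact: chart_open. Qed.

Let ch_smooth p q : smooth_on (ch p @` (dom p `&` dom q)) (ch q \o inv p).
Proof.
have oD := ch_open p q; rewrite ch_image F'dom in oD *.
set B := chart A (F p) @` _ in oD *.
have oB : open B by exact: chart_open.
apply: (smooth_on_ext (f := L \o ((chart A (F q) \o chart_inv A (F p)) \o L'))) => //.
  by move=> x _; rewrite /ch /inv /= F'K.
apply: (smooth_on_comp (B := setT)) => //; [exact: openT| |exact: smooth_on_lin].
apply: (smooth_on_comp (B := B)) => //; [exact: smooth_on_lin|exact: chart_smooth].
Qed.

Let atl : atlas E' Y := Atlas domP chK ch_open ch_smooth.

Let hausd (p q : Y) : p <> q -> exists U V : set Y,
  [/\ mopen atl U, mopen atl V, U p, V q & U `&` V = set0].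
Proof.
move=> pq; have /(mfd_hausdorff A) [U [V [oU oV Up Vq UV]]] : F p <> F q.
  by move=> /(can_inj FK).
have F'F (W : set M) : F' @^-1` (F @^-1` W) = W.
  by apply/seteqP; split=> z; rewrite /preimage /= F'K.
exists (F @^-1` U), (F @^-1` V); split=> //; try by move=> x; apply: mopenF'; rewrite F'F.
by apply/seteqP; split=> // z [Uz Vz]; have : (U `&` V) (F z) by []; rewrite UV.
Qed.

Let cover : exists D : set Y, countable D /\ forall q, exists2 p, D p & dom p q.
Proof.
have [D [cD hD]] := mfd_countable A; exists (F' @` D); split.
  exact: sub_countable (card_image_le _ _) cD.
move=> q; have [p Dp pq] := hD (F q); exists (F' p); first by exists p.
by rewrite /dom /preimage /= F'K.
Qed.

(** The structure that makes the bijection [F] a diffeomorphism. The linear change of model [L]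
    serves to replace the model of TG by row vectors. *)
Definition transport : manifold E' Y := Manifold hausd cover.

Let t_image p : chart_image transport p = L' @^-1` chart_image A (F p).
Proof. by have := ch_image p setT; rewrite preimage_setT !setIT. Qed.

Lemma smooth_map_transport : smooth_map transport A F.
Proof.
apply/smooth_mapP => p; have oU := @chart_image_open _ _ _ transport p.
have pA : plot A (chart_image A (F p)) (chart_inv A (F p)) by exact: plot_chart_inv.
rewrite t_image in oU *.
apply: (plot_ext (g := chart_inv A (F p) \o L')); first by move=> y _; rewrite /= /inv F'K.
by apply: (plot_comp_smooth _ oU _ _ pA) => //; exact: smooth_on_lin.
Qed.

Lemma smooth_map_transport_inv : smooth_map A transport F'.
Proof.
apply/smooth_mapP => x y Uy; set c := chart_inv A x; pose p := F' (c y).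
have pc : plot A (chart_image A x) c by exact: plot_chart_inv.
have [oD sD] := plot_chart (F p) pc.
exists p, (chart_image A x `&` c @^-1` chart_dom A (F p)); split=> //.
- by split=> //; rewrite /preimage /= /p F'K; exact: chart_domP.
- by move=> z [Uz Dz]; split=> //; rewrite /preimage /= /dom /preimage /= F'K.
apply: (smooth_on_ext (f := L \o (chart A (F p) \o c))) => //.
  by move=> z _; rewrite /= /ch F'K.
apply: (smooth_on_comp (B := setT)) => //; [exact: openT|exact: smooth_on_lin].
Qed.

Lemma diffeomorphism_transport : diffeomorphism transport A F.
Proof.
split; first exact: smooth_map_transport.
by exists F'; split=> //; exact: smooth_map_transport_inv.
Qed.

Lemma tangent_transportK p v :
  tangent_map A transport F' (F p) (tangent_map transport A F p v) = v.
Proof.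
rewrite -[RHS](tangent_map_id transport p v).
have -> : id = F' \o F :> (Y -> Y) by apply/funext => y; rewrite /= FK.
exact/esym/(tangent_map_comp p v smooth_map_transport smooth_map_transport_inv).
Qed.

Lemma tangent_transport_invK x v :
  tangent_map transport A F (F' x) (tangent_map A transport F' x v) = v.
Proof.
rewrite -[RHS](tangent_map_id A x v).
have -> : id = F \o F' :> (M -> M) by apply/funext => y; rewrite /= F'K.
exact/esym/(tangent_map_comp x v smooth_map_transport_inv smooth_map_transport).
Qed.

End transport.

Section transport_forms.
Context {R : realType} (E : normedModType R) {fE : findim E}.
Context (M Y : Type) (A : manifold E M) (F : Y -> M) (F' : M -> Y) (FK : cancel F F') (F'K : cancel F' F).
Let lid : linear (id : E -> E). Proof. by []. Qed.
Let idK : cancel (id : E -> E) id. Proof. by []. Qed.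

Definition transport_id : manifold E Y := transport A lid lid idK idK FK F'K.
Local Notation Q := transport_id.

(** The charts are those of [A] composed with [F], so in preferred charts [F] reads as the identity;
    forms are carried over with unchanged coordinates. *)
Lemma tangent_transport_id p v : tangent_map Q A F p v = v.
Proof.
have pQ : smooth_map Q A F by exact: smooth_map_transport.
apply: (eq_trans (tangent_mapE p v pQ)).
rewrite -[RHS](velocity_chart_inv A (F p) v) /velocity.
have e : F (chart_inv Q p (chart Q p p)) = chart_inv A (F p) (chart A (F p) (F p)) by rewrite /= F'K.
rewrite /= F'K.
by apply: eq_derive => z /=; rewrite F'K.
Qed.

Context (w : form2 E M).

Lemma local2_transport_id p u v x :
  local2 Q (pullback2 Q A F w) p u v x = local2 A w (F p) u v x.
Proof.
rewrite /local2 /pullback2 !tangent_transport_id /= F'K.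
have e u' : chart_vector Q p x u' = chart_vector A (F p) x u'.
  rewrite /chart_vector /= F'K.
  by have -> : (fun q : Y => chart A (chart_inv A (F p) x) (F q)) \o
    (fun x => F' (chart_inv A (F p) x)) = chart A (chart_inv A (F p) x) \o chart_inv A (F p)
    by apply/funext => z /=; rewrite F'K.
by rewrite !e.
Qed.

Lemma symplectic_form_transport_id : symplectic_form A w -> symplectic_form Q (pullback2 Q A F w).
Proof.
have le p u v : local2 Q (pullback2 Q A F w) p u v = local2 A w (F p) u v.
  by apply/funext => x; exact: local2_transport_id.
move=> [h1 h2 h3 h4 h5]; split.
- by move=> p a u v z; rewrite /pullback2 !tangent_transport_id; exact: h1.
- by move=> p v; rewrite /pullback2 !tangent_transport_id; exact: h2.
- move=> p u v; rewrite le; apply: smooth_on_sub (h3 (F p) u v).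
  by move=> _ [q pq <-]; exists (F q).
- by move=> p u v z; rewrite /ext_deriv2 !le; exact: h4.
- move=> p u h; apply: (h5 (F p)) => v; have := h v.
  by rewrite /pullback2 !tangent_transport_id.
Qed.

End transport_forms.

(** * Identification of the reduced space with the orbit *)

Section reduction_of_cotangent.
Context {R : realType} {n : nat} {G : groupType} (A : manifold 'rV[R]_n G).
Context (hG : lie_group A).
Local Notation g_ := 'rV[R]_n.
Local Notation g_dual := 'cV[R]_n.
Local Notation dual2 := (vmanifold (g_dual * g_dual)%type).
Local Notation TTG_carrier := (G * g_ * (g_dual * g_dual))%type.
Local Notation TTG_model := (g_ * g_ * (g_dual * g_dual))%type.
Context (m : g_dual * g_dual).

Definition coad_graph (k : G * g_) : TTG_carrier := (k, coad A k m).

Lemma smooth_map_coad_graph : smooth_map (TG A) (TTG A) coad_graph.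
Proof.
apply/smooth_mapP => k; have pc : plot (TG A) (chart_image (TG A) k) (chart_inv (TG A) k).
  exact: plot_chart_inv.
by apply/plot_TTG; split=> //; exact: (coad_smooth hG m pc).
Qed.

Lemma tangent_coad_graph k w : tangent_map (TG A) (TTG A) coad_graph k w =
  (w, orbit_vector A (coad A k m) (TG_triv A k w)).
Proof.
have sfst : smooth_map (TTG A) (TG A) fst by exact: smooth_map_fst.
have ssnd : smooth_map (TTG A) dual2 snd by exact: smooth_map_snd.
have e1 := tangent_map_comp k w smooth_map_coad_graph sfst.
have e2 := tangent_map_comp k w smooth_map_coad_graph ssnd.
rewrite [LHS]surjective_pairing; congr pair.
- apply: (eq_trans (esym (tangent_map_fst (TG A) dual2 (coad_graph k) _))).
  by apply: (eq_trans (esym (e1 _ _ _))); exact: tangent_map_id.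
- apply: (eq_trans (esym (tangent_map_snd (TG A) dual2 (coad_graph k) _))).
  by apply: (eq_trans (esym (e2 _ _ _))); exact: tangent_map_coad.
Qed.

Local Notation LS := (level_set (momentum A) m).
Local Notation RS := (reduced_space (TTG_act A) (momentum A) (coad A) m).
Local Notation iso_orbit := (isotropy_orbit (TTG_act A) (coad A) m).
Local Notation rproj := (@reduction_proj _ _ _ (TTG_act A) (momentum A) (coad A) m).

Lemma coad_graph_level k : LS (coad_graph k).
Proof. exact/(level_setP hG). Qed.

Lemma level_coad_graph (p : LS) : coad_graph (set_val p).1 = set_val p.
Proof.
have /(level_setP hG) h := set_valP p.
by rewrite [RHS]surjective_pairing; congr pair; exact: esym h.
Qed.

Let FS (p : LS) : G * g_ := (set_val p).1.
Let sig (k : G * g_) : LS := SigSub (mem_set (coad_graph_level k)).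

Let FSK : cancel FS sig.
Proof. move=> p; have h : set_val (sig (FS p)) = set_val p by exact: level_coad_graph. exact: val_inj. Qed.

Let sigK : cancel sig FS. Proof. by []. Qed.

Lemma TTG_act1 p : TTG_act A p (1%g, 0) = p.
Proof. by case: p => k x; rewrite /TTG_act /= (TG_mul_1r hG). Qed.

Lemma TTG_act_level p k : LS p -> isotropy (coad A) m k -> LS (TTG_act A p k).
Proof.
move=> /(level_setP hG) e ik; apply/(level_setP hG); apply: (eq_trans e).
by apply: esym; apply: (eq_trans (coad_mul hG _ _ _)); congr (coad A _ _).
Qed.

Lemma isotropy_orbit_sub p p' : LS p -> LS p' -> p.2 = p'.2 -> iso_orbit p `<=` iso_orbit p'.
Proof.
move=> /(level_setP hG) ep /(level_setP hG) ep' e _ [k ik <-].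
(* The element that carries [p'] to the translate of [p] by [k]; it fixes [m] because [p.1] and
   [p'.1] send [m] to the same point. *)
exists (TG_mul A (TG_inv A p'.1) (TG_mul A p.1 k)).
  apply: (eq_trans (coad_mul hG _ _ _)).
  apply: (eq_trans (congr1 (coad A _) (coad_mul hG _ _ _))).
  apply: (eq_trans (congr1 (fun x => coad A _ (coad A p.1 x)) ik)).
  apply: (eq_trans (congr1 (coad A (TG_inv A p'.1)) (eq_trans (esym ep) (eq_trans e ep')))).
  exact: coad_invK.
rewrite /TTG_act e; congr pair; apply: (eq_trans (TG_mul_assoc hG _ _ _)).
by rewrite (TG_mul_inv hG) (TG_mul_1l hG).
Qed.

Lemma isotropy_orbit_eq p p' : LS p -> LS p' -> iso_orbit p = iso_orbit p' <-> p.2 = p'.2.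
Proof.
move=> lp lp'; split=> [e|e].
  have : iso_orbit p p by exists (1%g, 0); [exact: coad_one|exact: TTG_act1].
  by rewrite e => -[k _ <-].
by apply/seteqP; split; apply: isotropy_orbit_sub.
Qed.

(** The two maps out of the level set have the same fibres, so the representatives chosen below do
    not matter. *)
Lemma reduction_proj_eq (p p' : LS) : rproj p = rproj p' <-> orbit_map A m (FS p) = orbit_map A m (FS p').
Proof.
have lp := set_valP p; have lp' := set_valP p'.
have e2 (q : LS) : (set_val q).2 = set_val (orbit_map A m (FS q)).
  exact: (congr1 snd (esym (level_coad_graph q))).
split=> h.
  have /(isotropy_orbit_eq lp lp') : iso_orbit (set_val p) = iso_orbit (set_val p').
    exact: (congr1 set_val h).
  by rewrite !e2; exact: val_inj.
have e : (set_val p).2 = (set_val p').2 by rewrite !e2 h.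
have /(isotropy_orbit_eq lp lp') : (set_val p).2 = (set_val p').2 by [].
by move=> e'; apply: val_inj.
Qed.

Let rep_ex (q : RS) : exists p, rproj p = q.
Proof.
have [p lp e] := set_valP q; exists (SigSub (mem_set lp)); apply: val_inj; exact: e.
Qed.
Let rep q := sval (cid (rep_ex q)).
Let repE q : rproj (rep q) = q. Proof. exact: svalP (cid (rep_ex q)). Qed.

Let pt_ex (x : coad_orbit A m) : exists k, orbit_map A m k = x.
Proof. by have [k ->] := orbit_mapP x; exists k. Qed.
Let pt x := sval (cid (pt_ex x)).
Let ptE x : orbit_map A m (pt x) = x. Proof. exact: svalP (cid (pt_ex x)). Qed.

Definition reduced_to_orbit (q : RS) : coad_orbit A m := orbit_map A m (FS (rep q)).
Definition orbit_to_reduced (x : coad_orbit A m) : RS := rproj (sig (pt x)).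

Lemma reduced_to_orbit_proj p : reduced_to_orbit (rproj p) = orbit_map A m (FS p).
Proof. by apply/reduction_proj_eq; rewrite repE. Qed.

Lemma orbit_to_reduced_map k : orbit_to_reduced (orbit_map A m k) = rproj (sig k).
Proof. by apply/reduction_proj_eq; rewrite !sigK ptE. Qed.

Lemma reduced_to_orbitK : cancel reduced_to_orbit orbit_to_reduced.
Proof.
by move=> q; rewrite -[in LHS](repE q) reduced_to_orbit_proj orbit_to_reduced_map FSK repE.
Qed.

Lemma orbit_to_reducedK : cancel orbit_to_reduced reduced_to_orbit.
Proof. by move=> x; rewrite -[in LHS](ptE x) orbit_to_reduced_map reduced_to_orbit_proj sigK ptE. Qed.

Let L (w : g_ * g_) : 'rV[R]_(n + n) := row_mx w.1 w.2.
Let L' (u : 'rV[R]_(n + n)) : (g_ * g_)%type := (lsubmx u, rsubmx u).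
Let lL : linear L. Proof. by move=> a u v; rewrite /L /= scale_row_mx add_row_mx. Qed.
Let lL' : linear L'. Proof. by move=> a u v; rewrite /L' !linearP. Qed.
Let LK : cancel L L'. Proof. by move=> [u v]; rewrite /L /L' /= row_mxKl row_mxKr. Qed.
Let L'K : cancel L' L. Proof. by move=> u; rewrite /L /L' /= hsubmxK. Qed.

Let S : manifold 'rV[R]_(n + n) LS := transport (TG A) lL lL' LK L'K FSK sigK.
Let sFS : smooth_map S (TG A) FS. Proof. exact: smooth_map_transport. Qed.
Let ssig : smooth_map (TG A) S sig. Proof. exact: smooth_map_transport_inv. Qed.
Let FS_inj p u v : tangent_map S (TG A) FS p u = tangent_map S (TG A) FS p v -> u = v.
Proof.
have K w : tangent_map (TG A) S sig (FS p) (tangent_map S (TG A) FS p w) = w.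
  exact: tangent_transportK.
by move=> e; rewrite -(K u) e K.
Qed.
Let FS_surj p w : exists u, tangent_map S (TG A) FS p u = w.
Proof.
exists (tangent_map (TG A) S sig (FS p) w).
have : tangent_map S (TG A) FS (sig (FS p)) (tangent_map (TG A) S sig (FS p) w) = w.
  exact: tangent_transport_invK.
by rewrite FSK.
Qed.

Let val_graph : set_val = coad_graph \o FS :> (LS -> TTG_carrier).
Proof. by apply/funext => p; rewrite /= level_coad_graph. Qed.

Let smooth_val : smooth_map S (TTG A) set_val.
Proof. by rewrite val_graph; exact: smooth_map_comp sFS smooth_map_coad_graph. Qed.

Let tangent_val p u : tangent_map S (TTG A) set_val p u =
  (tangent_map S (TG A) FS p u,
   orbit_vector A (coad A (FS p) m) (TG_triv A (FS p) (tangent_map S (TG A) FS p u))).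
Proof.
rewrite val_graph; apply: (eq_trans (tangent_map_comp p u sFS smooth_map_coad_graph)).
exact: tangent_coad_graph.
Qed.

Let embedding_val : embedding S (TTG A) set_val.
Proof.
split; [split=> // p u v|exact: val_inj|].
  move=> e; have e' := eq_trans (esym (tangent_val p u)) (eq_trans e (tangent_val p v)).
  exact: (FS_inj (congr1 fst e')).
(* The projection to TG inverts the graph map, so an open set of the level set is cut out by its
   inverse image under this projection. *)
move=> U oU; exists (fst @^-1` (sig @^-1` U)).
  have sfst : smooth_map (TTG A) (TG A) fst by exact: smooth_map_fst.
  by apply: (smooth_map_open sfst); exact: (smooth_map_open ssig).
by apply/seteqP; split=> p; rewrite /preimage /= -/(FS p) FSK.
Qed.

Section orbit.
Context (r : nat) (O : manifold 'rV[R]_r (coad_orbit A m)) (hO : orbit_manifold O).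
Context (hsymp : symplectic_form O (Omega_orbit O)).
Let sorb : smooth_map (TG A) O (orbit_map A m). Proof. by case: hO => [_ []]. Qed.

Definition reduced_manifold : manifold 'rV[R]_r RS :=
  transport_id O reduced_to_orbitK orbit_to_reducedK.
Local Notation Q := reduced_manifold.
Definition Omega_reduced : form2 'rV[R]_r RS := pullback2 Q O reduced_to_orbit (Omega_orbit O).

Let sF : smooth_map Q O reduced_to_orbit. Proof. exact: smooth_map_transport. Qed.
Let sF' : smooth_map O Q orbit_to_reduced. Proof. exact: smooth_map_transport_inv. Qed.

Let rprojE : rproj = orbit_to_reduced \o (orbit_map A m \o FS).
Proof. by apply/funext => p; rewrite /= orbit_to_reduced_map FSK. Qed.

Let sOFS : smooth_map S O (orbit_map A m \o FS). Proof. exact: smooth_map_comp sFS sorb. Qed.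

Let smooth_rproj : smooth_map S Q rproj.
Proof. by rewrite rprojE; exact: smooth_map_comp sOFS sF'. Qed.

Let tangent_F_rproj p u :
  tangent_map Q O reduced_to_orbit (rproj p) (tangent_map S Q rproj p u) =
  tangent_map (TG A) O (orbit_map A m) (FS p) (tangent_map S (TG A) FS p u).
Proof.
apply: (eq_trans (esym (tangent_map_comp p u smooth_rproj sF))).
have -> : reduced_to_orbit \o rproj = orbit_map A m \o FS.
  by apply/funext => q; exact: reduced_to_orbit_proj.
exact: (tangent_map_comp p u sFS sorb).
Qed.

Let submersion_rproj : submersion S Q rproj.
Proof.
split=> // p w; have [_ [_ surj]] := hO.
have [v ev] := surj (FS p) (tangent_map Q O reduced_to_orbit (rproj p) w).
have [u eu] := FS_surj p v; exists u.
have := tangent_F_rproj p u; rewrite eu ev.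
by rewrite !(tangent_transport_id O reduced_to_orbitK orbit_to_reducedK).
Qed.

(** On both sides the value is the orbit form at the fibre component of [p], evaluated on the
    right-trivialized projections of [u] and [v] to TG. *)
Let pullback_eq : pullback2 S Q rproj Omega_reduced = pullback2 S (TTG A) set_val (Omega_TTG A).
Proof.
apply/funext => p; apply/funext => u; apply/funext => v.
rewrite /pullback2 /Omega_reduced /pullback2 !tangent_F_rproj reduced_to_orbit_proj.
have e := tangent_incl_orbit_map hG hO (FS p).
apply: (eq_trans (Omega_orbitE hG hO (e _) (e _))).
have ep : (set_val p).2 = coad A (FS p) m by exact: (congr1 snd (esym (level_coad_graph p))).
apply: esym; rewrite !tangent_val.
apply: (eq_trans (Omega_TTG_orbit hG _ _)) => /=; rewrite ?ep //.
Qed.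

Lemma MW_reduction_orbit : MW_reduction (TTG A) (Omega_TTG A) Q Omega_reduced.
Proof.
split; first by move=> p k; exact: TTG_act_level.
exists (n + n)%N, S; split; [exact: embedding_val|exact: submersion_rproj| |exact: pullback_eq].
exact: symplectic_form_transport_id.
Qed.

End orbit.

End reduction_of_cotangent.

Theorem proposition4p13 (R : realType) (n : nat) (G : groupType)
    (A : manifold 'rV[R]_n G) (hG : lie_group A) (mu nu : 'cV[R]_n) :
  exists (r : nat)
         (Q : manifold 'rV[R]_r
                (reduced_space (TTG_act A) (momentum A) (coad A) (mu, nu)))
         (Omega_Q : form2 'rV[R]_r _)
         (O : manifold 'rV[R]_r (coad_orbit A (mu, nu)))
         (Omega_O : form2 'rV[R]_r (coad_orbit A (mu, nu)))
         (F : reduced_space (TTG_act A) (momentum A) (coad A) (mu, nu) ->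
              coad_orbit A (mu, nu)),
    [/\ MW_reduction (TTG A) (Omega_TTG A) Q Omega_Q,
        orbit_manifold O /\ symplectic_form O Omega_O,
        diffeomorphism Q O F /\ pullback2 Q O F Omega_O = Omega_Q,
        forall x : coad_orbit A (mu, nu),
          range (tangent_map O (vmanifold _) set_val x) =
          range (orbit_vector A (set_val x)) &
        forall (x : coad_orbit A (mu, nu)) (u u' : 'rV[R]_r)
               (eta zeta eta' zeta' : 'rV[R]_n),
          tangent_map O (vmanifold _) set_val x u =
            orbit_vector A (set_val x) (eta, zeta) ->
          tangent_map O (vmanifold _) set_val x u' =
            orbit_vector A (set_val x) (eta', zeta') ->
          Omega_O x u u' =
            pairing (set_val x).1 (ad A eta' eta) +
            pairing (set_val x).2 (ad A eta' zeta - ad A eta zeta')].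
Proof.
have [r [B [hO sec]]] := coadjoint_orbit_manifold hG (mu, nu).
have hs := Omega_orbit_symplectic hG hO sec.
exists r, (reduced_manifold hG B), (Omega_reduced hG B), B, (Omega_orbit B),
  (reduced_to_orbit (m := (mu, nu))); split.
- exact: MW_reduction_orbit.
- by [].
- by split=> //; exact: diffeomorphism_transport.
- exact: range_tangent_incl.
- move=> x u u' eta zeta eta' zeta' e e'; exact: (Omega_orbitE hG hO e e').
Qed.
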